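(* Let $\theta$ be a classical solution of the 2D quasi-geostrophic equation on the time interval $[0,T_* )$, with velocity $u$ and particle trajectories $X(\alpha,\tau,t)$, and let $\Omega(t)=\|\nabla^{\perp}\theta(\cdot,t)\|_{L^\infty}$. Assume that there is a family of level set segments $L_t$ of $\theta(\cdot,t)$ and $T_0\in[0,T_* )$ such that $$X(L_{t_0},t_0,t)\supseteq L_t\qquad\text{for all } T_0\le t_0<t<T_*.$$ Write $L(t)$ for the arc length of $L_t$, $\xi=\nabla^\perp\theta/|\nabla^\perp\theta|$, and $$\Omega_L(t)=\max_{x\in L_t}|\nabla^\perp\theta(x,t)|,\qquad M(t)=\max_{x\in L_t}|(\nabla\cdot\xi)(x,t)|,\qquad K(t)=\max_{x\in L_t}|(\xi\cdot\nabla\xi)(x,t)|.$$ Also assume that $\Omega(t)$ is monotonically increasing and that $\Omega_L(t)\ge c_0\,\Omega(t)$ for some $0<c_0\le 1$ for all $t\in[T_0,T_* )$. Assume moreover that there exist constants $c_L,C_0>0$ such that (H1') $L(t)\ge c_L$, and (H2) $M(t)L(t)\le C_0$ and $K(t)L(t)\le C_0$. Then the following double exponential estimate holds for $t\in[0,T_* )$ (improving the triple exponential estimate $\log\log\log\Omega(t)\le C_1t+C_2$ that holds when (H1') is weakened to $L(t)\ge c_L/\log\log\Omega(t)$): $$\log\log\Omega(t)\le C_1't+C_2'$$ for some constants $C_1'$ and $C_2'$ independent of time.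
   Context: The 2D quasi-geostrophic (QG) equation for a scalar $\theta(x,t)$, $x\in\mathbb{R}^2$, is $$\theta_t+u\cdot\nabla\theta=0,\qquad \theta|_{t=0}=\theta_0,\qquad u=\nabla^\perp\psi,\qquad \psi=(-\Delta)^{-1/2}(-\theta),$$ where $\nabla^\perp f=(-\partial_{x_2}f,\partial_{x_1}f)^T$ and $(-\Delta)^{-1/2}f(x)=\int e^{2\pi i x\cdot k}\frac{1}{2\pi|k|}\hat f(k)\,dk$ with $\hat f(k)=\int e^{-2\pi i x\cdot k}f(x)\,dx$. The particle trajectory $X(\alpha,\tau,t)$ passing through $\alpha$ at time $\tau$ solves $\partial_tX(\alpha,\tau,t)=u(X(\alpha,\tau,t),t)$, $X(\alpha,\tau,\tau)=\alpha$; for a set $A\subseteq\mathbb{R}^2$, $X(A,\tau,t)=\{X(\alpha,\tau,t):\alpha\in A\}$. A level set segment at time $t$ is a segment (arc) of a level curve $\{x:\theta(x,t)=\text{const}\}$. Along the segments considered $\nabla^\perp\theta$ does not vanish, so that $\xi$, the unit tangent, is well defined; $|\xi\cdot\nabla\xi|$ is the unsigned curvature of the level curve. Conditions (H1') and (H2) are imposed for $t\in[T_0,T_* )$. $\Omega(t)$ is understood to be large enough ($\Omega(t)>e$) for the iterated logarithms to make sense. *)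

(* Defs.v *)
From HB Require Import structures.
From mathcomp Require Import all_boot all_order all_algebra.
From mathcomp Require Import complex.
From mathcomp Require Import all_classical all_reals all_analysis.

Set Implicit Arguments.
Unset Strict Implicit.
Unset Printing Implicit Defensive.

Import Order.TTheory GRing.Theory Num.Theory.
Import numFieldNormedType.Exports.

Local Open Scope classical_set_scope.
Local Open Scope ring_scope.

Section Plane.
Variable R : realType.

(* R^2 is R * R with its product topology and product Lebesgue measure. The
   library norm on R * R is the sup norm, so the Euclidean one is explicit. *)
Definition dot (x y : R * R) : R := x.1 * y.1 + x.2 * y.2.
Definition enorm (x : R * R) : R := Num.sqrt (dot x x).

Definition e1 : R * R := (1, 0).
Definition e2 : R * R := (0, 1).

Definition mu2 := (@lebesgue_measure R \x @lebesgue_measure R)%E.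

Definition grad (f : R * R -> R) (x : R * R) : R * R :=
  ('D_e1 f x, 'D_e2 f x).
Definition gradperp (f : R * R -> R) (x : R * R) : R * R :=
  (- 'D_e2 f x, 'D_e1 f x).
Definition divergence (v : R * R -> R * R) (x : R * R) : R :=
  'D_e1 (fun y => (v y).1) x + 'D_e2 (fun y => (v y).2) x.
Definition advect (w v : R * R -> R * R) (x : R * R) : R * R :=
  (w x).1 *: 'D_e1 v x + (w x).2 *: 'D_e2 v x.

Definition unit_tangent (f : R * R -> R) (x : R * R) : R * R :=
  (enorm (gradperp f x))^-1 *: gradperp f x.

(* The library integrates real and extended-real functions only. *)
Definition cintegrable (g : R * R -> R[i]) : Prop :=
  mu2.-integrable [set: R * R] (fun x => (complex.Re (g x))%:E) /\
  mu2.-integrable [set: R * R] (fun x => (complex.Im (g x))%:E).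
Definition cintegral (g : R * R -> R[i]) : R[i] :=
  Complex (\int[mu2]_x complex.Re (g x)) (\int[mu2]_x complex.Im (g x)).

Definition cexpi (a : R) : R[i] := Complex (cos a) (sin a).

Definition fourier (f : R * R -> R) (k : R * R) : R[i] :=
  cintegral (fun x => cexpi (- (2 * pi * dot x k)) * (f x)%:C%C).

(* At the null set k = 0 the multiplier takes the value 0^-1 = 0. *)
Definition half_symbol (f : R * R -> R) (k : R * R) : R[i] :=
  ((2 * pi * enorm k)^-1)%:C%C * fourier f k.
Definition inv_half_laplacian (f : R * R -> R) (x : R * R) : R[i] :=
  cintegral (fun k => cexpi (2 * pi * dot x k) * half_symbol f k).

(* For real f the integral is real; Re only changes the type. *)
Definition stream_function (th : R * R -> R) (x : R * R) : R :=
  complex.Re (inv_half_laplacian (fun y => - th y) x).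
Definition velocity (th : R * R -> R) : R * R -> R * R :=
  gradperp (stream_function th).

Section Solution.
Variable Tstar : \bar R.

Definition lifespan : set R := [set t | 0 <= t /\ (t%:E < Tstar)%E].

Definition continuous_spacetime (V : topologicalType) (f : R -> R * R -> V) :=
  {within [set p : R * (R * R) | lifespan p.1],
    continuous (fun p : R * (R * R) => f p.1 p.2)}.

(* C^1 in x, jointly with continuity in time; t = 0 is included. *)
Definition C1_in_space (V : normedModType R) (f : R -> R * R -> V) : Prop :=
  [/\ forall t x, lifespan t -> differentiable (f t) x,
      continuous_spacetime f,
      continuous_spacetime (fun t => 'D_e1 (f t))
    & continuous_spacetime (fun t => 'D_e2 (f t))].

Definition sup_grad (th : R -> R * R -> R) (t : R) : \bar R :=
  'N[mu2]_+oo[EFin \o (fun x => enorm (gradperp (th t) x))]%E.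
Definition Omega (th : R -> R * R -> R) (t : R) : R := fine (sup_grad th t).

(* theta is C^2 in x and u is C^1 in x, continuously on [0, Tstar) x R^2, the
   equation holds pointwise on (0, Tstar), the Fourier integrals defining psi
   converge absolutely, and theta is bounded in L^1 and grad theta in L^oo on
   every [0, T] with T < Tstar. No bound uniform up to Tstar is assumed. *)
Record classical_solution (th : R -> R * R -> R) : Prop := ClassicalSolution {
  theta_C1 : C1_in_space th ;
  gradperp_theta_C1 : C1_in_space (fun t => gradperp (th t)) ;
  theta_integrable : forall t, lifespan t ->
    mu2.-integrable [set: R * R] (fun x => (th t x)%:E) ;
  symbol_integrable : forall t, lifespan t ->
    cintegrable (half_symbol (th t)) ;
  stream_differentiable : forall t x, lifespan t ->
    differentiable (stream_function (th t)) x ;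
  velocity_C1 : C1_in_space (fun t => velocity (th t)) ;
  theta_derivable_time : forall t x, 0 < t -> lifespan t ->
    derivable (fun s => th s x) t 1 ;
  transport : forall t x, 0 < t -> lifespan t ->
    derive1 (fun s => th s x) t + dot (velocity (th t) x) (grad (th t) x) = 0 ;
  local_bounds : forall T, lifespan T -> exists B : R,
    forall t, 0 <= t <= T ->
      ('N[mu2]_1[EFin \o th t] <= B%:E)%E /\
      (sup_grad th t <= B%:E)%E }.

(* X a tau t is the position at time t of the particle at a at time tau. *)
Definition trajectories (th : R -> R * R -> R)
    (X : R * R -> R -> R -> R * R) : Prop :=
  forall a tau, lifespan tau ->
    [/\ X a tau tau = a,
        {within lifespan, continuous (X a tau)}
      & forall t, 0 < t -> lifespan t ->
          is_derive t 1 (X a tau) (velocity (th t) (X a tau t))].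

End Solution.

Definition curve_image (g : R -> R * R) : set (R * R) := g @` `[0, 1].

(* Segments are carried by a regular injective C^1 parametrization on [0, 1].
   Two-sided derivatives at the end points cost nothing: g is a function on all
   of R and only its restriction to [0, 1] matters. *)
Definition level_segment (f : R * R -> R) (g : R -> R * R) : Prop :=
  [/\ {in `[0, 1] &, injective g},
      forall s, s \in `[0, 1] -> derivable g s 1 /\ derive1 g s != 0,
      {within `[0, 1], continuous (derive1 g)},
      exists c, forall x, curve_image g x -> f x = c
    & forall x, curve_image g x -> gradperp f x != 0].

Definition arc_length (g : R -> R * R) : R :=
  \int[lebesgue_measure]_(s in `[0, 1]) enorm (derive1 g s).

(* On a compact arc a continuous function attains its supremum. *)
Definition max_on (A : set (R * R)) (f : R * R -> R) : R := sup (f @` A).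

Definition max_gradperp (th : R -> R * R -> R) (g : R -> R -> R * R) (t : R) : R :=
  max_on (curve_image (g t)) (fun x => enorm (gradperp (th t) x)).
Definition max_div_tangent (th : R -> R * R -> R) (g : R -> R -> R * R)
    (t : R) : R :=
  max_on (curve_image (g t)) (fun x => `|divergence (unit_tangent (th t)) x|).
Definition max_curvature (th : R -> R * R -> R) (g : R -> R -> R * R)
    (t : R) : R :=
  max_on (curve_image (g t))
    (fun x => enorm (advect (unit_tangent (th t)) (unit_tangent (th t)) x)).

End Plane.

(* Main.v *)
From HB Require Import structures.
From mathcomp Require Import all_boot all_order all_algebra.
From mathcomp Require Import complex ring lra.
From mathcomp Require Import all_classical all_reals all_analysis measurable_realfun ess_sup_inf.
Require Import Defs.

Set Implicit Arguments.
Unset Strict Implicit.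
Unset Printing Implicit Defensive.

Import Order.TTheory GRing.Theory Num.Theory.
Import numFieldNormedType.Exports.
Local Open Scope classical_set_scope.
Local Open Scope ring_scope.

(** Subordinating [(-Delta)^(-1/2)] to Gaussians and bounding a second difference
    of the Gaussian average of [theta] at scale [s] by the gradient bound [Omega]
    for [s <= 1 / Omega] and by the sup bound of [theta] (which is conserved) for
    larger [s], one gets [|u x - u y| <= C log Omega] for [|x - y| <= 1]: the
    integral over [1 / Omega < s < 1] of [ds / s] is the logarithm.

    Along a level curve the logarithmic derivative of [|grad^perp theta|] is the
    divergence of [xi], so by (H2) this modulus is comparable on [L_t] to its
    maximum, hence to [Omega t]; the curvature bound makes a sub-arc of small but
    fixed length [l] nearly straight.  The backward flow maps a curve with velocity
    [lam grad^perp theta] at time [t1] to one with velocity [lam grad^perp theta]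
    at time [t0], so the chord of that sub-arc is shrunk by [Omega t0 / Omega t1]
    up to a constant.  But its ends separate by at most [C (t1 - t0) log Omega t1].
    Therefore [Omega] grows at most by a constant factor over a time of order
    [1 / log Omega], i.e. [log Omega] grows at most exponentially. *)

(** The stream function is an absolutely convergent Fourier integral, and the velocity is only its
    derivative. No singular kernel is manipulated: one estimates second differences of psi, with one
    increment of size at most 1 and another, [h], that tends to 0 after division by it. The Gaussian
    kernel is a product of one-dimensional ones, so all increments run along the axes. The second
    obstacle is regularity. Neither differentiability of the flow in its starting point nor a time
    derivative of the gradient of theta is assumed. Only the derivative of the flow along a level
    curve is required, and there the solution of the linearized equation is known beforehand:
    grad^perp theta along the trajectory. The flow is run backwards so that the speed of the image
    curve is bounded by [Omega t0], while the geometry of the arc is used at [t1] only. (H1') lets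
    the length [l] be fixed once and for all; the allowed drift is a fixed fraction of [l], which
    gives the admissible time steps a uniform constant. Finally [Omega] is merely monotone, so the
    differential inequality for [log Omega] is replaced by a discrete one: bounded gain per short
    step, hence at most doubling in a fixed time. *)

Section Integration.
Context {R : realType}.
Notation mu := (@lebesgue_measure R).

(** * Integrals of real functions: Fubini and affine substitution *)

Section Fubini.
Context d1 d2 (T1 : measurableType d1) (T2 : measurableType d2).
Variables (m1 : {sigma_finite_measure set T1 -> \bar R})
  (m2 : {sigma_finite_measure set T2 -> \bar R}).

(** Integrability of every section, not of almost every one, makes the inner extended integral
    finite pointwise, so that [fine] can be removed inside the outer integral. *)
Lemma Rintegral_prod1 (F : T1 * T2 -> R) :
  (m1 \x m2)%E.-integrable setT (EFin \o F) ->
  (forall x, m2.-integrable setT (fun y => (F (x, y))%:E)) ->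
  \int[(m1 \x m2)%E]_z F z = \int[m1]_x \int[m2]_y F (x, y).
Proof.
move=> iF iy; rewrite /Rintegral -(integral12_prod_meas1 iF).
congr fine; apply: eq_integral => x _.
by rewrite fineK//; exact: integrable_fin_num (iy x).
Qed.

Lemma Rintegral_prod2 (F : T1 * T2 -> R) :
  (m1 \x m2)%E.-integrable setT (EFin \o F) ->
  (forall y, m1.-integrable setT (fun x => (F (x, y))%:E)) ->
  \int[(m1 \x m2)%E]_z F z = \int[m2]_y \int[m1]_x F (x, y).
Proof.
move=> iF iy; rewrite /Rintegral -(integral21_prod_meas1 iF).
congr fine; apply: eq_integral => x _.
by rewrite fineK//; exact: integrable_fin_num (iy x).
Qed.

Lemma integrable_Rintegral1 (F : T1 * T2 -> R) :
  (m1 \x m2)%E.-integrable setT (EFin \o F) ->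
  (forall x, m2.-integrable setT (fun y => (F (x, y))%:E)) ->
  m1.-integrable setT (fun x => (\int[m2]_y F (x, y))%:E).
Proof.
move=> iF iy; have := integrable_fubini_F iF.
apply: eq_integrable => // x _; rewrite /fubini_F /Rintegral fineK//.
exact: integrable_fin_num (iy x).
Qed.

Lemma integrable_prod_dominated (F : T1 * T2 -> R) (p : T1 -> R) (q : T2 -> R) :
  measurable_fun setT F ->
  m1.-integrable setT (EFin \o p) -> m2.-integrable setT (EFin \o q) ->
  (forall x y, `|F (x, y)| <= p x * q y) ->
  (m1 \x m2)%E.-integrable setT (EFin \o F).
Proof.
move=> mF ip iq Fpq.
have mEF : measurable_fun [set: T1 * T2] (fun z => (F z)%:E).
  exact/measurable_EFinP.
apply/integrable12ltyP => //.
have ip' := integrable_norm ip; have iq' := integrable_norm iq.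
apply: (@le_lt_trans _ _ (\int[m1]_x \int[m2]_y (`|p x| * `|q y|)%:E)%E).
  have mpq : measurable_fun [set: T1 * T2] (fun z => (`|p z.1| * `|q z.2|)%:E).
    apply/measurable_EFinP; apply: measurable_funM.
      by apply: measurableT_comp => //; apply: measurableT_comp => //;
        exact/measurable_EFinP/(measurable_int _ ip).
    by apply: measurableT_comp => //; apply: measurableT_comp => //;
        exact/measurable_EFinP/(measurable_int _ iq).
  apply: ge0_le_integral => //.
  - by move=> x _; apply: integral_ge0.
  - apply: (measurable_fun_fubini_tonelli_F (fun z => `|(F z)%:E|%E)) => //.
    exact: measurableT_comp.
  - by apply: (measurable_fun_fubini_tonelli_F (fun z => (`|p z.1| * `|q z.2|)%:E)) => //= z; rewrite lee_fin mulr_ge0.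
  - move=> x _; apply: ge0_le_integral => //=.
    + apply/measurable_EFinP/measurableT_comp => //.
      exact: (measurableT_comp mF (pair1_measurable x)).
    + apply/measurable_EFinP; apply: measurable_funM => //.
      exact/measurable_EFinP/(measurable_int _ iq').
    + move=> y _; rewrite lee_fin (le_trans (Fpq x y))// -normrM ler_norm//.
have -> : (\int[m1]_x \int[m2]_y (`|p x| * `|q y|)%:E =
   (\int[m1]_x `|p x|%:E) * (\int[m2]_y `|q y|%:E))%E.
  have fq := integrable_fin_num measurableT iq'.
  under eq_integral => x _ do under eq_integral => y _ do rewrite EFinM.
  under eq_integral => x _ do rewrite integralZl//.
  by rewrite -(fineK fq) integralZr//.
by rewrite ltey_eq fin_numM//; apply: integrable_fin_num.
Qed.

End Fubini.

(* The library states changes of variables for nonnegative integrands. *)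
Lemma Rintegral_affine (G H : R -> R) (a b : R) : 0 < a ->
  continuous G -> continuous H -> (forall x, `|G x| <= H x) ->
  mu.-integrable setT (EFin \o H) ->
  mu.-integrable setT (fun x => (G (a * x + b))%:E) /\
  \int[mu]_x G x = a * \int[mu]_x G (a * x + b).
Proof.
move=> a0 cG cH GH iH.
have H0 x : 0 <= H x by apply: le_trans (GH x).
pose F x := a * x + b.
have dF (x : R) : is_derive x 1 F a.
  by rewrite /F; apply: is_derive_eq; rewrite /GRing.scale /=; lra.
have F'E : F^`()%classic = cst a.
  by apply/funext => x; rewrite derive1E; apply: derive_val.
have key (K : R -> R) : continuous K -> (forall x, 0 <= K x) ->
    (\int[mu]_x (K x)%:E = \int[mu]_x (a * K (F x))%:E)%E.
  move=> cK K0.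
  rewrite (@increasing_ge0_integration_by_substitutionT _ F K)//.
  - by apply: eq_integral => x _; rewrite F'E /= mulrC.
  - by move=> x y xy; rewrite /F ltrD2r ltr_pM2l.
  - by rewrite F'E; exact: cst_continuous.
  - by rewrite F'E; exact: is_cvg_cst.
  - by rewrite F'E; exact: is_cvg_cst.
  - apply/cvgrNyPle => A; apply: filterS (nbhs_ninfty_le (num_real ((A - b) / a))) => x.
    by rewrite ler_pdivlMr// /F; lra.
  - apply/cvgryPge => A; apply: filterS (nbhs_pinfty_ge (num_real ((A - b) / a))) => x.
    by rewrite ler_pdivrMr// /F; lra.
have cF : continuous F.
  by move=> x; apply: differentiable_continuous; apply/derivable1_diffP; have [] := dF x.
have mc (K : R -> R) : continuous K -> measurable_fun setT (EFin \o K).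
  by move=> cK; apply/measurable_EFinP; exact: continuous_measurable_fun.
have iHF : mu.-integrable setT (fun x => (a * H (F x))%:E).
  apply/integrableP; split.
    apply: mc; move=> x; apply: cvgM; first exact: cvg_cst.
    exact: (@continuous_comp _ _ _ F H x (cF x) (cH (F x))).
  move/integrableP : iH => [_]; under eq_integral do rewrite /= ger0_norm//.
  by rewrite key//; under [in X in _ -> X]eq_integral do rewrite /= ger0_norm ?mulr_ge0 ?(ltW a0)//.
have cGF : continuous (G \o F).
  by move=> x; exact: (@continuous_comp _ _ _ F G x (cF x) (cG (F x))).
have cHF : continuous (H \o F).
  by move=> x; exact: (@continuous_comp _ _ _ F H x (cF x) (cH (F x))).
have iHF' : mu.-integrable setT (EFin \o (H \o F)).
  have := integrableZl measurableT a^-1 iHF; apply: eq_integrable => // x _ /=.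
  by rewrite -EFinM mulKf// gt_eqF.
have iGF : mu.-integrable setT (EFin \o (G \o F)).
  apply: le_integrable iHF' => //; first exact: mc.
  by move=> x _ /=; rewrite lee_fin [leRHS]ger0_norm.
have iG : mu.-integrable setT (EFin \o G).
  apply: le_integrable iH => //; first exact: mc.
  by move=> x _ /=; rewrite lee_fin [leRHS]ger0_norm.
split; first exact: iGF.
(* Both [G + H] and [H] are nonnegative, since [|G| <= H]; subtracting their two identities leaves
   the one for [G]. *)
have E1 : \int[mu]_x (G x + H x) = a * \int[mu]_x ((G (F x)) + H (F x)).
  rewrite -RintegralZl//; last exact: integrableD iGF iHF'.
  rewrite /Rintegral key//.
    by move=> x; apply: cvgD; [exact: cG|exact: cH].
  by move=> x; have := GH x; rewrite ler_norml => /andP[]; lra.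
have E2 : \int[mu]_x (H x) = a * \int[mu]_x (H (F x)).
  by rewrite -RintegralZl// /Rintegral key.
have := E1; rewrite RintegralD// RintegralD// mulrDr E2.
exact: addIr.
Qed.

End Integration.

(** * Gaussian integrals and Fourier transforms *)

Section GaussianIntegrals.
Context {R : realType}.
Notation mu := (@lebesgue_measure R).

Lemma is_derive1_continuous (f : R -> R) (x df : R) :
  is_derive x 1 f df -> {for x, continuous f}.
Proof.
by move=> dfx; apply: differentiable_continuous; apply/derivable1_diffP; have [] := dfx.
Qed.

(** On [[-(n+1), n+1]] the integral is a difference of boundary values, which the decay assumption
    makes O(1/n); dominated convergence identifies the limit with the integral over the line. *)
Lemma Rintegral_derive0 (phi dphi : R -> R) (C : R) :
  (forall x : R, is_derive x 1 phi (dphi x)) -> continuous dphi ->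
  mu.-integrable setT (EFin \o dphi) -> (forall x, `|phi x * x| <= C) ->
  \int[mu]_x dphi x = 0.
Proof.
move=> dphiE cdphi idphi decay.
have C0 : 0 <= C by apply: le_trans (decay 0).
pose I (n : nat) : set R := `[- n.+1%:R, n.+1%:R]%classic.
have cphi : continuous phi by move=> x; apply: is_derive1_continuous (dphiE x).
have m_int (n : nat) : (\int[mu]_x ((dphi \_ (I n)) x)%:E =
    (phi n.+1%:R - phi (- n.+1%:R))%:E)%E.
  transitivity (\int[mu]_(x in I n) (dphi x)%:E)%E.
    by rewrite [RHS]integral_mkcond; apply: eq_integral => x _; rewrite /= restrict_EFin.
  rewrite (@continuous_FTC2 _ dphi phi).
  - by rewrite EFinB.
  - by rewrite -subr_gt0 opprK addr_gt0.
  - exact: continuous_subspaceT.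
  - split=> [x _| |]; first by have [] := dphiE x.
    + by apply: cvg_at_right_filter; exact: cphi.
    + by apply: cvg_at_left_filter; exact: cphi.
  - by move=> x _; rewrite derive1E derive_val.
have cv1 : (fun n => \int[mu]_x ((dphi \_ (I n)) x)%:E)%E @ \oo -->
    (\int[mu]_x (dphi x)%:E)%E.
  apply: (@dominated_cvg _ _ _ mu setT measurableT
    (fun n x => ((dphi \_ (I n)) x)%:E) _ (fun x => `|dphi x|%:E)) => //.
  - move=> n; apply/measurable_EFinP; apply/(measurable_restrictT _ _).1 => //.
      exact: measurable_itv.
    by apply: measurable_funTS; exact: continuous_measurable_fun.
  - move=> x _; apply: cvg_near_cst; near=> n; rewrite patchE ifT// inE /I /= in_itv /=.
    rewrite -ler_norml; near: n.
    exists (Num.bound `|x|) => // n /= bn; rewrite (le_trans (ltW (archi_boundP (normr_ge0 x))))//.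
    by rewrite ler_nat ltnW.
  - exact: integrable_norm.
  - by move=> n x _; rewrite lee_fin patchE; case: ifP => // _; rewrite normr0.
have cv2 : (fun n => \int[mu]_x ((dphi \_ (I n)) x)%:E)%E @ \oo --> 0%E.
  under eq_fun do rewrite m_int.
  apply: cvg_EFin; first exact: nearW.
  apply/cvgrPdist_le => e e0; near=> n.
  rewrite /= sub0r normrN.
  have n0 : 0 < n.+1%:R :> R by [].
  have ne : 2 * C / e <= n.+1%:R.
    near: n; exists (Num.bound `|2 * C / e|) => // n /= bn.
    rewrite (le_trans (ler_norm _))// (le_trans (ltW (archi_boundP (normr_ge0 _))))//.
    by rewrite ler_nat ltnW.
  have := decay n.+1%:R; have := decay (- n.+1%:R).
  rewrite mulrN normrN !normrM (gtr0_norm n0) => h1 h2.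
  rewrite (le_trans (ler_normB _ _))// -(ler_pM2r n0).
  by move: ne; rewrite ler_pdivrMr// => ne; rewrite mulrDl; lra.
by rewrite /Rintegral (cvg_unique _ cv1 cv2).
Unshelve. all: by end_near. Qed.

End GaussianIntegrals.

Section GaussianTransform.
Context {R : realType}.
Notation mu := (@lebesgue_measure R).

Definition gs (b k : R) : R := expR (- (b * k ^+ 2)).

Lemma gs_gt0 b k : 0 < gs b k. Proof. exact: expR_gt0. Qed.

Lemma gs_le1 b k : 0 <= b -> gs b k <= 1.
Proof. by move=> b0; rewrite -expR0 ler_expR lerNl oppr0 mulr_ge0 ?sqr_ge0. Qed.

Lemma is_derive_gs b (k : R) : is_derive k 1 (gs b) (- (2 * b * k) * gs b k).
Proof.
have d1 : is_derive k 1 (fun k => - (b * k ^+ 2)) (- (2 * b * k)).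
  by apply: is_derive_eq; rewrite /GRing.scale /=; ring.
have := @is_derive1_comp R expR _ k _ _ (is_derive_expR _) d1.
by move=> h; apply: is_derive_eq; rewrite mulrC.
Qed.

Lemma continuous_gs b : continuous (gs b).
Proof. by move=> k; apply: is_derive1_continuous (is_derive_gs b k). Qed.

Lemma gs_integral b : 0 < b ->
  mu.-integrable setT (EFin \o gs b) /\ \int[mu]_k gs b k = Num.sqrt (pi / b).
Proof.
move=> b0; have a0 : 0 < Num.sqrt b by rewrite sqrtr_gt0.
have gE x : gauss_fun (Num.sqrt b * x + 0) = gs b x.
  by rewrite /gauss_fun /gs addr0 exprMn sqr_sqrtr// ltW.
have gEf : (fun x => gauss_fun (Num.sqrt b * x + 0)) = gs b by exact/funext.
have [||i1] := @Rintegral_affine R gauss_fun gauss_fun (Num.sqrt b) 0 a0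
  continuous_gauss_fun continuous_gauss_fun.
- by move=> x; rewrite ger0_norm// gauss_fun_ge0.
- exact: integrableT_gauss.
rewrite gEf => e1; split.
  by move: i1; congr (integrable _ _ _); apply/funext => x /=; rewrite gE.
move: e1; rewrite {1}/Rintegral integralT_gauss /= sqrtrM ?pi_ge0// sqrtrV ?(ltW b0)// => ->.
by rewrite mulrC mulKf// gt_eqF.
Qed.

Lemma gs_half_integral (b : R) : 0 < b ->
  (\int[mu]_(s in `[0%R, +oo[) (gs b s)%:E)%E = (Num.sqrt (pi / b) / 2)%:E.
Proof.
move=> b0; have a0 : 0 < Num.sqrt b by rewrite sqrtr_gt0.
pose F x := Num.sqrt b * x.
have dF (x : R) : is_derive x 1 F (Num.sqrt b).
  by rewrite /F; apply: is_derive_eq; rewrite /GRing.scale /=; lra.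
have F'E : F^`()%classic = cst (Num.sqrt b).
  by apply/funext => x; rewrite derive1E; apply: derive_val.
have F0 : F 0 = 0 by rewrite /F mulr0.
have := @integral0y_gauss R; rewrite -{1}F0.
rewrite (@increasing_ge0_integration_by_substitutiony _ F gauss_fun 0).
- under eq_integral => x _.
    have -> : ((gauss_fun \o F) * F^`()%classic) x = Num.sqrt b * gs b x.
      rewrite F'E -[LHS]/(gauss_fun (F x) * Num.sqrt b).
      by rewrite mulrC /gauss_fun /gs /F exprMn sqr_sqrtr// ltW.
    over.
  under eq_integral do rewrite EFinM.
  rewrite ge0_integralZl//=; first last.
  + by move=> x _; rewrite lee_fin ltW// gs_gt0.
  + apply/measurable_EFinP/measurable_funTS; apply: continuous_measurable_fun.
    exact: continuous_gs.
  move=> /(congr1 (fun x => ((Num.sqrt b)^-1%:E * x)%E)).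
  rewrite muleA -EFinM mulVf ?gt_eqF// mul1e => ->.
  by rewrite -EFinM sqrtrM ?pi_ge0// sqrtrV ?(ltW b0)//; congr EFin; ring.
- by move=> x y _ _ xy; rewrite /F ltr_pM2l.
- by move=> x _; rewrite F'E; exact: cst_continuous.
- by rewrite F'E; exact: is_cvg_cst.
- by rewrite F'E; exact: is_cvg_cst.
- split=> [x _|]; first by have [] := dF x.
  by apply: cvg_at_right_filter; exact: is_derive1_continuous (dF 0).
- apply/cvgryPge => A; apply: filterS (nbhs_pinfty_ge (num_real (A / Num.sqrt b))) => x.
  by rewrite ler_pdivrMr// /F mulrC.
- exact/continuous_subspaceT/continuous_gauss_fun.
- by move=> x _; exact: gauss_fun_ge0.
Qed.

(** Half of the exponent absorbs the factor [|k|], through [|k| <= 1 + k^2] and [1 + x <= exp x]. *)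
Lemma norm_mul_gs_le b k : 0 < b -> `|k| * gs b k <= (1 + 2 / b) * gs (b / 2) k.
Proof.
move=> b0; have -> : gs b k = gs (b / 2) k * gs (b / 2) k.
  by rewrite /gs -expRD; congr expR; lra.
rewrite mulrA ler_pM2r ?gs_gt0//.
have h1 : gs (b / 2) k * expR (b / 2 * k ^+ 2) = 1 by rewrite /gs expRN mulVf// gt_eqF// expR_gt0.
rewrite -(ler_pM2r (expR_gt0 (b / 2 * k ^+ 2))) -[X in X <= _]mulrA h1 mulr1.
have k2 : `|k| <= 1 + k ^+ 2.
  by rewrite -(real_normK (num_real k)); have := sqr_ge0 (`|k| - 1 / 2); nra.
apply: (le_trans k2).
have h2 := expR_ge1Dx (b / 2 * k ^+ 2).
have b2 : 0 <= 1 + 2 / b by rewrite addr_ge0 ?divr_ge0 ?(ltW b0).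
apply: (le_trans _ (ler_wpM2l b2 h2)).
have -> : (1 + 2 / b) * (1 + b / 2 * k ^+ 2) = 1 + k ^+ 2 + (2 / b + b / 2 * k ^+ 2).
  by field; rewrite gt_eqF.
have h3 : 0 <= 2 / b by rewrite divr_ge0// ltW.
have h4 : 0 <= b / 2 * k ^+ 2 by rewrite mulr_ge0 ?sqr_ge0// divr_ge0// ltW.
lra.
Qed.

Lemma integrable_norm_mul_gs b : 0 < b ->
  mu.-integrable setT (fun k => (`|k| * gs b k)%:E).
Proof.
move=> b0; have b20 : 0 < b / 2 by rewrite divr_gt0.
have := integrableZl measurableT (1 + 2 / b) (gs_integral b20).1.
apply: le_integrable => //.
  apply/measurable_EFinP; apply: continuous_measurable_fun => k.
  by apply: cvgM; [exact: norm_continuous|exact: continuous_gs].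
move=> k _; rewrite /= lee_fin ger0_norm ?mulr_ge0 ?(ltW (gs_gt0 _ _))//.
by rewrite (le_trans (norm_mul_gs_le k b0))// ler_norm.
Qed.

Lemma integrable_gs_bounded b (f : R -> R) (M : R) : 0 < b ->
  measurable_fun setT f -> (forall k, `|f k| <= M) ->
  mu.-integrable setT (fun k => (gs b k * f k)%:E).
Proof.
move=> b0 mf fM; have := integrableZl measurableT M (gs_integral b0).1.
apply: le_integrable => //.
  apply/measurable_EFinP/measurable_funM => //.
  by apply: continuous_measurable_fun; exact: continuous_gs.
move=> k _; rewrite /= lee_fin normrM (ger0_norm (ltW (gs_gt0 b k))) mulrC.
by rewrite normrM (ger0_norm (ltW (gs_gt0 b k))) ler_wpM2r ?(ltW (gs_gt0 _ _))// (le_trans (fM k))// ler_norm.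
Qed.

End GaussianTransform.

Section GaussianFourier.
Context {R : realType}.
Notation mu := (@lebesgue_measure R).

Lemma is_derive_cos_affine (c w k : R) :
  is_derive k 1 (fun k => cos (c + w * k)) (- (w * sin (c + w * k))).
Proof.
have d1 : is_derive k 1 (fun k => c + w * k) w.
  by apply: is_derive_eq; rewrite /GRing.scale /=; lra.
have h := @is_derive1_comp R cos _ k _ _ (is_derive_cos _) d1.
by apply: is_derive_eq; rewrite /GRing.scale /=; ring.
Qed.

Lemma is_derive_sin_affine (c w k : R) :
  is_derive k 1 (fun k => sin (c + w * k)) (w * cos (c + w * k)).
Proof.
have d1 : is_derive k 1 (fun k => c + w * k) w.
  by apply: is_derive_eq; rewrite /GRing.scale /=; lra.
have h := @is_derive1_comp R sin _ k _ _ (is_derive_sin _) d1.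
by apply: is_derive_eq; rewrite mulrC.
Qed.

Lemma norm_cos_le1 (x : R) : `|cos x| <= 1.
Proof. by rewrite ler_norml cos_geN1 cos_le1. Qed.

Lemma norm_sin_le1 (x : R) : `|sin x| <= 1.
Proof. by rewrite ler_norml sin_geN1 sin_le1. Qed.

Lemma integrable_gs_cos b c w : 0 < b ->
  mu.-integrable setT (fun k => (gs b k * cos (c + w * k))%:E).
Proof.
move=> b0; apply: (@integrable_gs_bounded _ _ _ 1) => //; last first.
  by move=> k; exact: norm_cos_le1.
apply: continuous_measurable_fun => k.
exact: is_derive1_continuous (is_derive_cos_affine c w k).
Qed.

Lemma continuous_sin_affine (c w : R) : continuous (fun k => sin (c + w * k)).
Proof. by move=> k; exact: is_derive1_continuous (is_derive_sin_affine c w k). Qed.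

Lemma continuous_cos_affine (c w : R) : continuous (fun k => cos (c + w * k)).
Proof. by move=> k; exact: is_derive1_continuous (is_derive_cos_affine c w k). Qed.

Lemma integrable_mul_gs_sin b c w : 0 < b ->
  mu.-integrable setT (fun k => (k * gs b k * sin (c + w * k))%:E).
Proof.
move=> b0; apply: le_integrable (integrable_norm_mul_gs b0) => //.
  apply/measurable_EFinP; apply: continuous_measurable_fun => k.
  apply: cvgM; last exact: continuous_sin_affine.
  by apply: cvgM; [exact: cvg_id|exact: continuous_gs].
move=> k _; rewrite /= lee_fin !normrM normr_id.
by rewrite ler_piMr ?mulr_ge0// norm_sin_le1.
Qed.

(** Integration by parts: the derivative of [gs b k * sin (c + w * k)] has integral 0. *)
Lemma Rintegral_mul_gs_sin b c w : 0 < b ->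
  2 * b * \int[mu]_k (k * gs b k * sin (c + w * k)) =
  w * \int[mu]_k (gs b k * cos (c + w * k)).
Proof.
move=> b0.
pose phi k := gs b k * sin (c + w * k).
pose dphi k := w * (gs b k * cos (c + w * k)) - 2 * b * (k * gs b k * sin (c + w * k)).
have dphiE (k : R) : is_derive k 1 phi (dphi k).
  have h1 := is_derive_gs b k; have h2 := is_derive_sin_affine c w k.
  by apply: is_derive_eq; rewrite /dphi /GRing.scale /=; ring.
have ic := integrable_gs_cos c w b0.
have is_ := integrable_mul_gs_sin c w b0.
have ic' := integrableZl measurableT w ic.
have is' := integrableZl measurableT (2 * b) is_.
have := @Rintegral_derive0 R phi dphi (1 + 2 / b) dphiE.
rewrite RintegralB//.
rewrite RintegralZl// RintegralZl// => H; apply/esym/subr0_eq/H.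
- move=> k; apply: cvgB; (apply: cvgM; first exact: cvg_cst).
    by apply: cvgM; [exact: continuous_gs|exact: continuous_cos_affine].
  apply: cvgM; last exact: continuous_sin_affine.
  by apply: cvgM; [exact: cvg_id|exact: continuous_gs].
- exact: integrableB ic' is'.
- move=> k; rewrite /phi !normrM -mulrA mulrCA mulrA mulrC mulrA.
  have h := norm_mul_gs_le k b0.
  rewrite (ger0_norm (ltW (gs_gt0 b k))).
  have g1 : gs (b / 2) k <= 1 by rewrite gs_le1 ?divr_ge0 ?(ltW b0).
  have b2 : 0 <= 1 + 2 / b by rewrite addr_ge0 ?divr_ge0 ?(ltW b0).
  have s1 := norm_sin_le1 (c + w * k).
  have := ler_wpM2l b2 g1; have := gs_gt0 b k; have := normr_ge0 k.
  have := normr_ge0 (sin (c + w * k)).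
  move: (gs b k) (gs (b / 2) k) `|k| `|sin _| (1 + _) h s1 b2 => g g' K S B h s1 b2 S0 K0 g0 h2.
  have : K * S * g <= K * g by rewrite mulrAC ler_piMr ?mulr_ge0 ?(ltW g0).
  by lra.
Qed.

(** Differentiation under the integral, dominated by [|k| * gs b k], followed by the integration by
    parts above, which gives back a multiple of the transform itself. *)
Lemma is_derive_gs_transform b c (w : R) : 0 < b ->
  is_derive w 1 (fun w => \int[mu]_k (gs b k * cos (c + w * k)))
    (- (w / (2 * b)) * \int[mu]_k (gs b k * cos (c + w * k))).
Proof.
move=> b0; pose f w k := gs b k * cos (c + w * k).
have df (x y : R) : is_derive x 1 (f ^~ y) (- (y * gs b y * sin (c + x * y))).
  have h := is_derive_cos_affine c y x.
  have -> : f ^~ y = gs b y \*: (fun x => cos (c + y * x)).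
    by apply/funext => z; rewrite /f /GRing.scale /= (mulrC z).
  by apply: is_derive_eq; rewrite /GRing.scale /= (mulrC x); ring.
have d1E x y : partial1of2 f x y = - (y * gs b y * sin (c + x * y)).
  by rewrite partial1of2E derive_val.
have Ia : `]w - 1, w + 1[%classic w by rewrite /= in_itv /= ltrBlDr ltrDl ltr01.
pose G k := `|k| * gs b k.
have i1 x : `]w - 1, w + 1[%classic x -> mu.-integrable setT (EFin \o f x).
  by move=> _; exact: integrable_gs_cos.
have i2 x y : `]w - 1, w + 1[%classic x -> setT y -> derivable (f ^~ y) x 1.
  by move=> _ _; have [] := df x y.
have G0 y : 0 <= G y by rewrite mulr_ge0// ltW// gs_gt0.
have i3 x y : `]w - 1, w + 1[%classic x -> setT y -> `|partial1of2 f x y| <= G y.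
  move=> _ _; rewrite d1E normrN !normrM (ger0_norm (ltW (gs_gt0 b y))).
  by rewrite ler_piMr ?norm_sin_le1//; exact: G0.
have iG : mu.-integrable setT (EFin \o G) by exact: integrable_norm_mul_gs.
have D := @derivable_under_integral R _ _ mu f setT measurableT w _ _ Ia i1 i2 G G0 iG i3.
have V := @differentiation_under_integral R _ _ mu f setT measurableT w _ _ Ia i1 i2 G G0 iG i3.
apply: DeriveDef; first exact: D.
rewrite -derive1E V.
have -> : \int[mu]_y partial1of2 f w y = - \int[mu]_k (k * gs b k * sin (c + w * k)).
  rewrite -[RHS]mulN1r -RintegralZl//; last exact: integrable_mul_gs_sin.
  by apply: eq_Rintegral => y _; rewrite d1E mulN1r.
have b20 : 2 * b != 0 by rewrite gt_eqF// mulr_gt0.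
apply: (mulfI b20); rewrite mulrN Rintegral_mul_gs_sin//.
by rewrite mulNr mulrN mulrA [2 * b * _]mulrC divfK.
Qed.

(** The transform J solves [J' = - w / (2 b) J], so its product with [exp (w^2 / (4 b))] is constant
    in [w]. The free phase [c] receives the contribution of the other coordinate in
    [gs2_cos_integral], where the lemma is applied once per variable. *)
Lemma gs_cos_integral b c w : 0 < b ->
  \int[mu]_k (gs b k * cos (c + w * k)) =
  cos c * Num.sqrt (pi / b) * expR (- (w ^+ 2 / (4 * b))).
Proof.
move=> b0; pose J w := \int[mu]_k (gs b k * cos (c + w * k)).
pose e (w : R) := expR ((4 * b)^-1 * w ^+ 2).
have de (x : R) : is_derive x 1 e (x / (2 * b) * e x).
  have d1 : is_derive x 1 (fun x => (4 * b)^-1 * x ^+ 2) (x / (2 * b)).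
    by apply: is_derive_eq; rewrite /GRing.scale /=; field; rewrite gt_eqF.
  have h := @is_derive1_comp R expR _ x _ _ (is_derive_expR _) d1.
  by apply: is_derive_eq; rewrite mulrC.
have dJe (x : R) : is_derive x 1 (J * e) 0.
  have h1 := is_derive_gs_transform c x b0; have h2 := de x.
  have := @is_deriveM _ _ J e x 1 _ _ h1 h2.
  by move=> h; apply: is_derive_eq; rewrite /GRing.scale /= -/(J x); ring.
have := is_derive_0_is_cst w 0 dJe.
have -> : (J * e) w = J w * e w by [].
have -> : (J * e) 0 = cos c * Num.sqrt (pi / b).
  rewrite -[LHS]/(J 0 * e 0) /e expr0n mulr0 expR0 mulr1 /J.
  under eq_Rintegral do rewrite mul0r addr0 mulrC.
  by have [i1 <-] := gs_integral b0; rewrite RintegralZl.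
move=> <-; rewrite -mulrA /e -expRD (_ : _ + _ = 0) ?expR0 ?mulr1//.
by rewrite mulrC subrr.
Qed.

Definition gs2 (b : R) (k : R * R) := gs b k.1 * gs b k.2.

Lemma gs2_gt0 b k : 0 < gs2 b k.
Proof. by rewrite mulr_gt0// gs_gt0. Qed.

Lemma gs2_le1 b k : 0 <= b -> gs2 b k <= 1.
Proof. by move=> b0; rewrite mulr_ile1 ?gs_le1// ltW// gs_gt0. Qed.

Lemma measurable_gs2 b : measurable_fun [set: R * R] (gs2 b).
Proof.
have m : measurable_fun setT (gs b).
  by apply: continuous_measurable_fun; exact: continuous_gs.
by apply: measurable_funM; exact: measurableT_comp.
Qed.

Lemma integrable_gs2_bounded (b : R) (f : R * R -> R) (M : R) : 0 < b ->
  measurable_fun setT f -> (forall k, `|f k| <= M) ->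
  (@mu2 R).-integrable setT (fun k => (gs2 b k * f k)%:E).
Proof.
move=> b0 mf fM.
have [ig _] := gs_integral b0.
rewrite /mu2; apply: (@integrable_prod_dominated _ _ _ _ _ mu mu
  (fun k => gs2 b k * f k) (fun k => gs b k * M) (gs b)) => //.
- by apply: measurable_funM => //; exact: measurable_gs2.
- by have := integrableZl measurableT M ig; apply: eq_integrable => // k _ /=; rewrite mulrC.
move=> x y; rewrite /gs2 !normrM /=.
rewrite !(ger0_norm (ltW (gs_gt0 _ _))) mulrAC.
by rewrite ler_wpM2r ?(ltW (gs_gt0 _ _))// ler_wpM2l ?(ltW (gs_gt0 _ _)).
Qed.

Lemma gs2_cos_integral b c w1 w2 : 0 < b ->
  \int[@mu2 R]_k (gs2 b k * cos (c + w1 * k.1 + w2 * k.2)) =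
  cos c * (pi / b) * expR (- (w1 ^+ 2 / (4 * b))) * expR (- (w2 ^+ 2 / (4 * b))).
Proof.
move=> b0; rewrite /@mu2 Rintegral_prod1; last 2 first.
- apply: (@integrable_gs2_bounded _ _ 1) => //; last by move=> k; exact: norm_cos_le1.
  have mc : measurable_fun setT (@cos R).
    by apply: continuous_measurable_fun; exact: continuous_cos.
  apply: measurableT_comp => //; apply: measurable_funD.
    by apply: measurable_funD => //; apply: measurable_funM.
  by apply: measurable_funM.
- move=> x /=; rewrite /gs2 /=.
  have := integrableZl measurableT (gs b x) (integrable_gs_cos (c + w1 * x) w2 b0).
  by apply: eq_integrable => // y _; rewrite -EFinM mulrA.
set e2 := expR (- (w2 ^+ 2 / (4 * b))); set q := Num.sqrt (pi / b).
have inner x : \int[mu]_y (gs2 b (x, y) * cos (c + w1 * x + w2 * y)) =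
    q * e2 * (gs b x * cos (c + w1 * x)).
  transitivity (gs b x * \int[mu]_y (gs b y * cos (c + w1 * x + w2 * y))).
    rewrite -RintegralZl//; last exact: integrable_gs_cos.
    by apply: eq_Rintegral => y _; rewrite /gs2 /= mulrA.
  by rewrite gs_cos_integral// -/q -/e2; ring.
under eq_Rintegral do rewrite inner.
rewrite RintegralZl//; last exact: integrable_gs_cos.
rewrite gs_cos_integral// -/q.
have <- : q * q = pi / b by rewrite -expr2 sqr_sqrtr// divr_ge0 ?pi_ge0// ltW.
by ring.
Qed.

End GaussianFourier.

Section ProductMeasure.
Context {R : realType} d1 d2 (T1 : measurableType d1) (T2 : measurableType d2).
Variables (m1 : {sigma_finite_measure set T1 -> \bar R})
  (m2 : {sigma_finite_measure set T2 -> \bar R}).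

(* On [product_measure1] the library registers sigma-finiteness only for finite
   factors, hence this copy. *)
Definition sprod : set (T1 * T2) -> \bar R := (m1 \x m2)%E.

HB.instance Definition _ := Measure.on sprod.

Lemma sprod_sigma_finite : sigma_finite setT sprod.
Proof.
have /sigma_finiteP[F [TF ndF Foo]] := sigma_finiteT m1.
have /sigma_finiteP[G [TG ndG Goo]] := sigma_finiteT m2.
exists (fun n => F n `*` G n).
  apply/seteqP; split=> // -[x y] _.
  have : [set: T1] x by []. have : [set: T2] y by [].
  rewrite TF TG => -[j _ Gy] [i _ Fx]; exists (maxn i j) => //; split => /=.
  - by move: x Fx; apply/subsetPset/ndF; exact: leq_maxl.
  - by move: y Gy; apply/subsetPset/ndG; exact: leq_maxr.
move=> k; have [mF Fk] := Foo k; have [mG Gk] := Goo k.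
split; first exact: measurableX.
by rewrite /sprod product_measure1E// lte_mul_pinfty// ge0_fin_numE.
Qed.

HB.instance Definition _ := Measure_isSigmaFinite.Build _ _ _ sprod
  sprod_sigma_finite.

End ProductMeasure.

(** * Subordination of the stream function to Gaussians *)

Section Subordination.
Context {R : realType}.
Notation mu := (@lebesgue_measure R).
Notation pos := (`]0%R, +oo[%classic : set R).

Lemma enorm_ge0 (k : R * R) : 0 <= enorm k.
Proof. exact: sqrtr_ge0. Qed.

Lemma dot_ge0 (k : R * R) : 0 <= dot k k.
Proof. by rewrite /dot addr_ge0// -expr2 sqr_ge0. Qed.

Lemma enorm_sqr (k : R * R) : enorm k ^+ 2 = dot k k.
Proof. by rewrite sqr_sqrtr// dot_ge0. Qed.

Lemma dot_eq0 (k : R * R) : (dot k k == 0) = (k == 0).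
Proof.
case: k => a b; rewrite /dot /= -!expr2 paddr_eq0 ?sqr_ge0// !sqrf_eq0.
by rewrite -pair_eqE.
Qed.

(** A Gaussian in the frequency at scale [s] is also a Gaussian in [s] with parameter [pi |k|^2]; it
    is in [s] that subordination integrates it. *)
Lemma gs2_sqr (s : R) (k : R * R) : gs2 (pi * s ^+ 2) k = gs (pi * dot k k) s.
Proof. by rewrite /gs2 /gs -expRD; congr expR; rewrite /dot; ring. Qed.

Lemma gs_pos_integral (c : R) : 0 < c ->
  mu.-integrable setT (fun s => (\1_pos s * gs c s)%:E) /\
  \int[mu]_s (\1_pos s * gs c s) = Num.sqrt (pi / c) / 2.
Proof.
move=> c0; split.
  apply: le_integrable (gs_integral c0).1 => //.
    apply/measurable_EFinP/measurable_funM; first exact: measurable_indic.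
    by apply: continuous_measurable_fun; exact: continuous_gs.
  move=> s _; rewrite /= lee_fin normrM ler_piMl//.
  by rewrite /indic; case: (_ \in _); rewrite ?normr1// normr0.
rewrite /Rintegral.
transitivity (fine (\int[mu]_(s in pos) (gs c s)%:E)).
  rewrite [in RHS]integral_mkcond; congr fine; apply: eq_integral => s _.
  rewrite patchE /indic; case: ifPn => _ /=; by rewrite ?mul1r ?mul0r.
rewrite integral_itv_obnd_cbnd.
  by rewrite gs_half_integral.
apply: measurable_funTS; apply/measurable_EFinP.
by apply: continuous_measurable_fun; exact: continuous_gs.
Qed.

(* The multiplier is subordinated to the Gaussians by
   [1 / (2 pi |k|) = 1 / pi * \int_(s > 0) exp (- pi s^2 |k|^2)]. *)
Lemma heat_bound (Psi : R * R -> R) (bnd : R -> R) :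
  measurable_fun setT Psi -> Psi 0 = 0 ->
  (sprod mu mu).-integrable setT (fun k => ((2 * pi * enorm k)^-1 * Psi k)%:E) ->
  (forall s, 0 < s ->
    (sprod mu mu).-integrable setT (fun k => (gs2 (pi * s ^+ 2) k * Psi k)%:E)) ->
  mu.-integrable setT (fun s => (\1_pos s * bnd s)%:E) ->
  (forall s, 0 < s -> `|\int[(sprod mu mu)]_k (gs2 (pi * s ^+ 2) k * Psi k)| <= bnd s) ->
  `|\int[(sprod mu mu)]_k ((2 * pi * enorm k)^-1 * Psi k)| <=
    pi^-1 * \int[mu]_s (\1_pos s * bnd s).
Proof.
move=> mPsi Psi0 imP igP ib hb.
have pi0 : 0 < pi :> R by exact: pi_gt0.
pose F (z : R * (R * R)) := \1_pos z.1 * (gs2 (pi * z.1 ^+ 2) z.2 * Psi z.2).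
have FE s k : F (s, k) = \1_pos s * gs (pi * dot k k) s * Psi k.
  by rewrite /F /= gs2_sqr mulrA.
have i01 s : 0 <= \1_pos s :> R by rewrite /indic; case: (_ \in _).
have mF : measurable_fun [set: R * (R * R)] F.
  have m1 : measurable_fun [set: R * (R * R)] (fun z : R * (R * R) => \1_pos z.1 : R).
    by apply: measurableT_comp => //; exact: measurable_indic.
  have m2 : measurable_fun [set: R * (R * R)] (fun z : R * (R * R) => Psi z.2).
    exact: measurableT_comp.
  apply: measurable_funM => //; apply: measurable_funM => //.
  have mx : measurable_fun [set: R * (R * R)] (fun z : R * (R * R) => pi * z.1 ^+ 2 : R).
    by apply: measurable_funM => //; apply: measurable_funX.
  have mg (g : R * (R * R) -> R) : measurable_fun setT g ->
      measurable_fun [set: R * (R * R)] (fun z => gs (pi * z.1 ^+ 2) (g z)).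
    move=> m; apply: measurableT_comp => //.
    by apply: measurableT_comp => //; apply: measurable_funM => //; apply: measurable_funX.
  apply: measurable_funM.
    by apply: (mg (fun z => z.2.1)); apply: measurableT_comp => //.
  by apply: (mg (fun z => z.2.2)); apply: measurableT_comp => //.
have sec k : mu.-integrable setT (fun s => (F (s, k))%:E) /\
    \int[mu]_s `|F (s, k)| = `|pi * ((2 * pi * enorm k)^-1 * Psi k)| /\
    \int[mu]_s F (s, k) = pi * ((2 * pi * enorm k)^-1 * Psi k).
  (* At [k = 0] the Gaussian is constant in [s] and has no finite integral; [Psi 0 = 0] removes this
     point, where the multiplier itself is [0^-1 = 0]. *)
  have [->|k0] := eqVneq k 0.
    have F0 s : F (s, 0) = 0 by rewrite /F /= Psi0 !mulr0.
    under eq_fun do rewrite F0.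
    under eq_Rintegral do rewrite F0 normr0.
    under [X in _ /\ _ /\ X = _]eq_Rintegral do rewrite F0.
    rewrite Psi0 !mulr0 normr0 /Rintegral integral0 /=; split => //.
    exact: integrable0.
  have d0 : 0 < dot k k by rewrite lt_def dot_ge0 dot_eq0 k0.
  have c0 : 0 < pi * dot k k by rewrite mulr_gt0.
  have [i1 i2] := gs_pos_integral c0.
  have e0 : 0 < enorm k by rewrite sqrtr_gt0.
  have vE : Num.sqrt (pi / (pi * dot k k)) / 2 = pi * (2 * pi * enorm k)^-1.
    rewrite invfM mulrA mulfV ?gt_eqF// mul1r sqrtrV ?dot_ge0// -/(enorm k).
    have p0 : pi != 0 :> R by rewrite gt_eqF.
    have e1 : enorm k != 0 by rewrite gt_eqF.
    by move: (pi : R) (enorm k) p0 e1 => p e p0 e1; field; rewrite p0 e1.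
  split.
    have := integrableZl measurableT (Psi k) i1.
    by apply: eq_integrable => // s _; rewrite FE -EFinM mulrC.
  split.
    under eq_Rintegral => s _.
      rewrite FE normrM mulrC [X in _ * X]ger0_norm; last by rewrite mulr_ge0// ltW// gs_gt0.
      over.
    rewrite RintegralZl// i2 vE [in RHS]mulrA [RHS]normrM [RHS]mulrC; congr (_ * _).
    by rewrite ger0_norm// mulr_ge0 ?invr_ge0 ?mulr_ge0 ?(ltW pi0) ?(ltW e0).
  under eq_Rintegral do rewrite FE mulrC.
  by rewrite RintegralZl// i2 vE mulrC mulrA.
have iF : (mu \x @mu2 R)%E.-integrable setT (EFin \o F).
  have mEF : measurable_fun [set: R * (R * R)] (EFin \o F) by exact/measurable_EFinP.
  (* Tonelli in the order whose inner integral is explicit: finiteness then reduces to the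
     integrability of the multiplier times [Psi]. *)
  have := @integrable21ltyP _ _ _ _ _ mu (sprod mu mu) _ mEF. move=> [_]; apply.
  have -> : (\int[(sprod mu mu)]_k \int[mu]_s `|(EFin \o F) (s, k)| =
     \int[(sprod mu mu)]_k `|(pi * ((2 * pi * enorm k)^-1 * Psi k))%:E|)%E.
    apply: eq_integral => k _; have [i1 [i2 _]] := sec k.
    rewrite -[RHS]/(`|pi * ((2 * pi * enorm k)^-1 * Psi k)|%:E) -i2 /Rintegral.
    rewrite fineK//; apply: (integrable_fin_num measurableT).
    exact: integrable_norm i1.
  by have /integrableP[_] := integrableZl measurableT pi imP.
have secs s : (sprod mu mu).-integrable setT (fun k => (F (s, k))%:E).
  rewrite /F /indic /=; have [s0|s0] := boolP (s \in pos).
    by under eq_fun do rewrite mul1r; apply: igP; move: s0; rewrite inE /= in_itv /= andbT.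
  by under eq_fun do rewrite mul0r; exact: integrable0.
have := @Rintegral_prod1 _ _ _ _ _ mu (sprod mu mu) F iF secs.
rewrite (@Rintegral_prod2 _ _ _ _ _ mu (sprod mu mu) F iF (fun k => (sec k).1)).
under eq_Rintegral do rewrite (sec _).2.2.
rewrite RintegralZl// => E.
rewrite -(ler_pM2l pi0) mulrA mulfV ?gt_eqF// mul1r.
rewrite -[X in X * `|_|](gtr0_norm pi0) -normrM E.
have i1 := @integrable_Rintegral1 _ _ _ _ _ mu (sprod mu mu) F iF secs.
apply: (le_trans (le_normr_Rintegral measurableT i1)).
apply: le_Rintegral => //; first exact: integrable_norm i1.
move=> s _; rewrite /F /indic /=; have [s0|s0] := boolP (s \in pos) => /=.
  under eq_Rintegral do rewrite mul1r.
  by rewrite mul1r hb//; move: s0; rewrite inE /= in_itv /= andbT.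
under eq_Rintegral do rewrite mul0r.
by rewrite mul0r /Rintegral integral0 normr0.
Qed.

End Subordination.

Section StreamFunction.
Context {R : realType}.
Notation mu := (@lebesgue_measure R).
Notation m2 := (sprod mu mu).
Notation pos := (`]0%R, +oo[%classic : set R).

(** The real part of [exp (2 pi i x.k)] times the Fourier transform of [f] at [k], written as one
    real integral. *)
Definition phase (f : R * R -> R) (x k : R * R) : R :=
  \int[m2]_y (f y * cos (2 * pi * dot (x - y) k)).

Lemma measurable_dotr (k : R * R) : measurable_fun [set: R * R] (fun x => dot k x).
Proof. by apply: measurable_funD; apply: measurable_funM. Qed.

Lemma measurable_dotl (k : R * R) : measurable_fun [set: R * R] (fun x => dot x k).
Proof. by apply: measurable_funD; apply: measurable_funM. Qed.

Lemma measurable_rsub (x : R * R) : measurable_fun [set: R * R] (fun y => x - y).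
Proof.
have -> : (fun y => x - y) = fun y : R * R => (x.1 - y.1, x.2 - y.2).
  by apply/funext => y; rewrite [LHS]surjective_pairing.
by apply: measurable_fun_pair; apply: measurable_funB.
Qed.

Lemma measurable_cos : measurable_fun setT (@cos R).
Proof. by apply: continuous_measurable_fun; exact: continuous_cos. Qed.

Lemma measurable_sin : measurable_fun setT (@sin R).
Proof. by apply: continuous_measurable_fun; exact: continuous_sin. Qed.

Lemma integrable_mul_bounded (f g : R * R -> R) :
  m2.-integrable setT (EFin \o f) -> measurable_fun setT g ->
  (forall y, `|g y| <= 1) -> m2.-integrable setT (fun y => (f y * g y)%:E).
Proof.
move=> fi mg g1; apply: le_integrable (fi) => //.
  apply/measurable_EFinP; apply: measurable_funM => //.
  by apply/measurable_EFinP; exact: (measurable_int _ fi).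
by move=> y _ /=; rewrite lee_fin normrM ler_piMr.
Qed.

Variable f : R * R -> R.
Hypothesis fi : m2.-integrable setT (EFin \o f).

Lemma integrable_mul_cos k :
  m2.-integrable setT (fun y => (f y * cos (2 * pi * dot y k))%:E).
Proof.
apply: integrable_mul_bounded => //; last by move=> y; exact: norm_cos_le1.
apply: measurableT_comp; first exact: measurable_cos.
by apply: measurable_funM => //; exact: measurable_dotl.
Qed.

Lemma integrable_mul_sin k :
  m2.-integrable setT (fun y => (f y * sin (2 * pi * dot y k))%:E).
Proof.
apply: integrable_mul_bounded => //; last by move=> y; exact: norm_sin_le1.
apply: measurableT_comp; first exact: measurable_sin.
by apply: measurable_funM => //; exact: measurable_dotl.
Qed.

Lemma Re_half_symbol k : complex.Re (half_symbol f k) =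
  (2 * pi * enorm k)^-1 * \int[m2]_y (f y * cos (2 * pi * dot y k)).
Proof.
rewrite /half_symbol /fourier /cintegral /= mul0r subr0; congr (_ * _).
by apply: eq_Rintegral => y _ /=; rewrite cosN mulr0 subr0 mulrC.
Qed.

Lemma Im_half_symbol k : complex.Im (half_symbol f k) =
  - ((2 * pi * enorm k)^-1 * \int[m2]_y (f y * sin (2 * pi * dot y k))).
Proof.
rewrite /half_symbol /fourier /cintegral /= mul0r addr0 -mulrN; congr (_ * _).
rewrite -[RHS]mulN1r -RintegralZl//; last exact: integrable_mul_sin.
by apply: eq_Rintegral => y _ /=; rewrite sinN mulr0 add0r mulN1r mulNr mulrC.
Qed.

Lemma phaseE x k : phase f x k =
  cos (2 * pi * dot x k) * \int[m2]_y (f y * cos (2 * pi * dot y k)) +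
  sin (2 * pi * dot x k) * \int[m2]_y (f y * sin (2 * pi * dot y k)).
Proof.
have ic := integrable_mul_cos k; have is_ := integrable_mul_sin k.
rewrite -RintegralZl// -RintegralZl// -RintegralD//; last 2 first.
- exact: (integrableZl measurableT (cos (2 * pi * dot x k)) ic).
- exact: (integrableZl measurableT (sin (2 * pi * dot x k)) is_).
apply: eq_Rintegral => y _.
have -> : 2 * pi * dot (x - y) k = 2 * pi * dot x k - 2 * pi * dot y k.
  by rewrite /dot /=; ring.
by rewrite cosB; ring.
Qed.

Lemma inv_half_laplacianE x : complex.Re (inv_half_laplacian f x) =
  \int[m2]_k ((2 * pi * enorm k)^-1 * phase f x k).
Proof.
rewrite -[LHS]/(\int[m2]_k complex.Re (cexpi (2 * pi * dot x k) * half_symbol f k)).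
apply: eq_Rintegral => k _.
rewrite phaseE; move: (Re_half_symbol k) (Im_half_symbol k).
case: (half_symbol f k) => a b /= -> ->.
by ring.
Qed.

Lemma integrable_multiplier_phase x : cintegrable (half_symbol f) ->
  m2.-integrable setT (fun k => ((2 * pi * enorm k)^-1 * phase f x k)%:E).
Proof.
move=> [iRe iIm].
have mc : measurable_fun [set: R * R] (fun k => cos (2 * pi * dot x k)).
  apply: measurableT_comp; first exact: measurable_cos.
  by apply: measurable_funM => //; exact: measurable_dotr.
have ms : measurable_fun [set: R * R] (fun k => sin (2 * pi * dot x k)).
  apply: measurableT_comp; first exact: measurable_sin.
  by apply: measurable_funM => //; exact: measurable_dotr.
have i1 := integrable_mul_bounded iRe mc (fun k => norm_cos_le1 _).
have i2 := integrable_mul_bounded iIm ms (fun k => norm_sin_le1 _).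
have := integrableB measurableT i1 i2; apply: eq_integrable => // k _.
rewrite -[LHS]/((complex.Re (half_symbol f k) * cos (2 * pi * dot x k)
  - complex.Im (half_symbol f k) * sin (2 * pi * dot x k))%:E).
rewrite phaseE Re_half_symbol Im_half_symbol; congr EFin.
by ring.
Qed.

Lemma integrable_translate (b : R) (x : R * R) : 0 < b ->
  m2.-integrable setT (fun y => (f y * gs2 b (x - y))%:E).
Proof.
move=> b0; apply: integrable_mul_bounded => //; last first.
  by move=> y; rewrite ger0_norm ?gs2_le1 ?(ltW b0) ?(ltW (gs2_gt0 _ _)).
by apply: measurableT_comp; [exact: measurable_gs2|exact: measurable_rsub].
Qed.

(** Convolution with the Gaussian of mass 1 and width [s]: the heat flow of [f] at a time
    proportional to [s^2]. *)
Definition heat (s : R) (x : R * R) : R :=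
  \int[m2]_y (f y * (s ^- 2 * gs2 (pi / s ^+ 2) (x - y))).

(** Fubini exchanges the frequency with the space variable; the inner integral is the Gaussian
    transform of [gs2_cos_integral], with phase 0 and frequency [2 pi (x - y)]. *)
Lemma heat_phase s x : 0 < s ->
  m2.-integrable setT (fun k => (gs2 (pi * s ^+ 2) k * phase f x k)%:E) /\
  \int[m2]_k (gs2 (pi * s ^+ 2) k * phase f x k) = heat s x.
Proof.
move=> s0; have b0 : 0 < pi * s ^+ 2 by rewrite mulr_gt0 ?pi_gt0// exprn_gt0.
set b := pi * s ^+ 2 in b0 *.
pose F (z : (R * R) * (R * R)) := gs2 b z.1 * (f z.2 * cos (2 * pi * dot (x - z.2) z.1)).
have mf : measurable_fun setT f by apply/measurable_EFinP; exact: (measurable_int _ fi).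
have mF : measurable_fun [set: (R * R) * (R * R)] F.
  apply: measurable_funM; first exact: (measurableT_comp (measurable_gs2 b)).
  apply: measurable_funM; first exact: measurableT_comp.
  apply: measurableT_comp; first exact: measurable_cos.
  apply: measurable_funM => //; apply: measurable_funD; apply: measurable_funM => //=;
    try (by apply: measurableT_comp);
    by apply: measurable_funB => //; apply: measurableT_comp.
have ig : m2.-integrable setT (EFin \o gs2 b).
  have := @integrable_gs2_bounded R b (cst 1) 1 b0 (measurable_cst _).
  have h1 : forall k : R * R, `|cst 1 k : R| <= 1 by move=> k /=; rewrite normr1.
  by move=> /(_ h1); apply: eq_integrable => // k _ /=; rewrite mulr1.
have iF : (m2 \x m2)%E.-integrable setT (EFin \o F).
  apply: (@integrable_prod_dominated _ _ _ _ _ m2 m2 F (gs2 b) (fun y => `|f y|)) => //.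
    exact: integrable_norm.
  move=> k y; rewrite /F /= normrM (ger0_norm (ltW (gs2_gt0 b k))) normrM.
  by rewrite ler_wpM2l ?(ltW (gs2_gt0 _ _))// ler_piMr// norm_cos_le1.
have iph k : m2.-integrable setT (fun y => (f y * cos (2 * pi * dot (x - y) k))%:E).
  apply: integrable_mul_bounded => //; last by move=> y; exact: norm_cos_le1.
  apply: measurableT_comp; first exact: measurable_cos.
  apply: measurable_funM => //; apply: (measurableT_comp (measurable_dotl k)).
  exact: measurable_rsub.
have sec1 k : m2.-integrable setT (fun y => (F (k, y))%:E).
  by have := integrableZl measurableT (gs2 b k) (iph k); apply: eq_integrable.
have sec1E k : \int[m2]_y F (k, y) = gs2 b k * phase f x k.
  by rewrite /phase -RintegralZl//; exact: iph.
have sec2 y : m2.-integrable setT (fun k => (F (k, y))%:E).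
  have h := @integrable_gs2_bounded R b (fun k => f y * cos (2 * pi * dot (x - y) k)) `|f y| b0.
  apply: h => [|k].
    apply: measurable_funM => //; apply: measurableT_comp; first exact: measurable_cos.
    by apply: measurable_funM => //; exact: measurable_dotr.
  by rewrite normrM ler_piMr// norm_cos_le1.
have sec2E y : \int[m2]_k F (k, y) = f y * (s ^- 2 * gs2 (pi / s ^+ 2) (x - y)).
  pose w1 := 2 * pi * (x - y).1; pose w2 := 2 * pi * (x - y).2.
  transitivity (f y * \int[m2]_k (gs2 b k * cos (0 + w1 * k.1 + w2 * k.2))).
    rewrite -RintegralZl//.
      apply: eq_Rintegral => k _; rewrite /F /= mulrCA; congr (_ * (_ * cos _)).
      by rewrite /w1 /w2 /dot add0r /=; ring.
    apply: (@integrable_gs2_bounded R b (fun k => cos (0 + w1 * k.1 + w2 * k.2)) 1 b0).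
      apply: measurableT_comp; first exact: measurable_cos.
      by apply: measurable_funD; [apply: measurable_funD|] => //; apply: measurable_funM.
    by move=> k; exact: norm_cos_le1.
  rewrite (@gs2_cos_integral R b 0 w1 w2 b0) cos0 mul1r.
  have p0 : pi != 0 :> R by rewrite gt_eqF// pi_gt0.
  have s1 : s != 0 by rewrite gt_eqF.
  have e w : (2 * pi * w) ^+ 2 / (4 * b) = pi / s ^+ 2 * w ^+ 2.
    by rewrite /b; move: (pi : R) p0 => p p0; field; rewrite p0 s1.
  rewrite /w1 /w2 !e /gs2 /gs; congr (_ * _); rewrite -mulrA; congr (_ * _).
  by rewrite /b; move: (pi : R) p0 => p p0; field; rewrite p0 s1.
have i1 := @integrable_Rintegral1 _ _ _ _ _ m2 m2 F iF sec1.
split.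
  by move: i1; apply: eq_integrable => // k _; rewrite sec1E.
have := @Rintegral_prod1 _ _ _ _ _ m2 m2 F iF sec1.
rewrite (@Rintegral_prod2 _ _ _ _ _ m2 m2 F iF sec2).
under eq_Rintegral do rewrite sec2E.
by under [X in _ = X -> _]eq_Rintegral do rewrite sec1E.
Qed.

(** Integrability in [heat_phase] at [s = 1] already makes the phase times a Gaussian measurable;
    the factor [gs2 (- pi)] cancels that Gaussian. *)
Lemma measurable_phase x : measurable_fun [set: R * R] (phase f x).
Proof.
have [i1 _] := heat_phase x (@ltr01 R).
have m1 : measurable_fun [set: R * R] (fun k => gs2 (pi * 1 ^+ 2) k * phase f x k).
  by apply/measurable_EFinP; exact: (measurable_int _ i1).
have -> : phase f x = fun k => gs2 (- pi) k * (gs2 (pi * 1 ^+ 2) k * phase f x k).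
  apply/funext => k; rewrite mulrA (_ : gs2 _ _ * _ = 1) ?mul1r//.
  rewrite /gs2 /gs -!expRD -[RHS]expR0; congr expR.
  by ring.
by apply: measurable_funM => //; exact: measurable_gs2.
Qed.

End StreamFunction.

(** * Logarithmic modulus of the velocity *)

Section KernelDifferences.
Context {R : realType}.

Lemma mvt_everywhere (f df : R -> R) (a b : R) :
  (forall x : R, is_derive x 1 f (df x)) ->
  exists2 c, `|c - a| <= `|b - a| & f b - f a = df c * (b - a).
Proof.
move=> dfE; have cf : continuous f by move=> x; exact: is_derive1_continuous (dfE x).
have [ab|ba] := leP a b.
  have [c] := MVT_segment ab (fun x _ => dfE x) (continuous_subspaceT cf).
  rewrite in_itv /= => /andP[ac cb] E; exists c => //.
  by rewrite !ger0_norm ?subr_ge0// lerB.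
have [c] := MVT_segment (ltW ba) (fun x _ => dfE x) (continuous_subspaceT cf).
rewrite in_itv /= => /andP[bc ca] E; exists c; last by rewrite -opprB E -mulrN opprB.
by rewrite distrC [leRHS]distrC !ger0_norm ?subr_ge0 ?(ltW ba)// lerB.
Qed.

(** The factor [4 pi^2 (1 + c^2)] dominates the polynomials [2 pi |c|] and [|4 pi^2 c^2 - 2 pi|] in
    the first two derivatives of [exp (- pi c^2)]; [exp 4] is the price of recentring from [c] to a
    point [v] within distance 2. *)
Definition Kdiff : R := 4 * pi ^+ 2 * expR 4.

Lemma Kdiff_ge1 : 1 <= Kdiff.
Proof.
have p2 := @pi_ge2 R; have e1 : 1 <= expR (4 : R) by rewrite -expR0 ler_expR.
rewrite /Kdiff; have : 4 <= pi ^+ 2 :> R by nra.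
move: (pi ^+ 2) (expR 4) e1 => p e; nra.
Qed.

(* Here [gs pi] is the unit Gaussian [exp (- pi v^2)]; a derivative of it at a
   point within distance 2 of [v] is controlled by the wider Gaussian. *)
Lemma wide_gs (c v : R) : `|c - v| <= 2 ->
  4 * pi ^+ 2 * (1 + c ^+ 2) * gs pi c <= Kdiff * gs (1 / 2) v.
Proof.
move=> cv; rewrite /Kdiff -mulrA -[leRHS]mulrA ler_pM2l; last by rewrite mulr_gt0// exprn_gt0// pi_gt0.
rewrite /gs -expRD.
apply: (@le_trans _ _ (expR (c ^+ 2) * expR (- (pi * c ^+ 2)))).
  by rewrite ler_wpM2r ?expR_ge0// expR_ge1Dx.
rewrite -expRD ler_expR.
have p2 := @pi_ge2 R.
have h1 : 2 * c ^+ 2 <= pi * c ^+ 2 by rewrite ler_wpM2r ?sqr_ge0.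
have h2 : (c - v) ^+ 2 <= 4.
  have -> : 4 = 2 ^+ 2 :> R by ring.
  by rewrite -[leLHS]real_normK ?num_real// lerXn2r// nnegrE.
(* This square is [v^2 / 2 <= c^2 + (c - v)^2] in disguise. *)
have h3 := sqr_ge0 (2 * c - v).
move: (pi * c ^+ 2) h1 => p h1; nra.
Qed.

Lemma gs_pi_le v : gs pi v <= gs (1 / 2) v :> R.
Proof.
rewrite /gs ler_expR lerN2 ler_wpM2r ?sqr_ge0//.
by have := @pi_ge2 R; lra.
Qed.

Lemma gs_diff1 (v h : R) : `|h| <= 1 ->
  `|gs pi (v + h) - gs pi v| <= Kdiff * `|h| * gs (1 / 2) v.
Proof.
move=> h1; have [c cv ->] := mvt_everywhere v (v + h) (is_derive_gs pi).
rewrite addrAC subrr add0r in cv *.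
rewrite normrM [leRHS]mulrAC ler_wpM2r//.
apply: le_trans (wide_gs (c := c) (v := v) _); last by rewrite (le_trans cv)// (le_trans h1)// ler1n.
rewrite normrM (ger0_norm (ltW (gs_gt0 _ _))) ler_wpM2r ?(ltW (gs_gt0 _ _))//.
have p2 := @pi_ge2 R.
rewrite normrN !normrM normr_nat (ger0_norm (pi_ge0 R)).
have cc : `|c| <= 1 + c ^+ 2.
  by rewrite -(real_normK (num_real c)); have := sqr_ge0 (`|c| - 1 / 2); nra.
have c0 := normr_ge0 c.
have hp : 2 * pi <= 4 * pi ^+ 2 :> R by nra.
apply: (@le_trans _ _ (2 * pi * (1 + c ^+ 2))).
  by rewrite ler_wpM2l// mulr_ge0// pi_ge0.
by rewrite ler_wpM2r// addr_ge0 ?sqr_ge0.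
Qed.

Lemma is_derive_shift (f : R -> R) (a df x : R) :
  is_derive (x + a) 1 f df -> is_derive x 1 (fun y => f (y + a)) df.
Proof.
move=> h; have d1 : is_derive x 1 (fun y : R => y + a) 1.
  by apply: is_derive_eq; rewrite addr0.
have := @is_derive1_comp R f (fun y => y + a) x _ _ h d1.
by move=> h'; apply: is_derive_eq; rewrite ?mulr1 ?mul1r.
Qed.

Lemma is_derive_gs_prime (b k : R) : is_derive k 1 (fun k => - (2 * b * k) * gs b k)
  ((4 * b ^+ 2 * k ^+ 2 - 2 * b) * gs b k).
Proof.
have h := is_derive_gs b k.
by apply: is_derive_eq; rewrite /GRing.scale /=; ring.
Qed.

Lemma gs_diff2 (v h a : R) : `|h| <= 1 -> `|a| <= 1 ->
  `|gs pi (v + h + a) - gs pi (v + h) - (gs pi (v + a) - gs pi v)| <=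
  Kdiff * (`|h| * `|a|) * gs (1 / 2) v.
Proof.
move=> h1 a1; pose f x := gs pi (x + a) - gs pi x.
pose g' (x : R) := - (2 * pi * x) * gs pi x.
have df (x : R) : is_derive x 1 f (g' (x + a) - g' x).
  have d1 := is_derive_shift (is_derive_gs pi (x + a)).
  have d2 := is_derive_gs pi x.
  by rewrite /f; apply: is_derive_eq.
have [c cv E] := mvt_everywhere v (v + h) df.
rewrite -[X in `|X| <= _]/(f (v + h) - f v) E.
have [c' cv' ->] := mvt_everywhere c (c + a) (is_derive_gs_prime pi).
have e1 : v + h - v = h by ring.
have e2 : c + a - c = a by ring.
rewrite e1 in cv *; rewrite e2 in cv' *.
rewrite !normrM (ger0_norm (ltW (gs_gt0 _ _))).
have d2 : `|c' - v| <= 2.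
  have -> : c' - v = (c' - c) + (c - v) by ring.
  by rewrite (le_trans (ler_normD _ _))//; lra.
have W := wide_gs d2.
rewrite -mulrA [`|a| * _]mulrC [leRHS]mulrAC ler_wpM2r ?mulr_ge0//.
apply: le_trans W; rewrite ler_wpM2r ?(ltW (gs_gt0 _ _))//.
have p2 := @pi_ge2 R; have hp : 2 * pi <= 4 * pi ^+ 2 :> R by nra.
have q0 : 0 <= 4 * pi ^+ 2 * c' ^+ 2 :> R by rewrite mulr_ge0 ?sqr_ge0// mulr_ge0 ?sqr_ge0.
by rewrite ler_norml; apply/andP; split; lra.
Qed.

Lemma gs_scale (b u s : R) : s != 0 -> gs b (u / s) = gs (b / s ^+ 2) u.
Proof. by move=> s0; rewrite /gs expr_div_n; congr expR; field. Qed.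

(** One coordinate of the kernel of [heat], and next to it [wk], a wider Gaussian at the same scale
    that dominates both the kernel and its difference quotients. *)
Definition gk (s u : R) : R := s^-1 * gs (pi / s ^+ 2) u.
Definition wk (s u : R) : R := s^-1 * gs (1 / 2 / s ^+ 2) u.

Lemma gkE s u : s != 0 -> gk s u = s^-1 * gs pi (u / s).
Proof. by move=> s0; rewrite gs_scale. Qed.

Lemma wkE s u : s != 0 -> wk s u = s^-1 * gs (1 / 2) (u / s).
Proof. by move=> s0; rewrite gs_scale. Qed.

Lemma gk_ge0 s u : 0 < s -> 0 <= gk s u.
Proof. by move=> s0; rewrite mulr_ge0 ?invr_ge0 ?(ltW s0) ?(ltW (gs_gt0 _ _)). Qed.

Lemma wk_ge0 s u : 0 < s -> 0 <= wk s u.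
Proof. by move=> s0; rewrite mulr_ge0 ?invr_ge0 ?(ltW s0) ?(ltW (gs_gt0 _ _)). Qed.

Lemma gk_le s u : 0 < s -> `|gk s u| <= 1 * wk s u.
Proof.
move=> s0; have s1 : s != 0 by rewrite gt_eqF.
rewrite ger0_norm ?gk_ge0// gkE// wkE// mul1r ler_wpM2l ?invr_ge0 ?(ltW s0)//.
exact: gs_pi_le.
Qed.

Lemma gk_diff1 s u h : 0 < s -> `|h| <= s ->
  `|gk s (u + h) - gk s u| <= Kdiff * (`|h| / s) * wk s u.
Proof.
move=> s0 hs; have s1 : s != 0 by rewrite gt_eqF.
rewrite !gkE// wkE// -mulrBr normrM ger0_norm ?invr_ge0 ?(ltW s0)//.
rewrite mulrDl mulrCA ler_wpM2l ?invr_ge0 ?(ltW s0)//.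
have -> : `|h| / s = `|h / s| by rewrite normrM normfV (gtr0_norm s0).
by apply: gs_diff1; rewrite normrM normfV (gtr0_norm s0) ler_pdivrMr// mul1r.
Qed.

Lemma gk_diff2 s u h a : 0 < s -> `|h| <= s -> `|a| <= s ->
  `|gk s (u + h + a) - gk s (u + h) - (gk s (u + a) - gk s u)| <=
  Kdiff * (`|h| / s * (`|a| / s)) * wk s u.
Proof.
move=> s0 hs as_; have s1 : s != 0 by rewrite gt_eqF.
rewrite !gkE// wkE// -!mulrBr normrM ger0_norm ?invr_ge0 ?(ltW s0)//.
rewrite !mulrDl mulrCA ler_wpM2l ?invr_ge0 ?(ltW s0)//.
have e b : `|b| / s = `|b / s| by rewrite normrM normfV (gtr0_norm s0).
rewrite !e; apply: gs_diff2; by rewrite -e ler_pdivrMr// mul1r.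
Qed.

End KernelDifferences.

Section HeatBounds.
Context {R : realType}.
Notation mu := (@lebesgue_measure R).
Notation m2 := (sprod mu mu).

Lemma gs_translate (c x : R) : 0 < c ->
  mu.-integrable setT (fun y => (gs c (x - y))%:E) /\
  \int[mu]_y gs c (x - y) = Num.sqrt (pi / c).
Proof.
move=> c0; have [ig eg] := gs_integral c0.
have E : (fun y => gs c (x - y)) = (fun y => gs c (1 * y + - x)).
  by apply/funext => y; rewrite /gs; congr expR; ring.
have [||i1 e1] := @Rintegral_affine R (gs c) (gs c) 1 (- x) ltr01
  (@continuous_gs R c) (@continuous_gs R c).
- by move=> y; rewrite ger0_norm// ltW// gs_gt0.
- exact: ig.
split; last by rewrite E -eg e1 mul1r.
by move: i1; apply: eq_integrable => // y _; rewrite -[X in _ = X%:E]/((fun y => gs c (x - y)) y) E.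
Qed.

Lemma gs2_translate (c : R) (x : R * R) : 0 < c ->
  m2.-integrable setT (fun y => (gs2 c (x - y))%:E) /\
  \int[m2]_y gs2 c (x - y) = pi / c.
Proof.
move=> c0; have [i1 e1] := gs_translate x.1 c0; have [i2 e2] := gs_translate x.2 c0.
have iF : m2.-integrable setT (EFin \o (fun y => gs2 c (x - y))).
  apply: (@integrable_prod_dominated _ _ _ _ _ mu mu (fun y => gs2 c (x - y))
    (fun y => gs c (x.1 - y)) (fun y => gs c (x.2 - y))) => //.
    by apply: measurableT_comp; [exact: measurable_gs2|exact: measurable_rsub].
  by move=> a b; rewrite ger0_norm ?(ltW (gs2_gt0 _ _)).
split => //.
rewrite /sprod Rintegral_prod1//; last first.
  move=> a; have := integrableZl measurableT (gs c (x.1 - a)) i2.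
  by apply: eq_integrable.
transitivity (\int[mu]_a (gs c (x.1 - a) * Num.sqrt (pi / c))).
  by apply: eq_Rintegral => a _; rewrite -e2 -RintegralZl.
by rewrite RintegralZr// e1 -expr2 sqr_sqrtr// divr_ge0 ?pi_ge0// ltW.
Qed.

Definition gk2 (s : R) (z : R * R) := gk s z.1 * gk s z.2.
Definition wk2 (s : R) (z : R * R) := wk s z.1 * wk s z.2.

Lemma gk2E s z : gk2 s z = s ^- 2 * gs2 (pi / s ^+ 2) z.
Proof. by rewrite /gk2 /gk /gs2 expr2 invfM; ring. Qed.

Lemma wk2E s z : wk2 s z = s ^- 2 * gs2 (1 / 2 / s ^+ 2) z.
Proof. by rewrite /wk2 /wk /gs2 expr2 invfM; ring. Qed.

Lemma gk2_translate s x : 0 < s ->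
  m2.-integrable setT (fun y => (gk2 s (x - y))%:E) /\
  \int[m2]_y gk2 s (x - y) = 1.
Proof.
move=> s0; have p0 := @pi_gt0 R.
have c0 : 0 < pi / s ^+ 2 by rewrite divr_gt0// exprn_gt0.
have [i1 e1] := gs2_translate x c0.
split.
  have := integrableZl measurableT (s ^- 2) i1.
  by apply: eq_integrable => // y _; rewrite gk2E.
under eq_Rintegral do rewrite gk2E.
rewrite RintegralZl// e1; have s1 : s != 0 by rewrite gt_eqF.
by move: (pi : R) p0 => p p0; field; rewrite s1 gt_eqF.
Qed.

Lemma wk2_translate s x : 0 < s ->
  m2.-integrable setT (fun y => (wk2 s (x - y))%:E) /\
  \int[m2]_y wk2 s (x - y) = 2 * pi.
Proof.
move=> s0; have c0 : 0 < 1 / 2 / s ^+ 2 by rewrite divr_gt0// exprn_gt0.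
have [i1 e1] := gs2_translate x c0.
split.
  have := integrableZl measurableT (s ^- 2) i1.
  by apply: eq_integrable => // y _; rewrite wk2E.
under eq_Rintegral do rewrite wk2E.
rewrite RintegralZl// e1; have s1 : s != 0 by rewrite gt_eqF.
by move: (pi : R) => p; field; rewrite s1.
Qed.

Variables (f : R * R -> R) (B : R).
Hypothesis fi : m2.-integrable setT (EFin \o f).
Hypothesis fB : forall x, `|f x| <= B.

Let B0 : 0 <= B. Proof. exact: le_trans (fB 0). Qed.

Lemma integrable_gk2 s x : 0 < s ->
  m2.-integrable setT (fun y => (f y * gk2 s (x - y))%:E).
Proof.
move=> s0; have c0 : 0 < pi / s ^+ 2 by rewrite divr_gt0 ?pi_gt0// exprn_gt0.
have := integrableZl measurableT (s ^- 2) (integrable_translate fi x c0).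
by apply: eq_integrable => // y _; rewrite gk2E -EFinM; congr EFin; ring.
Qed.

Lemma heatE s x : heat f s x = \int[m2]_y (f y * gk2 s (x - y)).
Proof. by apply: eq_Rintegral => y _; rewrite gk2E. Qed.

Lemma conv_bound (K : R * R -> R) (M s : R) (x : R * R) : 0 < s -> 0 <= M ->
  m2.-integrable setT (fun y => (f y * K y)%:E) ->
  (forall y, `|K y| <= M * wk2 s (x - y)) ->
  `|\int[m2]_y (f y * K y)| <= B * M * (2 * pi).
Proof.
move=> s0 M0 iK KM; have [i1 <-] := wk2_translate x s0.
rewrite -RintegralZl//; apply: (le_trans (le_normr_Rintegral measurableT iK)).
apply: le_Rintegral => //.
- exact: integrable_norm iK.
- exact: (integrableZl measurableT (B * M) i1).
by move=> y _; rewrite normrM -mulrA ler_pM.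
Qed.

Lemma heat_diffE s p q : 0 < s ->
  m2.-integrable setT (fun y => (f y * (gk2 s (p - y) - gk2 s (q - y)))%:E) /\
  heat f s p - heat f s q = \int[m2]_y (f y * (gk2 s (p - y) - gk2 s (q - y))).
Proof.
move=> s0; have i1 := integrable_gk2 p s0; have i2 := integrable_gk2 q s0.
split.
  have := integrableB measurableT i1 i2.
  by apply: eq_integrable => // y _; rewrite mulrBr.
by rewrite !heatE -RintegralB//; apply: eq_Rintegral => y _; rewrite mulrBr.
Qed.

Definition ei (i : bool) : R * R := if i then e2 R else e1 R.

Lemma heat_diff1 s x h i : 0 < s -> 0 <= h <= s ->
  `|heat f s (x + h *: ei i) - heat f s x| <= B * (Kdiff * (h / s)) * (2 * pi).
Proof.
move=> s0 /andP[h0 hs]; have [i1 ->] := heat_diffE (x + h *: ei i) x s0.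
have K0 : 0 <= Kdiff :> R by apply: le_trans Kdiff_ge1.
have M0 : 0 <= Kdiff * (h / s) by rewrite mulr_ge0// divr_ge0// ltW.
apply: (conv_bound (s := s) (x := x)) => // y.
have hs' : `|h| <= s by rewrite ger0_norm.
have -> : x + h *: ei i - y = (x - y) + h *: ei i by rewrite addrAC.
rewrite /gk2 /wk2; case: (x - y) => z1 z2.
have g1 := gk_le z1 s0; have g2 := gk_le z2 s0; rewrite !mul1r in g1 g2.
have d1 := gk_diff1 z1 s0 hs'; have d2 := gk_diff1 z2 s0 hs'.
rewrite (ger0_norm h0) in d1 d2.
case: i {i1} => /=; rewrite /GRing.scale /= ?mulr0 ?mulr1 ?addr0.
  by rewrite -mulrBr normrM mulrCA ler_pM.
by rewrite -mulrBl normrM mulrA ler_pM.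
Qed.

(** Each difference gains its increment divided by [s]. Along the same axis both differences fall on
    one factor of the kernel; along distinct axes they split into a product of two first
    differences, and this case costs [Kdiff ^+ 2]. *)
Lemma heat_diff2 s x h a i j : 0 < s -> 0 <= h <= s -> `|a| <= s ->
  `|heat f s (x + a *: ei j + h *: ei i) - heat f s (x + a *: ei j)
    - (heat f s (x + h *: ei i) - heat f s x)| <=
  B * (Kdiff ^+ 2 * (h / s * (`|a| / s))) * (2 * pi).
Proof.
move=> s0 /andP[h0 hs] as_.
have [i1 E1] := heat_diffE (x + a *: ei j + h *: ei i) (x + a *: ei j) s0.
have [i2 E2] := heat_diffE (x + h *: ei i) x s0.
rewrite [X in `|X - _|]E1 [X in `|_ - X|]E2 {E1 E2}.
have K1 := @Kdiff_ge1 R; have K0 : 0 <= Kdiff :> R by apply: le_trans K1.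
have h0s : 0 <= h / s by rewrite divr_ge0// ltW.
have a0s : 0 <= `|a| / s by rewrite divr_ge0// ltW.
have M0 : 0 <= Kdiff ^+ 2 * (h / s * (`|a| / s)) by rewrite mulr_ge0 ?sqr_ge0 ?(mulr_ge0 h0s a0s).
rewrite -RintegralB//.
under eq_Rintegral do rewrite -mulrBr.
apply: (conv_bound (s := s) (x := x)) => // [|y].
  have := integrableB measurableT i1 i2.
  by apply: eq_integrable => // y _; rewrite -EFinB -mulrBr.
have hs' : `|h| <= s by rewrite ger0_norm.
have -> : x + a *: ei j + h *: ei i - y = (x - y) + a *: ei j + h *: ei i.
  by rewrite addrAC (addrAC x).
have -> : x + a *: ei j - y = (x - y) + a *: ei j by rewrite addrAC.
have -> : x + h *: ei i - y = (x - y) + h *: ei i by rewrite addrAC.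
rewrite /gk2 /wk2; case: (x - y) => z1 z2.
have g1 := gk_le z1 s0; have g2 := gk_le z2 s0; rewrite !mul1r in g1 g2.
have d1 := gk_diff1 z1 s0 hs'; have d2 := gk_diff1 z2 s0 hs'.
have c1 := gk_diff1 z1 s0 as_; have c2 := gk_diff1 z2 s0 as_.
have e1 := gk_diff2 z1 s0 as_ hs'; have e2 := gk_diff2 z2 s0 as_ hs'.
rewrite (ger0_norm h0) in d1 d2 e1 e2.
have w1 := wk_ge0 z1 s0; have w2 := wk_ge0 z2 s0.
have KK : Kdiff <= Kdiff ^+ 2 :> R by rewrite expr2 ler_peMl.
have weaken z : 0 <= z -> Kdiff * (`|a| / s * (h / s)) * z <=
    Kdiff ^+ 2 * (h / s * (`|a| / s)) * z.
  by move=> z0; rewrite ler_wpM2r// [`|a| / s * _]mulrC ler_wpM2r// mulr_ge0.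
have mixed (D D' : R) (A A' : R) : `|D| <= Kdiff * (h / s) * A ->
    `|D'| <= Kdiff * (`|a| / s) * A' -> 
    `|D * D'| <= Kdiff ^+ 2 * (h / s * (`|a| / s)) * (A * A').
  move=> HD HD'; rewrite normrM.
  have -> : Kdiff ^+ 2 * (h / s * (`|a| / s)) * (A * A') =
    (Kdiff * (h / s) * A) * (Kdiff * (`|a| / s) * A') by ring.
  exact: ler_pM.
case: i {i1 i2}; case: j => /=; rewrite /GRing.scale /= !(mulr0, mulr1, addr0).
- rewrite (_ : _ - _ = gk s z1 *
    (gk s (z2 + a + h) - gk s (z2 + a) - (gk s (z2 + h) - gk s z2))); last by ring.
  by rewrite normrM mulrCA; apply: ler_pM => //; exact: le_trans e2 (weaken _ w2).
- rewrite (_ : _ - _ = (gk s (z2 + h) - gk s z2) * (gk s (z1 + a) - gk s z1)); last by ring.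
  by rewrite [wk s z1 * _]mulrC; exact: mixed.
- rewrite (_ : _ - _ = (gk s (z1 + h) - gk s z1) * (gk s (z2 + a) - gk s z2)); last by ring.
  exact: mixed.
- rewrite (_ : _ - _ =
    (gk s (z1 + a + h) - gk s (z1 + a) - (gk s (z1 + h) - gk s z1)) * gk s z2); last by ring.
  by rewrite normrM mulrA; apply: ler_pM => //; exact: le_trans e1 (weaken _ w1).
Qed.

End HeatBounds.

Section Translation.
Context {R : realType}.
Notation mu := (@lebesgue_measure R).
Notation m2 := (sprod mu mu).

Lemma continuous_gk (s : R) : continuous (gk s).
Proof. by move=> u; apply: cvgM; [exact: cvg_cst|exact: continuous_gs]. Qed.

Lemma continuous_gk_sub (s x : R) : continuous (fun y => gk s (x - y)).
Proof.
move=> y; apply: (@continuous_comp _ _ _ (fun y => x - y) (gk s)); last exact: continuous_gk.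
by apply: cvgB; [exact: cvg_cst|exact: cvg_id].
Qed.

Lemma gk_translate (s x : R) : 0 < s ->
  mu.-integrable setT (fun y => (gk s (x - y))%:E).
Proof.
move=> s0; have c0 : 0 < pi / s ^+ 2 by rewrite divr_gt0 ?pi_gt0// exprn_gt0.
have := integrableZl measurableT s^-1 (gs_translate x c0).1.
by apply: eq_integrable.
Qed.

Lemma integrable_mul_gk (phi : R -> R) (B s x : R) : 0 < s ->
  measurable_fun setT phi -> (forall t, `|phi t| <= B) ->
  mu.-integrable setT (fun y => (phi y * gk s (x - y))%:E).
Proof.
move=> s0 mphi phiB; have B0 : 0 <= B by apply: le_trans (phiB 0).
have := integrableZl measurableT B (gk_translate x s0).
apply: le_integrable => //.
  apply/measurable_EFinP/measurable_funM => //.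
  by apply: continuous_measurable_fun; exact: continuous_gk_sub.
move=> y _; rewrite /= lee_fin !normrM ler_wpM2r//.
by rewrite (le_trans (phiB y))// ler_norm.
Qed.

Lemma integrable_mul_gk2 (f : R * R -> R) (B s : R) (x : R * R) : 0 < s ->
  measurable_fun setT f -> (forall t, `|f t| <= B) ->
  m2.-integrable setT (fun y => (f y * gk2 s (x - y))%:E).
Proof.
move=> s0 mf fB; have B0 : 0 <= B by apply: le_trans (fB 0).
apply: (@integrable_prod_dominated _ _ _ _ _ mu mu (fun y => f y * gk2 s (x - y))
    (fun y => B * gk s (x.1 - y)) (fun y => gk s (x.2 - y))).
- apply: measurable_funM => //.
  have -> : (fun y => gk2 s (x - y)) = fun y => s ^- 2 * gs2 (pi / s ^+ 2) (x - y).
    by apply/funext => y; exact: gk2E.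
  apply: measurable_funM => //.
  by apply: measurableT_comp; [exact: measurable_gs2|exact: measurable_rsub].
- exact: (integrableZl measurableT B (gk_translate x.1 s0)).
- exact: gk_translate.
move=> a b; rewrite normrM -mulrA ler_pM// ger0_norm//.
by rewrite mulr_ge0// gk_ge0.
Qed.

Lemma gk_shift (phi : R -> R) (B s u h : R) : 0 < s -> continuous phi ->
  (forall t, `|phi t| <= B) ->
  \int[mu]_t (phi t * gk s (u + h - t)) = \int[mu]_t (phi (t + h) * gk s (u - t)).
Proof.
move=> s0 cphi phiB.
have [| | | |_ ->] := @Rintegral_affine R (fun t => phi t * gk s (u + h - t))
  (fun t => B * gk s (u + h - t)) 1 h ltr01.
- by move=> t; apply: cvgM; [exact: cphi|exact: continuous_gk_sub].
- by move=> t; apply: cvgM; [exact: cvg_cst|exact: continuous_gk_sub].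
- by move=> t; rewrite normrM (ger0_norm (gk_ge0 _ s0)) ler_wpM2r// gk_ge0.
- exact: (integrableZl measurableT B (gk_translate (u + h) s0)).
rewrite mul1r; apply: eq_Rintegral => t _; rewrite mul1r; congr (_ * gk s _).
by ring.
Qed.

Lemma scale_ei (h : R) (i : bool) : h *: ei i = if i then (0, h) else (h, 0).
Proof.
by case: i; rewrite [LHS]surjective_pairing /=; congr (_, _); rewrite ?scaler0//;
  exact: mulr1.
Qed.

Lemma continuous_pairl (y : R) : continuous (fun x : R => (x, y)).
Proof.
by move=> x; apply: (@cvg_pair _ _ _ (nbhs x) (nbhs x) (nbhs y)); [exact: cvg_id|exact: cvg_cst].
Qed.

Lemma continuous_pairr (x : R) : continuous (fun y : R => (x, y)).
Proof.
by move=> y; apply: (@cvg_pair _ _ _ (nbhs y) (nbhs x) (nbhs y)); [exact: cvg_cst|exact: cvg_id].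
Qed.

Variables (f : R * R -> R) (B Om : R).
Hypothesis cf : continuous f.
Hypothesis fi : m2.-integrable setT (EFin \o f).
Hypothesis fB : forall x, `|f x| <= B.
Hypothesis fL : forall x h i, 0 <= h -> `|f (x + h *: ei i) - f x| <= Om * h.

Let mf : measurable_fun [set: R * R] f.
Proof. by apply/measurable_EFinP; exact: (measurable_int _ fi). Qed.

Let cf1 y : continuous (fun x => f (x, y)).
Proof.
move=> x; apply: (@continuous_comp _ _ _ (fun x => (x, y)) f); last exact: cf.
exact: continuous_pairl.
Qed.

Let cf2 x : continuous (fun y => f (x, y)).
Proof.
move=> y; apply: (@continuous_comp _ _ _ (fun y => (x, y)) f); last exact: cf.
exact: continuous_pairr.
Qed.

Let mshift h i : measurable_fun [set: R * R] (fun y => f (y + h *: ei i)).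
Proof.
apply: measurableT_comp => //.
have -> : (fun y => y + h *: ei i) = fun y : R * R => (y.1 + (h *: ei i).1, y.2 + (h *: ei i).2).
  by apply/funext => y; rewrite [LHS]surjective_pairing.
by apply: measurable_fun_pair; apply: measurable_funD.
Qed.

(** The translation passes from the kernel to [f] by Fubini and a one-dimensional substitution in
    the shifted coordinate, the other coordinate being untouched. *)
Lemma heat_shift s x h i : 0 < s ->
  heat f s (x + h *: ei i) = \int[m2]_y (f (y + h *: ei i) * gk2 s (x - y)).
Proof.
move=> s0; rewrite heatE; case: x => x1 x2.
have i1 := integrable_mul_gk2 ((x1, x2) + h *: ei i) s0 mf fB.
have i2 := integrable_mul_gk2 (x1, x2) s0 (mshift h i) (fun t => fB _).
have sec (g : R * R -> R) (z : R * R) : (forall y, continuous (fun x => g (x, y))) ->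
    (forall x, continuous (fun y => g (x, y))) -> (forall y, `|g y| <= B) ->
    (forall x, mu.-integrable setT (fun y => (g (x, y) * gk2 s (z - (x, y)))%:E)) /\
    (forall y, mu.-integrable setT (fun x => (g (x, y) * gk2 s (z - (x, y)))%:E)).
  move=> cg1 cg2 gB; split => [x|y].
    have h1 := @integrable_mul_gk (fun y => g (x, y)) B s z.2 s0.
    have := integrableZl measurableT (gk s (z.1 - x))
      (h1 (continuous_measurable_fun (cg2 x)) (fun t => gB _)).
    by apply: eq_integrable => // y _; rewrite -EFinM; congr EFin; rewrite /gk2 /=; ring.
  have h1 := @integrable_mul_gk (fun x => g (x, y)) B s z.1 s0.
  have := integrableZl measurableT (gk s (z.2 - y))
    (h1 (continuous_measurable_fun (cg1 y)) (fun t => gB _)).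
  by apply: eq_integrable => // x _; rewrite -EFinM; congr EFin; rewrite /gk2 /=; ring.
have [s1 s2] := sec f ((x1, x2) + h *: ei i) cf1 cf2 fB.
have [s3 s4] : (forall x, mu.-integrable setT
      (fun y => (f ((x, y) + h *: ei i) * gk2 s ((x1, x2) - (x, y)))%:E)) /\
    (forall y, mu.-integrable setT
      (fun x => (f ((x, y) + h *: ei i) * gk2 s ((x1, x2) - (x, y)))%:E)).
  apply: (sec (fun y => f (y + h *: ei i))) => //.
    move=> y x; apply: (@continuous_comp _ _ _ (fun x => (x, y) + h *: ei i) f); last exact: cf.
    by apply: cvgD; [exact: continuous_pairl|exact: cvg_cst].
  move=> x y; apply: (@continuous_comp _ _ _ (fun y => (x, y) + h *: ei i) f); last exact: cf.
  by apply: cvgD; [exact: continuous_pairr|exact: cvg_cst].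
have RM (c : R) (g k : R -> R) : mu.-integrable setT (fun y => (g y)%:E) ->
    (forall y, k y = c * g y) -> \int[mu]_y k y = c * \int[mu]_y g y.
  by move=> ig kE; rewrite -RintegralZl//; apply: eq_Rintegral => y _.
case: i i1 i2 s1 s2 s3 s4 => i1 i2 s1 s2 s3 s4.
  rewrite (Rintegral_prod1 i1 s1) (Rintegral_prod1 i2 s3).
  apply: eq_Rintegral => a _.
  have j1 := integrable_mul_gk (x2 + h) s0 (continuous_measurable_fun (@cf2 a)) (fun t => fB _).
  rewrite (RM (gk s (x1 - a)) _ _ j1); last first.
    by move=> y; rewrite scale_ei /gk2 /= addr0; ring.
  rewrite (gk_shift _ _ s0 (@cf2 a) (fun t => fB _)).
  have j2 : mu.-integrable setT (fun y => (f (a, y + h) * gk s (x2 - y))%:E).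
    apply: (@integrable_mul_gk (fun y => f (a, y + h)) B) => //.
    apply: continuous_measurable_fun => y.
    apply: (@continuous_comp _ _ _ (fun y => y + h) (fun y => f (a, y))); last exact: cf2.
    by apply: cvgD; [exact: cvg_id|exact: cvg_cst].
  rewrite [RHS](RM (gk s (x1 - a)) _ _ j2)// => y.
  rewrite (_ : (a, y) + h *: ei true = (a, y + h)); last first.
    by rewrite scale_ei; congr (_, _); rewrite /= addr0.
  by rewrite /gk2 /=; ring.
rewrite (Rintegral_prod2 i1 s2) (Rintegral_prod2 i2 s4).
apply: eq_Rintegral => a _.
have j1 := integrable_mul_gk (x1 + h) s0 (continuous_measurable_fun (@cf1 a)) (fun t => fB _).
rewrite (RM (gk s (x2 - a)) _ _ j1); last first.
  by move=> y; rewrite scale_ei /gk2 /= addr0; ring.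
rewrite (gk_shift _ _ s0 (@cf1 a) (fun t => fB _)).
have j2 : mu.-integrable setT (fun y => (f (y + h, a) * gk s (x1 - y))%:E).
  apply: (@integrable_mul_gk (fun y => f (y + h, a)) B) => //.
  apply: continuous_measurable_fun => y.
  apply: (@continuous_comp _ _ _ (fun y => y + h) (fun y => f (y, a))); last exact: cf1.
  by apply: cvgD; [exact: cvg_id|exact: cvg_cst].
rewrite [RHS](RM (gk s (x2 - a)) _ _ j2)// => y.
rewrite (_ : (y, a) + h *: ei false = (y + h, a)); last first.
  by rewrite scale_ei; congr (_, _); rewrite /= addr0.
by rewrite /gk2 /=; ring.
Qed.

(** Averaging against a mass 1 does not increase a Lipschitz constant. Unlike the bounds that
    differentiate the kernel, this one does not degenerate as [s] tends to 0. *)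
Lemma heat_lipschitz s x h i : 0 < s -> 0 <= h ->
  `|heat f s (x + h *: ei i) - heat f s x| <= Om * h.
Proof.
move=> s0 h0; have i1 := integrable_mul_gk2 x s0 (mshift h i) (fun t => fB _).
have i2 := integrable_mul_gk2 x s0 mf fB.
rewrite heat_shift// heatE -RintegralB//.
have i3 : m2.-integrable setT (fun y => (f (y + h *: ei i) * gk2 s (x - y) - f y * gk2 s (x - y))%:E).
  exact: (integrableB measurableT i1 i2).
apply: (le_trans (le_normr_Rintegral measurableT i3)).
have [j1 j2] := gk2_translate x s0.
rewrite -[leRHS]mulr1 -j2 -RintegralZl//; apply: le_Rintegral => //.
- exact: integrable_norm i3.
- exact: (integrableZl measurableT (Om * h) j1).
move=> y _; rewrite -mulrBl normrM.
have g0 : 0 <= gk2 s (x - y) by rewrite mulr_ge0// gk_ge0.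
by rewrite (ger0_norm g0) ler_wpM2r// fL.
Qed.

End Translation.

Section VelocityModulus.
Context {R : realType}.
Notation mu := (@lebesgue_measure R).
Notation m2 := (sprod mu mu).
Notation pos := (`]0%R, +oo[%classic : set R).

(** For [s > 0] and small [d] a single function, with an explicit primitive, comparable to [1 / d]
    for [s <= d], to [1 / s] for [d <= s <= 1] and to [1 / s^2] beyond. The absolute values only
    make it continuous on the whole line. *)
Definition log_kernel (d s : R) : R := ((`|s| + d) * (`|s| + 1))^-1.

Lemma continuous_log_kernel (d : R) : 0 < d -> continuous (log_kernel d).
Proof.
move=> d0 s; apply: cvgV.
  by rewrite mulf_neq0 ?gt_eqF// ltr_wpDl.
by apply: cvgM; apply: cvgD; [exact: norm_continuous|exact: cvg_cst|
  exact: norm_continuous|exact: cvg_cst].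
Qed.

Lemma log_kernel_ge0 (d s : R) : 0 < d -> 0 <= log_kernel d s.
Proof. by move=> d0; rewrite invr_ge0 mulr_ge0// addr_ge0// ltW. Qed.

Lemma log_kernel_integral (d : R) : 0 < d < 1 ->
  (\int[mu]_(s in `[0%R, +oo[) (log_kernel d s)%:E)%E = (- ln d / (1 - d))%:E.
Proof.
move=> /andP[d0 d1].
have c0 : 1 - d != 0 by rewrite gt_eqF// subr_gt0.
(* The primitive given by partial fractions, normalized to tend to 0 at infinity. *)
pose F (s : R) := (1 - d)^-1 * (ln (s + d) - ln (s + 1)).
have dF (s : R) : 0 <= s -> is_derive s 1 F (log_kernel d s).
  move=> s0; have sd : 0 < s + d by rewrite ltr_wpDl.
  have s1 : 0 < s + 1 by rewrite ltr_wpDl.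
  have h1 := is_derive_shift (is_derive1_ln sd).
  have h2 := is_derive_shift (is_derive1_ln s1).
  rewrite /F; apply: is_derive_eq; rewrite /GRing.scale /= /log_kernel ger0_norm//.
  move: sd s1; rewrite !lt0r => /andP[sd _] /andP[s1 _].
  by field; rewrite sd s1 c0.
have -> : - ln d / (1 - d) = 0 - F 0.
  by rewrite /F !add0r ln1; ring.
rewrite EFinB; apply: ge0_continuous_FTC2y.
- by move=> s s0; exact: log_kernel_ge0.
- by apply: continuous_subspaceT; exact: continuous_log_kernel.
- apply/cvgrPdist_le => e e0.
  apply: filterS (nbhs_pinfty_ge (num_real (Num.max 1 (e^-1)))) => s.
  rewrite ge_max => /andP[s1 se]; rewrite sub0r normrN.
  have s0 : 0 < s by rewrite (lt_le_trans _ s1).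
  have sd : 0 < s + d by rewrite addr_gt0.
  have s1' : 0 < s + 1 by rewrite addr_gt0.
  have L0 : ln (s + d) <= ln (s + 1) by rewrite ler_ln ?posrE// lerD2l ltW.
  have L1 : ln (s + 1) - ln (s + d) <= (1 - d) / s.
    rewrite -ln_div ?posrE//.
    have -> : (s + 1) / (s + d) = 1 + (1 - d) / (s + d) by field; rewrite gt_eqF.
    have q0 : 0 < (1 - d) / (s + d) by rewrite divr_gt0// subr_gt0.
    apply: (@le_trans _ _ ((1 - d) / (s + d))).
      by rewrite -[leRHS]expRK ler_ln ?posrE ?expR_gt0 ?expR_ge1Dx// ltr_wpDr// ltW.
    by rewrite ler_pM2l ?subr_gt0// lef_pV2 ?posrE// lerDl ltW.
  rewrite /F normrM normfV (gtr0_norm (_ : 0 < 1 - d)) ?subr_gt0//.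
  rewrite distrC ger0_norm ?subr_ge0//.
  apply: (@le_trans _ _ s^-1); last by rewrite -[leRHS]invrK lef_pV2 ?posrE ?invr_gt0.
  by rewrite mulrC ler_pdivrMr ?subr_gt0// mulrC.
- by move=> s s0; have [] := dF s (ltW s0).
- by apply: cvg_at_right_filter; exact: is_derive1_continuous (dF 0 (lexx 0)).
- move=> s; rewrite in_itv /= andbT => s0; rewrite derive1E.
  by have h := dF s (ltW s0); rewrite derive_val.
Qed.

Lemma pos_integral (b : R -> R) (V : R) : continuous b -> (forall s, 0 <= b s) ->
  (\int[mu]_(s in `[0%R, +oo[) (b s)%:E)%E = V%:E ->
  mu.-integrable setT (fun s => (\1_pos s * b s)%:E) /\
  \int[mu]_s (\1_pos s * b s) = V.
Proof.
move=> cb b0 E.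
have mb : measurable_fun setT b by exact: continuous_measurable_fun.
have E' : (\int[mu]_s (\1_pos s * b s)%:E)%E = V%:E.
  transitivity (\int[mu]_(s in pos) (b s)%:E)%E.
    rewrite [in RHS]integral_mkcond; apply: eq_integral => s _.
    by rewrite patchE /indic; case: ifPn => _ /=; rewrite ?mul1r ?mul0r.
  by rewrite integral_itv_obnd_cbnd//; apply: measurable_funTS; exact/measurable_EFinP.
split; last by rewrite /Rintegral E'.
apply/integrableP; split.
  by apply/measurable_EFinP/measurable_funM => //; exact: measurable_indic.
rewrite (_ : (\int[mu]_x _)%E = V%:E) ?ltry// -E'; apply: eq_integral => s _.
by rewrite /= ger0_norm// mulr_ge0// /indic; case: (_ \in _).
Qed.

Lemma Rintegral_second_diff d (T : measurableType d) (m : {measure set T -> \bar R})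
    (a b c e : T -> R) :
  m.-integrable setT (fun x => (a x)%:E) -> m.-integrable setT (fun x => (b x)%:E) ->
  m.-integrable setT (fun x => (c x)%:E) -> m.-integrable setT (fun x => (e x)%:E) ->
  m.-integrable setT (fun x => (a x - b x - (c x - e x))%:E) /\
  \int[m]_x a x - \int[m]_x b x - (\int[m]_x c x - \int[m]_x e x) =
  \int[m]_x (a x - b x - (c x - e x)).
Proof.
move=> ia ib ic ie; have i1 := integrableB measurableT ia ib.
have i2 := integrableB measurableT ic ie.
split; first exact: integrableB i1 i2.
by rewrite RintegralB// RintegralB// RintegralB.
Qed.

Let normB_le_double (a b c : R) : `|a| <= c -> `|b| <= c -> `|a - b| <= 2 * c.
Proof. by move=> ha hb; have := ler_normB a b; lra. Qed.

Let kernel_den_small (s d : R) : 0 < s -> s <= d -> d <= 1 / 2 -> (s + d) * (s + 1) <= 4 * d.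
Proof. by move=> s0 sd d2; nra. Qed.

Let kernel_den_mid (s d : R) : 0 < d -> d < s -> s <= 1 -> (s + d) * (s + 1) <= 4 * s.
Proof. by move=> d0 ds s1; nra. Qed.

Let eight_le (p k : R) : 2 <= p -> 1 <= k -> 8 <= 16 * p * k.
Proof. by move=> p2 k1; nra. Qed.

Let half_facts (d : R) : d <= 1 / 2 -> d < 1 /\ (1 - d)^-1 <= 2.
Proof.
move=> h; split; first by lra.
have c : 0 < 1 - d by lra.
by rewrite -(ler_pM2r c) mulVf ?gt_eqF//; lra.
Qed.

Variables (th : R * R -> R) (B Om : R).
Hypothesis cth : continuous th.
Hypothesis thi : m2.-integrable setT (EFin \o th).
Hypothesis thB : forall x, `|th x| <= B.
Hypothesis thL : forall x h i, 0 <= h -> `|th (x + h *: ei i) - th x| <= Om * h.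
Hypothesis symb : cintegrable (half_symbol th).
Hypothesis Om_gt_e : expR 1 < Om.

Let f x := - th x.
Let cf : continuous f. Proof. by move=> x; apply: cvgN; exact: cth. Qed.
Let fi : m2.-integrable setT (EFin \o f).
Proof. by have := integrableN thi; apply: eq_integrable. Qed.
Let fB x : `|f x| <= B. Proof. by rewrite normrN. Qed.
Let fL x h i : 0 <= h -> `|f (x + h *: ei i) - f x| <= Om * h.
Proof. by move=> h0; rewrite /f -opprD normrN; exact: thL. Qed.

Let symbf : cintegrable (half_symbol f).
Proof.
have [iRe iIm] := symb; split.
  have := integrableN iRe; apply: eq_integrable => // k _.
  rewrite -[LHS]/((- complex.Re (half_symbol th k))%:E); congr EFin; rewrite !Re_half_symbol -mulrN -[in LHS]mulN1r; congr (_ * _).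
  rewrite -RintegralZl//; last exact: integrable_mul_cos.
  by apply: eq_Rintegral => y _; rewrite mulN1r mulNr.
have := integrableN iIm; apply: eq_integrable => // k _.
rewrite -[LHS]/((- complex.Im (half_symbol th k))%:E); congr EFin; rewrite !Im_half_symbol// -mulrN; congr (- (_ * _)).
rewrite -[LHS]mulN1r -RintegralZl//; last exact: integrable_mul_sin.
by apply: eq_Rintegral => y _; rewrite mulN1r mulNr.
Qed.

Let d : R := Om^-1.
Let Om0 : 0 < Om. Proof. exact: lt_trans (expR_gt0 1) Om_gt_e. Qed.
Let d0 : 0 < d. Proof. by rewrite invr_gt0. Qed.
Let Om2 : 2 <= Om.
Proof. by apply: le_trans (ltW Om_gt_e); have := expR_ge1Dx (1 : R). Qed.
Let d12 : d <= 1 / 2.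
Proof. by rewrite mul1r lef_pV2 ?posrE. Qed.
Let B0 : 0 <= B. Proof. exact: le_trans (thB 0). Qed.

(** The three ranges of [s] in the next lemma require the constants [8], [16 pi Kdiff B] and
    [8 pi Kdiff^2 B]; this one exceeds them all. *)
Let Cc : R := 16 * pi * Kdiff ^+ 2 * (1 + B).

(** For [s <= 1] the increment [a] may exceed [s], so only the difference in [h] is exploited, at
    each of the two base points separately: by the gradient bound for [s <= d], by the kernel for
    larger [s]. For [s > 1] both differences are exploited, and the resulting [s^-2] makes the
    integral converge at infinity. *)
Lemma heat_second_diff s x h a i j : 0 < s -> 0 < h <= d -> `|a| <= 1 ->
  `|heat f s (x + a *: ei j + h *: ei i) - heat f s (x + a *: ei j)
    - (heat f s (x + h *: ei i) - heat f s x)| <= Cc * h * log_kernel d s.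
Proof.
move=> s0 /andP[h0 hd] a1; rewrite /log_kernel (gtr0_norm s0).
have K1 := @Kdiff_ge1 R; have p2 := @pi_ge2 R.
have KK : Kdiff <= Kdiff ^+ 2 :> R by rewrite expr2 ler_peMl// (le_trans _ K1).
have K2 : 1 <= Kdiff ^+ 2 :> R by rewrite (le_trans K1).
have q0 : 0 < (s + d) * (s + 1) by rewrite mulr_gt0// addr_gt0.
rewrite ler_pdivlMr//.
have [sd|ds] := leP s d.
  have l1 := heat_lipschitz cf fi fB fL (x + a *: ei j) i s0 (ltW h0).
  have l2 := heat_lipschitz cf fi fB fL x i s0 (ltW h0).
  set D := `|_|; have Dle : D <= 2 * Om * h by rewrite -mulrA; exact: normB_le_double l1 l2.
  have q1 := kernel_den_small s0 sd d12.
  apply: (@le_trans _ _ (2 * Om * h * (4 * d))).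
    by apply: ler_pM => //; rewrite ?normr_ge0// ltW.
  have -> : 2 * Om * h * (4 * d) = 8 * h.
    by rewrite /d; field; rewrite gt_eqF.
  rewrite ler_pM2r// /Cc -mulrA.
  have : 1 <= Kdiff ^+ 2 * (1 + B) by rewrite mulr_ege1// lerDl.
  exact: eight_le.
have [s1|s1] := leP s 1.
  have hs : 0 <= h <= s by rewrite (ltW h0) (le_trans hd)// ltW.
  have l1 := heat_diff1 fi fB (x + a *: ei j) i s0 hs.
  have l2 := heat_diff1 fi fB x i s0 hs.
  set D := `|_|; have Dle : D <= 2 * (B * (Kdiff * (h / s)) * (2 * pi)).
    exact: normB_le_double l1 l2.
  have q1 := kernel_den_mid d0 ds s1.
  apply: (@le_trans _ _ (2 * (B * (Kdiff * (h / s)) * (2 * pi)) * (4 * s))).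
    by apply: ler_pM => //; rewrite ?normr_ge0// ltW.
  have -> : 2 * (B * (Kdiff * (h / s)) * (2 * pi)) * (4 * s) = 16 * pi * (Kdiff * B) * h.
    by move: (pi : R) Kdiff => p k; field; rewrite gt_eqF.
  rewrite ler_pM2r// /Cc -(mulrA (16 * pi)) ler_wpM2l ?mulr_ge0 ?pi_ge0//.
  by apply: ler_pM => //; [rewrite (le_trans _ K1)|rewrite lerDr].
have hs : 0 <= h <= s by rewrite (ltW h0) (le_trans hd)// ltW.
have as_ : `|a| <= s by rewrite (le_trans a1)// ltW.
have l1 := heat_diff2 fi fB x i j s0 hs as_.
set D := `|_| in l1 *.
have q1 : (s + d) * (s + 1) <= 4 * s ^+ 2 by nra.
apply: (@le_trans _ _ (B * (Kdiff ^+ 2 * (h / s * (`|a| / s))) * (2 * pi) * (4 * s ^+ 2))).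
  by apply: ler_pM => //; rewrite ?normr_ge0// ltW.
have -> : B * (Kdiff ^+ 2 * (h / s * (`|a| / s))) * (2 * pi) * (4 * s ^+ 2) =
    8 * pi * (Kdiff ^+ 2 * (B * `|a|)) * h.
  by move: (pi : R) Kdiff `|a| => p k b; field; rewrite gt_eqF.
rewrite ler_pM2r// /Cc -(mulrA (16 * pi)).
apply: ler_pM; rewrite ?mulr_ge0 ?pi_ge0 ?sqr_ge0//.
  by rewrite ler_wpM2r ?pi_ge0// ler_nat.
by rewrite ler_wpM2l ?sqr_ge0// (le_trans (ler_piMr B0 a1))// lerDr.
Qed.

Lemma stream_second_diff x h a i j : 0 < h <= d -> `|a| <= 1 ->
  `|stream_function th (x + a *: ei j + h *: ei i) - stream_function th (x + a *: ei j)
    - (stream_function th (x + h *: ei i) - stream_function th x)| <=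
  32 * Kdiff ^+ 2 * (1 + B) * ln Om * h.
Proof.
move=> hd a1; set p1 := x + a *: ei j + h *: ei i; set p2 := x + a *: ei j.
set p3 := x + h *: ei i.
pose Psi k := phase f p1 k - phase f p2 k - (phase f p3 k - phase f x k).
have imp p := @integrable_multiplier_phase R f fi p symbf.
have E : stream_function th p1 - stream_function th p2
    - (stream_function th p3 - stream_function th x) =
    \int[m2]_k ((2 * pi * enorm k)^-1 * Psi k).
  have SE p : stream_function th p = \int[m2]_k ((2 * pi * enorm k)^-1 * phase f p k).
    exact: (inv_half_laplacianE fi).
  rewrite !SE (Rintegral_second_diff (imp p1) (imp p2) (imp p3) (imp x)).2.
  by apply: eq_Rintegral => k _; rewrite /Psi !mulrBr.
have h0 : 0 < h by case/andP: hd.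
have Kd0 : 0 <= Kdiff :> R by exact: le_trans ler01 Kdiff_ge1.
have B1 : 0 <= 1 + B by rewrite addr_ge0.
have Cc0 : 0 <= Cc.
  by rewrite /Cc; apply: mulr_ge0 => //; apply: mulr_ge0; [rewrite mulr_ge0// pi_ge0|exact: sqr_ge0].
pose bnd s := Cc * h * log_kernel d s.
have d1 : 0 < d < 1 by rewrite d0 (half_facts d12).1.
have bc : continuous bnd.
  by move=> s; apply: cvgM; [exact: cvg_cst|exact: continuous_log_kernel].
have ch0 : 0 <= Cc * h by rewrite mulr_ge0 ?(ltW h0).
have b0 s : 0 <= bnd s by apply: mulr_ge0 => //; exact: log_kernel_ge0.
have bI : (\int[mu]_(s in `[0%R, +oo[) (bnd s)%:E)%E = (Cc * h * (- ln d / (1 - d)))%:E.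
  rewrite EFinM -log_kernel_integral// -ge0_integralZl//.
  - apply: measurable_funTS; apply/measurable_EFinP; apply: continuous_measurable_fun.
    exact: continuous_log_kernel.
  - by move=> s _; rewrite lee_fin log_kernel_ge0.
have [ib Ib] := pos_integral bc b0 bI.
rewrite E; apply: (@le_trans _ _ (pi^-1 * (Cc * h * (- ln d / (1 - d))))).
  rewrite -Ib; apply: heat_bound => //.
  - by apply: measurable_funB; apply: measurable_funB; exact: measurable_phase.
  (* At frequency 0 the phase does not depend on the point, so a difference of phases vanishes
     there, as [heat_bound] requires. *)
  - have P0 p : phase f p 0 = \int[m2]_y (f y * cos 0).
      by apply: eq_Rintegral => y _; rewrite /dot /= !mulr0 addr0 mulr0.
    by rewrite /Psi !P0 !subrr.
  - have := (Rintegral_second_diff (imp p1) (imp p2) (imp p3) (imp x)).1.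
    by apply: eq_integrable => // k _; rewrite /Psi !mulrBr.
  - move=> s s0; have hp p := (heat_phase fi p s0).1.
    have := (Rintegral_second_diff (hp p1) (hp p2) (hp p3) (hp x)).1.
    by apply: eq_integrable => // k _; rewrite /Psi !mulrBr.
  - move=> s s0; have hp p := (heat_phase fi p s0).1.
    have hE p := (heat_phase fi p s0).2.
    have -> : \int[m2]_k (gs2 (pi * s ^+ 2) k * Psi k) =
      heat f s p1 - heat f s p2 - (heat f s p3 - heat f s x).
      rewrite -!hE (Rintegral_second_diff (hp p1) (hp p2) (hp p3) (hp x)).2.
      by apply: eq_Rintegral => k _; rewrite /Psi !mulrBr.
    exact: heat_second_diff.
have lnd : - ln d = ln Om by rewrite /d lnV ?opprK// posrE.
have ln0 : 0 <= ln Om by rewrite ln_ge0// (le_trans _ Om2)// ler1n.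
rewrite lnd.
(* The factor [pi] of [Cc] cancels, and [1 / (1 - d) <= 2] doubles 16 into 32. *)
have -> : pi^-1 * (Cc * h * (ln Om / (1 - d))) =
    16 * Kdiff ^+ 2 * (1 + B) * (ln Om * h) * (1 - d)^-1.
  rewrite /Cc; have p0 := @pi_gt0 R.
  have c0 : 1 - d != 0 by case/andP: d1 => _ ?; rewrite gt_eqF// subr_gt0.
  by move: (pi : R) p0 Kdiff (ln Om) => p p0 k l; field; rewrite c0 gt_eqF.
have i2 := (half_facts d12).2.
have -> : 32 * Kdiff ^+ 2 * (1 + B) * ln Om * h =
  16 * Kdiff ^+ 2 * (1 + B) * (ln Om * h) * 2 by ring.
have lh : 0 <= ln Om * h by rewrite mulr_ge0 ?(ltW h0).
rewrite ler_wpM2l//; apply: mulr_ge0 => //; apply: mulr_ge0 => //.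
by apply: mulr_ge0 => //; exact: sqr_ge0.
Qed.

End VelocityModulus.

Section VelocityDifference.
Context {R : realType}.
Notation mu := (@lebesgue_measure R).
Notation m2 := (sprod mu mu).

(** As the derivatives exist, quotients with [h > 0] suffice to compute them. Two functions and a
    constant [c] are allowed because [gradient_evolution] compares theta at two times with a
    candidate derivative, whereas the velocity bound takes [f = g] and [c = 0]. *)
Lemma derive_diff_le (V : normedModType R) (f g : V -> R) (x y v : V) (c M d : R) :
  0 < d -> derivable g x v -> derivable f y v ->
  (forall h, 0 < h <= d ->
    `|f (y + h *: v) - f y - (g (x + h *: v) - g x) - h * c| <= M * h) ->
  `|'D_v f y - 'D_v g x - c| <= M.
Proof.
move=> d0 dx dy fM.
have cv : `|h^-1 *: (f (h *: v + y) - f y) - h^-1 *: (g (h *: v + x) - g x) - c|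
    @[h --> 0^'+] --> `|'D_v f y - 'D_v g x - c|.
  have cr (k : V -> R) z : derivable k z v ->
      h^-1 *: (k (h *: v + z) - k z) @[h --> 0^'+] --> 'D_v k z.
    move=> dz; apply: cvg_trans; last exact: dz.
    by apply: cvg_app; apply: within_subset => h /= h0; rewrite gt_eqF.
  by apply: cvg_norm; apply: cvgB; [apply: cvgB; exact: cr|exact: cvg_cst].
rewrite -(cvg_lim _ cv)//; apply: limr_le; first by apply/cvg_ex; eexists; exact: cv.
near=> h.
have h0 : 0 < h by near: h; exact: nbhs_right_gt.
have hd : 0 < h <= d.
  by rewrite h0; near: h; apply: nbhs_right_le.
have cE : c = h^-1 *: (h * c) by rewrite -[RHS]/(h^-1 * (h * c)) mulKf// gt_eqF.
rewrite {1}cE -!scalerBr normrZ ger0_norm ?invr_ge0 ?(ltW h0)//.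
rewrite mulrC ler_pdivrMr// ![h *: v + _]addrC.
exact: fM.
Unshelve. all: by end_near. Qed.

(** Twice the constant of [stream_second_diff]: a displacement is made of one step along each
    axis. *)
Definition Kvel (B : R) : R := 64 * Kdiff ^+ 2 * (1 + B).

Lemma velocity_diff (th : R * R -> R) (B Om : R) (x w : R * R) :
  continuous th -> m2.-integrable setT (EFin \o th) ->
  (forall x, `|th x| <= B) ->
  (forall x h i, 0 <= h -> `|th (x + h *: ei i) - th x| <= Om * h) ->
  cintegrable (half_symbol th) ->
  (forall x, differentiable (stream_function th) x) ->
  expR 1 < Om -> `|w.1| <= 1 -> `|w.2| <= 1 ->
  `|(velocity th (x + w)).1 - (velocity th x).1| <= Kvel B * ln Om /\
  `|(velocity th (x + w)).2 - (velocity th x).2| <= Kvel B * ln Om.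
Proof.
move=> cth thi thB thL symb sd OmE w1 w2.
have Om0 : 0 < Om by apply: lt_trans OmE; exact: expR_gt0.
have d0 : 0 < Om^-1 by rewrite invr_gt0.
have step p a i j : `|a| <= 1 ->
    `|'D_(ei i) (stream_function th) (p + a *: ei j) - 'D_(ei i) (stream_function th) p|
    <= 32 * Kdiff ^+ 2 * (1 + B) * ln Om.
  move=> a1; rewrite -[X in `|X|]subr0; apply: (derive_diff_le d0); try exact: diff_derivable.
  by move=> h hd; rewrite mulr0 subr0; exact: (stream_second_diff cth thi thB thL symb OmE).
have xw : x + w = x + w.1 *: ei false + w.2 *: ei true.
  rewrite !scale_ei; case: x {step} => a b; case: (w) => c e /=.
  by congr (_, _) => /=; rewrite addr0.
have both i : `|'D_(ei i) (stream_function th) (x + w) - 'D_(ei i) (stream_function th) x|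
    <= Kvel B * ln Om.
  have s1 := step x w.1 i false w1; have s2 := step (x + w.1 *: ei false) w.2 i true w2.
  have -> : Kvel B * ln Om = 32 * Kdiff ^+ 2 * (1 + B) * ln Om + 32 * Kdiff ^+ 2 * (1 + B) * ln Om.
    by rewrite /Kvel; move: Kdiff (ln Om) => k l; ring.
  rewrite xw; apply: le_trans (lerD s2 s1); exact: ler_distD.
split; last exact: (both false).
by rewrite /velocity /gradperp /= -opprD normrN; exact: (both true).
Qed.

End VelocityDifference.

(** * Differential calculus in the plane and a backward Gronwall inequality *)

Section Calculus.
Context {R : realType}.

Lemma is_derive1_epsP (f : R -> R) (t df : R) :
  is_derive t 1 f df <-> (forall e, 0 < e -> exists2 d, 0 < d &
    forall h, `|h| < d -> `|f (t + h) - f t - h * df| <= e * `|h|).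
Proof.
split=> [h e e0|H].
  have [D <-] := h; have /cvgrPdist_le /(_ e e0) := D.
  rewrite /dnbhs near_withinE => /nbhs_ballP[d /= d0 hd]; exists d => // k kd.
  have [->|k0] := eqVneq k 0; first by rewrite addr0 subrr mul0r subrr normr0 mulr0.
  have := hd k; rewrite /ball /= sub0r normrN => /(_ kd k0).
  rewrite -/('D_1 f t) => H.
  have -> : f (t + k) - f t - k * 'D_1 f t =
    - (k * ('D_1 f t - k^-1 *: (f (k *: 1 + t) - f t))).
    rewrite mulrBr opprB /GRing.scale /= mulVKf//.
    by rewrite [k * 1]mulr1 [k + t]addrC.
  by rewrite normrN normrM mulrC ler_wpM2r.
have cv : h^-1 *: (f (h *: 1 + t) - f t) @[h --> 0^'] --> df.
  apply/cvgrPdist_le => e e0; have [d d0 hd] := H e e0.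
  rewrite /dnbhs near_withinE; apply/nbhs_ballP; exists d => //= k.
  rewrite /ball /= sub0r normrN => kd k0; have := hd k kd.
  have -> : df - k^-1 *: (f (k *: 1 + t) - f t) = - (k^-1 * (f (t + k) - f t - k * df)).
    rewrite mulrBr mulKf// opprB /GRing.scale /=.
    by rewrite [k * 1]mulr1 [k + t]addrC.
  rewrite normrN normrM normfV => h1.
  by rewrite mulrC ler_pdivrMr// normr_gt0.
split; first by apply/cvg_ex; exists df.
exact: cvg_lim.
Qed.

Lemma is_derive_fst (V : normedModType R) (g : V -> R * R) (x v : V) (dg : R * R) :
  is_derive x v g dg -> is_derive x v (fun y => (g y).1) dg.1.
Proof.
move=> [D <-].
have cv : h^-1 *: ((g (h *: v + x)).1 - (g x).1) @[h --> 0^'] --> ('D_v g x).1.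
  exact: (@cvg_comp _ _ _ (fun h : R => h^-1 *: (g (h *: v + x) - g x)) fst _ _ _ D (@cvg_fst _ _ _ _ _)).
by split; [apply/cvg_ex; eexists; exact: cv|exact: cvg_lim].
Qed.

Lemma is_derive_snd (V : normedModType R) (g : V -> R * R) (x v : V) (dg : R * R) :
  is_derive x v g dg -> is_derive x v (fun y => (g y).2) dg.2.
Proof.
move=> [D <-].
have cv : h^-1 *: ((g (h *: v + x)).2 - (g x).2) @[h --> 0^'] --> ('D_v g x).2.
  exact: (@cvg_comp _ _ _ (fun h : R => h^-1 *: (g (h *: v + x) - g x)) snd _ _ _ D (@cvg_snd _ _ _ _ _)).
by split; [apply/cvg_ex; eexists; exact: cv|exact: cvg_lim].
Qed.

Lemma norm_pairE (x : R * R) : `|x| = Num.max `|x.1| `|x.2|.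
Proof. by []. Qed.

Lemma norm_pair_le (x : R * R) (M : R) : (`|x| <= M) = (`|x.1| <= M) && (`|x.2| <= M).
Proof. by rewrite norm_pairE ge_max. Qed.

Lemma norm_pair_lt (x : R * R) (M : R) : (`|x| < M) = (`|x.1| < M) && (`|x.2| < M).
Proof. by rewrite norm_pairE gt_max. Qed.

Lemma derive_gradE (f : R * R -> R) (x v : R * R) : differentiable f x ->
  'D_v f x = v.1 * 'D_(e1 R) f x + v.2 * 'D_(e2 R) f x.
Proof.
move=> df; rewrite !deriveE//.
have vE : v = v.1 *: e1 R + v.2 *: e2 R.
  rewrite (scale_ei v.1 false) (scale_ei v.2 true); case: v => a b /=.
  by congr (_, _); rewrite /= ?addr0 ?add0r.
by rewrite {1}vE linearD !linearZ.
Qed.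

Lemma is_derive_chain (f : R * R -> R) (c : R -> R * R) (t : R) (v : R * R) :
  differentiable f (c t) -> is_derive t 1 c v ->
  is_derive t 1 (f \o c) (v.1 * 'D_(e1 R) f (c t) + v.2 * 'D_(e2 R) f (c t)).
Proof.
move=> df [dc <-]; rewrite -derive_gradE//.
have dc' : differentiable c t by apply/derivable1_diffP.
have dfc : differentiable (f \o c) t by exact: differentiable_comp.
split; first exact: diff_derivable.
by rewrite !deriveE// diff_comp.
Qed.

Lemma is_derive_line (x v : R * R) (s : R) : is_derive s 1 (fun s => x + s *: v) v.
Proof.
have h : is_derive s 1 (fun s : R => s *: v) v.
  have dl : differentiable (fun s : R => s *: v) s by exact: differentiableZl.
  split; first exact: diff_derivable.
  apply: cvg_lim => //.
  apply: cvg_near_cst; rewrite /dnbhs near_withinE; near=> h => h0.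
  by rewrite /= -scalerBl addrK scalerA -[h *: 1]/(h * 1) mulr1 mulVf// scale1r.
by apply: is_derive_eq; rewrite add0r.
Unshelve. all: by end_near. Qed.

Lemma mvt_plane (f : R * R -> R) (x y : R * R) : (forall z, differentiable f z) ->
  exists2 c, 0 <= c <= 1 & f y - f x =
    (y - x).1 * 'D_(e1 R) f (x + c *: (y - x)) + (y - x).2 * 'D_(e2 R) f (x + c *: (y - x)).
Proof.
move=> df; have dl s := is_derive_chain (df (x + s *: (y - x))) (is_derive_line x (y - x) s).
have E1 : x + 1 *: (y - x) = y by rewrite scale1r addrC subrK.
have E0 : x + 0 *: (y - x) = x by rewrite scale0r addr0.
have [|c + E] := MVT_segment ler01 (fun s _ => dl s).
  by apply: continuous_subspaceT => s; exact: is_derive1_continuous (dl s).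
rewrite in_itv /= => c01; exists c => //.
by move: E; rewrite /= E1 E0 subr0 mulr1.
Qed.

Lemma mvt_dist (x y : R * R) (c : R) : 0 <= c <= 1 -> `|x + c *: (y - x) - x| <= `|y - x|.
Proof.
move=> /andP[c0 c1]; rewrite addrC addrA addNr add0r normrZ ger0_norm//.
by rewrite ler_piMl.
Qed.

(* Backward Gronwall inequality under a bootstrap assumption: the differential
   inequality is only required where [phi < M]. *)
Lemma gronwall_trap (phi dphi : R -> R) (t0 t1 K e M : R) : t0 <= t1 ->
  0 <= K -> 0 <= e ->
  (forall t, t0 <= t <= t1 -> is_derive t 1 phi (dphi t)) ->
  (forall t, t0 <= t <= t1 -> phi t < M -> - dphi t <= K * phi t + e) ->
  0 <= phi t1 ->
  (phi t1 + e * (t1 - t0)) * expR (K * (t1 - t0)) < M ->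
  forall t, t0 <= t <= t1 ->
    phi t <= (phi t1 + e * (t1 - t0)) * expR (K * (t1 - t0)).
Proof.
move=> t01 K0 e0 dphiE ineq phi10 small.
have mono b : t0 <= b <= t1 -> (forall t, b < t <= t1 -> phi t < M) ->
    phi b <= (phi t1 + e * (t1 - t0)) * expR (K * (t1 - t0)).
  move=> /andP[tb bt] lM.
  pose E (t : R) := expR (K * t).
  have dE (t : R) : is_derive t 1 E (K * E t).
    have d1 : is_derive t 1 (fun t : R => K * t) K.
      by apply: is_derive_eq; rewrite /GRing.scale /=; ring.
    have h := @is_derive1_comp R expR _ t _ _ (is_derive_expR _) d1.
    by apply: is_derive_eq; rewrite mulrC.
  (* An integrating factor equal to 1 at [t1]. It is at most 1 before, so the forcing term costs no
     more than [e * t] and [G] is nondecreasing wherever [phi < M]. *)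
  pose G t := phi t * E (t - t1) + e * t.
  have dG (t : R) : t0 <= t <= t1 -> is_derive t 1 G ((dphi t + K * phi t) * E (t - t1) + e).
    move=> tt; have h1 := dphiE t tt; have h2 := is_derive_shift (dE (t - t1)).
    by rewrite /G; apply: is_derive_eq; rewrite /GRing.scale /=; ring.
  have E0 t : 0 < E t by exact: expR_gt0.
  have GG : G b <= G t1.
    apply: (@ger0_derive1_le_cc _ G b t1) => //.
    - move=> t; rewrite in_itv /= => /andP[bt' tt1].
      have tt : t0 <= t <= t1 by rewrite (le_trans tb) ?ltW.
      by have [] := dG t tt.
    - move=> t; rewrite in_itv /= => /andP[bt' tt1].
      have tt : t0 <= t <= t1 by rewrite (le_trans tb) ?ltW.
      rewrite derive1E; have h := dG t tt; rewrite derive_val.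
      have lt : phi t < M by apply: lM; rewrite bt' ltW.
      have h1 := ineq t tt lt; have h2 := E0 (t - t1).
      have h3 : E (t - t1) <= 1.
        rewrite /E -expR0 ler_expR; have : 0 <= K * (t1 - t) by rewrite mulr_ge0// subr_ge0 ltW.
        by lra.
      by move: (E _) h2 h3 => z z0 z1; nra.
    - apply: derivable_within_continuous => t; rewrite in_itv /= => /andP[bt' tt1].
      have tt : t0 <= t <= t1 by rewrite (le_trans tb).
      by have [] := dG t tt.
    - by rewrite in_itv /= lexx.
    - by rewrite in_itv /= lexx andbT.
  move: GG; rewrite /G subrr /E mulr0 expR0 mulr1 => GG.
  have et : e * t0 <= e * b by rewrite ler_wpM2l.
  have h1 : phi b * expR (K * (b - t1)) <= phi t1 + e * (t1 - t0).
    by lra.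
  have h2 : expR (K * (b - t1)) * expR (K * (t1 - b)) = 1.
    by rewrite -expRD -[RHS]expR0; congr expR; ring.
  rewrite -[phi b]mulr1 -h2 mulrA.
  apply: (@le_trans _ _ ((phi t1 + e * (t1 - t0)) * expR (K * (t1 - b)))).
    by rewrite ler_wpM2r// expR_ge0.
  apply: ler_wpM2l; first by rewrite addr_ge0// mulr_ge0// subr_ge0.
  by rewrite ler_expR ler_wpM2l// lerD2l lerN2.
have [[b0 /andP[b0t0 b0t1] Mb0]|none] := pselect (exists2 b, t0 <= b <= t1 & M <= phi b).
  (* At the last time where [M] is reached the estimate already applies, since [phi < M] afterwards.
     It gives [phi < M] at that time, hence nearby by continuity, against the definition of the
     supremum. *)
  pose A := [set t | t0 <= t <= t1 /\ M <= phi t].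
  have Ab0 : A b0 by split; [rewrite b0t0|].
  have sA : has_sup A by split; [exists b0|exists t1 => t [/andP[]]].
  have b0s : b0 <= sup A by apply: sup_upper_bound.
  have st1 : sup A <= t1 by apply: ge_sup; [exists b0|move=> t [/andP[]]].
  have tt : t0 <= sup A <= t1 by rewrite st1 (le_trans b0t0).
  have lM t : sup A < t <= t1 -> phi t < M.
    move=> /andP[st tt1]; rewrite ltNge; apply/negP => Mt.
    have : t <= sup A.
      apply: sup_upper_bound => //; split => //.
      by rewrite tt1 (le_trans _ (ltW st))//; case/andP: tt.
    by rewrite leNgt st.
  have Ps := mono _ tt lM.
  have cphi : {for sup A, continuous phi} by exact: is_derive1_continuous (dphiE _ tt).
  have ltM : phi (sup A) < M by rewrite (le_lt_trans Ps).
  have /cphi : nbhs (phi (sup A)) [set y | y < M] by exact: lt_nbhsl.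
  move=> /nbhs_ballP[d /= d0 hd].
  have [a Aa da] := sup_adherent d0 sA.
  have : phi a < M.
    apply: hd; rewrite /ball /=; have as_ : a <= sup A by exact: sup_upper_bound.
    by rewrite ger0_norm ?subr_ge0// ltrBlDr -ltrBlDl.
  by case: Aa => _; rewrite leNgt => /negP.
move=> t tt; apply: mono => // t' /andP[tt' t't1]; rewrite ltNge; apply/negP => Mt.
apply: none; exists t' => //; rewrite t't1 andbT (le_trans _ (ltW tt'))//.
by case/andP: tt.
Qed.

End Calculus.

(** * Transport along trajectories *)

Section Spacetime.
Context {R : realType}.
Variable Tstar : \bar R.

(** Unlike [lifespan] this excludes [t = 0]: the equation holds at positive times only, and
    two-sided time derivatives need room on both sides. *)
Definition live (t : R) : Prop := 0 < t /\ (t%:E < Tstar)%E.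

Lemma live_lifespan t : live t -> lifespan Tstar t.
Proof. by move=> [t0 tT]; split => //; exact: ltW. Qed.

Lemma lifespan_gt t : lifespan Tstar t -> exists2 b, t < b & live b.
Proof.
rewrite /live => -[t0 tT]; case: Tstar tT => [r| |] //.
  rewrite lte_fin => tr; exists ((t + r) / 2); first by lra.
  by split; rewrite ?lte_fin; lra.
by move=> _; exists (t + 1); [lra|split; [lra|exact: ltry]].
Qed.

Lemma live_le s t : 0 < s -> s <= t -> live t -> live s.
Proof. by move=> s0 st [_ tT]; split => //; apply: le_lt_trans tT; rewrite lee_fin. Qed.

Lemma live_near t : live t -> exists2 d, 0 < d & forall s, `|s - t| < d -> live s.
Proof.
move=> lt; have [b tb lb] := lifespan_gt (live_lifespan lt).
have [t0 _] := lt; exists (Num.min t (b - t)); first by rewrite lt_min t0 subr_gt0.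
move=> s; rewrite lt_min !ltr_norml => /andP[/andP[h1 h2] /andP[h3 h4]].
by apply: (live_le _ _ lb); lra.
Qed.

Lemma spacetime_eps (f : R -> R * R -> R) t x e :
  continuous_spacetime Tstar f -> live t -> 0 < e ->
  exists2 d, 0 < d & forall t' x', `|t' - t| < d -> `|x' - x| < d ->
    live t' /\ `|f t' x' - f t x| < e.
Proof.
move=> cf lt e0; have [d0 d00 hd0] := live_near lt.
have /subspace_continuousP /(_ (t, x) (live_lifespan lt)) := cf.
move=> /cvgrPdist_lt /(_ e e0).
rewrite /within /prop_near1 /= => /nbhs_ballP[d /= dp hd].
exists (Num.min d d0); first by rewrite lt_min dp.
move=> t' x'; rewrite lt_min => /andP[h1 h2]; rewrite lt_min => /andP[h3 h4].
have lt' := hd0 _ h2; split => //; rewrite distrC.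
apply: (hd (t', x')); last exact: live_lifespan.
by split; rewrite /= -ball_normE /ball_ /= distrC.
Qed.

Lemma differentiable_fst (x : R * R) : differentiable (@fst R R) x.
Proof. by apply: linear_differentiable => y; exact: cvg_fst. Qed.

Lemma differentiable_snd (x : R * R) : differentiable (@snd R R) x.
Proof. by apply: linear_differentiable => y; exact: cvg_snd. Qed.

Lemma C1_fst (v : R -> R * R -> R * R) :
  C1_in_space Tstar v -> C1_in_space Tstar (fun t x => (v t x).1).
Proof.
move=> [dv cv c1 c2].
have cfst (g : R -> R * R -> R * R) : continuous_spacetime Tstar g ->
    continuous_spacetime Tstar (fun t x => (g t x).1).
  move=> /subspace_continuousP cg; apply/subspace_continuousP => p lp.
  exact: (@cvg_comp _ _ _ _ fst _ _ _ (cg p lp) (@cvg_fst _ _ _ _ _)).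
have D t x e : lifespan Tstar t -> 'D_e (fun y => (v t y).1) x = ('D_e (v t) x).1.
  move=> lt; have h : is_derive x e (v t) ('D_e (v t) x).
    by apply: derivableP; apply: diff_derivable; exact: dv.
  by have h' := is_derive_fst h; rewrite derive_val.
split.
- move=> t x lt; apply: (@differentiable_comp _ _ _ _ (v t) fst); first exact: dv.
  exact: differentiable_fst.
- exact: cfst.
- apply: (subspace_eq_continuous _ (cfst _ c1)) => p; rewrite inE => lp.
  by symmetry; exact: D.
- apply: (subspace_eq_continuous _ (cfst _ c2)) => p; rewrite inE => lp.
  by symmetry; exact: D.
Qed.

Lemma C1_snd (v : R -> R * R -> R * R) :
  C1_in_space Tstar v -> C1_in_space Tstar (fun t x => (v t x).2).
Proof.
move=> [dv cv c1 c2].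
have csnd (g : R -> R * R -> R * R) : continuous_spacetime Tstar g ->
    continuous_spacetime Tstar (fun t x => (g t x).2).
  move=> /subspace_continuousP cg; apply/subspace_continuousP => p lp.
  exact: (@cvg_comp _ _ _ _ snd _ _ _ (cg p lp) (@cvg_snd _ _ _ _ _)).
have D t x e : lifespan Tstar t -> 'D_e (fun y => (v t y).2) x = ('D_e (v t) x).2.
  move=> lt; have h : is_derive x e (v t) ('D_e (v t) x).
    by apply: derivableP; apply: diff_derivable; exact: dv.
  by have h' := is_derive_snd h; rewrite derive_val.
split.
- move=> t x lt; apply: (@differentiable_comp _ _ _ _ (v t) snd); first exact: dv.
  exact: differentiable_snd.
- exact: csnd.
- apply: (subspace_eq_continuous _ (csnd _ c1)) => p; rewrite inE => lp.
  by symmetry; exact: D.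
- apply: (subspace_eq_continuous _ (csnd _ c2)) => p; rewrite inE => lp.
  by symmetry; exact: D.
Qed.

Lemma second_diff_mvt (f : R * R -> R) (x v w : R * R) (h : R) :
  (forall z, differentiable f z) -> (forall z, differentiable ('D_v f) z) -> 0 < h ->
  exists a b, [/\ `|a| <= h, `|b| <= h &
    f (x + h *: v + h *: w) - f (x + h *: v) - (f (x + h *: w) - f x) =
    h * h * 'D_w ('D_v f) (x + a *: v + b *: w)].
Proof.
move=> df dDf h0.
have dline (g : R * R -> R) (z e : R * R) (s : R) : (forall y, differentiable g y) ->
    is_derive s 1 (fun s => g (z + s *: e)) ('D_e g (z + s *: e)).
  by move=> dg; rewrite derive_gradE//; exact: (is_derive_chain (dg _) (is_derive_line z e s)).
pose phi s := f (x + h *: w + s *: v) - f (x + s *: v).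
have dphi (s : R) : is_derive s 1 phi ('D_v f (x + h *: w + s *: v) - 'D_v f (x + s *: v)).
  have h1 := dline f (x + h *: w) v s df; have h2 := dline f x v s df.
  by rewrite /phi; apply: is_derive_eq.
have [a ah E] := mvt_everywhere 0 h dphi.
have [b bh E'] := mvt_everywhere 0 h (fun s => dline ('D_v f) (x + a *: v) w s dDf).
rewrite !subr0 (gtr0_norm h0) in ah bh.
exists a, b; split => //.
transitivity (phi h - phi 0).
  rewrite /phi !scale0r !addr0 [x + h *: w + _]addrAC.
  by move: (f _) (f _) (f _) (f _) => p q r s; ring.
rewrite E subr0 [x + h *: w + _]addrAC.
move: E'; rewrite scale0r addr0 subr0 => ->.
by ring.
Qed.

Lemma sum_close_opp (p q r s e : R) :
  `|p - r| <= e / 2 -> `|q - s| <= e / 2 -> r + s = 0 -> `|p + q| <= e.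
Proof.
move=> h1 h2 rs; have -> : p + q = (p - r) + (q - s).
  by move/eqP: rs; rewrite addr_eq0 => /eqP ->; ring.
by rewrite (le_trans (ler_normD _ _))//; lra.
Qed.

(** This is the equality of mixed derivatives: the same second difference, expanded by
    [second_diff_mvt] in the two orders, equals [h * h] times either mixed derivative at some nearby
    point, and both are continuous at [x]. *)
Lemma divergence_gradperp (f : R * R -> R) (x : R * R) :
  (forall z, differentiable f z) -> (forall z, differentiable (gradperp f) z) ->
  {for x, continuous ('D_(e1 R) (gradperp f))} ->
  {for x, continuous ('D_(e2 R) (gradperp f))} ->
  divergence (gradperp f) x = 0.
Proof.
move=> df dg c1 c2.
have dgP z e : is_derive z e (gradperp f) ('D_e (gradperp f) z).
  by apply: derivableP; exact: diff_derivable.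
have D1 z : 'D_(e1 R) (fun y => (gradperp f y).1) z = ('D_(e1 R) (gradperp f) z).1.
  by have h' := is_derive_fst (dgP z (e1 R)); rewrite derive_val.
have D2 z : 'D_(e2 R) (fun y => (gradperp f y).2) z = ('D_(e2 R) (gradperp f) z).2.
  by have h' := is_derive_snd (dgP z (e2 R)); rewrite derive_val.
have dD1 z : differentiable ('D_(e1 R) f) z.
  exact: (@differentiable_comp _ _ _ _ (gradperp f) snd _ (dg z) (differentiable_snd _)).
have dD2' z : differentiable (fun y => (gradperp f y).1) z.
  exact: (@differentiable_comp _ _ _ _ (gradperp f) fst _ (dg z) (differentiable_fst _)).
have D2E : 'D_(e2 R) f = \- (fun y => (gradperp f y).1).
  by apply/funext => z; rewrite /= opprK.
have dD2 z : differentiable ('D_(e2 R) f) z by rewrite D2E; exact: differentiableN.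
have DD z : 'D_(e1 R) ('D_(e2 R) f) z = - ('D_(e1 R) (gradperp f) z).1.
  by rewrite D2E deriveN ?D1//; exact: diff_derivable.
rewrite /divergence D1 D2.
set S := _ + _; apply/eqP; rewrite -normr_le0; apply/ler_addgt0Pr => e e0; rewrite add0r.
have e20 : 0 < e / 2 by rewrite divr_gt0.
have /cvgrPdist_le /(_ _ e20) /nbhs_ballP[d1 /= d10 h1] := c1.
have /cvgrPdist_le /(_ _ e20) /nbhs_ballP[d2 /= d20 h2] := c2.
pose h := Num.min d1 d2 / 4.
have m0 : 0 < Num.min d1 d2 by rewrite lt_min d10.
have h0 : 0 < h by rewrite divr_gt0.
have h2m : h + h < Num.min d1 d2.
  by rewrite /h; move: (Num.min d1 d2) m0 => m m0; lra.
have [a [b [ah bh E]]] := @second_diff_mvt f x (e1 R) (e2 R) h df dD1 h0.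
have [a' [b' [ah' bh' E']]] := @second_diff_mvt f x (e2 R) (e1 R) h df dD2 h0.
have ballx (k l : R) (v w : R * R) : `|k| <= h -> `|l| <= h -> `|v| <= 1 -> `|w| <= 1 ->
    forall d, Num.min d1 d2 <= d -> ball x d (x + k *: v + l *: w).
  move=> ah'' bh'' v1 w1 d dd; rewrite -ball_normE /ball_ /=.
  rewrite -addrA opprD addrA subrr add0r normrN (le_lt_trans (ler_normD _ _))//.
  rewrite !normrZ; apply: (@le_lt_trans _ _ (h * 1 + h * 1)).
    by apply: lerD; apply: ler_pM.
  by rewrite !mulr1 (lt_le_trans h2m dd).
have n1 : `|e1 R| <= 1 by rewrite norm_pair_le /= normr1 normr0 lexx ler01.
have n2 : `|e2 R| <= 1 by rewrite norm_pair_le /= normr1 normr0 lexx ler01.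
have g1 := h1 _ (ballx _ _ _ _ ah' bh' n2 n1 d1 _); rewrite ge_min lexx in g1.
have g2 := h2 _ (ballx _ _ _ _ ah bh n1 n2 d2 _); rewrite ge_min lexx orbT in g2.
have k1 := g1 isT; have k2 := g2 isT.
rewrite norm_pair_le in k1; rewrite norm_pair_le in k2.
case/andP: k1 => k1 _; case/andP: k2 => _ k2.
have EE : ('D_(e1 R) (gradperp f) (x + a' *: e2 R + b' *: e1 R)).1 +
    ('D_(e2 R) (gradperp f) (x + a *: e1 R + b *: e2 R)).2 = 0.
  rewrite -D2; apply: (@mulfI _ (h * h)); first by rewrite mulf_neq0 ?gt_eqF.
  rewrite mulr0 mulrDr -[X in _ + X]E -[X in h * h * X]opprK -DD mulrN -E'.
  rewrite [x + h *: e2 R + h *: e1 R]addrAC.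
  by move: (f _) (f _) (f _) (f _) => p q r s; ring.
exact: (sum_close_opp k1 k2 EE).
Qed.

End Spacetime.

Section Dynamics.
Context {R : realType}.
Variables (Tstar : \bar R) (th : R -> R * R -> R).
Hypothesis sol : classical_solution Tstar th.
Notation u t := (velocity (th t)).
Notation W t := (gradperp (th t)).
Notation D1 f := ('D_(e1 R) f).
Notation D2 f := ('D_(e2 R) f).

Lemma theta_differentiable t x : live Tstar t -> differentiable (th t) x.
Proof. by move=> lt; have [d _ _ _] := theta_C1 sol; apply: d; exact: live_lifespan. Qed.

Lemma is_derive_theta_time t x : live Tstar t ->
  is_derive t 1 (fun s => th s x) (- dot (u t x) (grad (th t) x)).
Proof.
move=> lt; have [t0 _] := lt; have ll := live_lifespan lt.
have h := @transport _ _ _ sol t x t0 ll; have d := @theta_derivable_time _ _ _ sol t x t0 ll.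
split; first exact: d.
by rewrite -derive1E; apply/eqP; rewrite -subr_eq0 opprK; apply/eqP.
Qed.

Lemma mul_diff_le (a b x y eta A : R) : 0 <= eta -> `|x - y| <= eta -> `|b - a| <= eta * A ->
  `|b * x - a * y| <= eta * (A * (`|y| + eta) + `|a|).
Proof.
move=> e0 hx hb; have -> : b * x - a * y = (b - a) * x + a * (x - y) by ring.
rewrite (le_trans (ler_normD _ _))// !normrM mulrDr lerD//.
  rewrite mulrA ler_pM//.
  by rewrite -[x](subrK y) addrC (le_trans (ler_normD _ _))// lerD2l.
by rewrite mulrC ler_wpM2r.
Qed.

Lemma transport_split (A B q1 q2 P h v1 v2 u1 u2 a1 a2 : R) :
  A * q1 + B * q2 + P - h * ((v1 - u1) * a1 + (v2 - u2) * a2) =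
  (A * q1 - h * v1 * a1) + (B * q2 - h * v2 * a2) + (P - h * - (u1 * a1 + u2 * a2)).
Proof. by ring. Qed.

Let error_identity (e h p q r s : R) :
  e * (h * (p + e) + h * r) + e * (h * (q + e) + h * s) + e * h =
  e * (p + q + r + s + (e + e + 1)) * h.
Proof. by ring. Qed.

(** Joint differentiability of theta in space and time is not among the assumptions. The increment
    is split into a time step at the fixed point [x = c t] and a space step at the fixed time
    [t + h]; the latter is handled by the mean value theorem and the joint continuity of the
    gradient. *)
Lemma transport_chain (c : R -> R * R) (t : R) (v : R * R) : live Tstar t ->
  is_derive t 1 c v ->
  is_derive t 1 (fun s => th s (c s)) (dot (v - u t (c t)) (grad (th t) (c t))).
Proof.
move=> lt dc; have [_ _ cD1 cD2] := theta_C1 sol.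
set x := c t; pose a1 := D1 (th t) x; pose a2 := D2 (th t) x.
have /is_derive1_epsP dc1 := is_derive_fst dc.
have /is_derive1_epsP dc2 := is_derive_snd dc.
have /is_derive1_epsP dt := is_derive_theta_time x lt.
apply/is_derive1_epsP => e e0.
pose C := `|a1| + `|a2| + `|v.1| + `|v.2| + 3.
have C0 : 0 < C by rewrite /C ltr_wpDl// !addr_ge0.
pose eta := Num.min 1 (e / C).
have eta0 : 0 < eta by rewrite lt_min ltr01 divr_gt0.
have eta1 : eta <= 1 by rewrite ge_min lexx.
have etaC : eta * C <= e by rewrite -ler_pdivlMr// ge_min lexx orbT.
clearbody eta.
have eta3 : eta + eta + 1 <= 3 by lra.
have [d1 d10 h1] := dc1 _ eta0; have [d2 d20 h2] := dc2 _ eta0.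
have [d3 d30 h3] := dt _ eta0.
have [d4 d40 h4] := spacetime_eps x cD1 lt eta0.
have [d5 d50 h5] := spacetime_eps x cD2 lt eta0.
have cc : {for t, continuous c}.
  by apply: differentiable_continuous; apply/derivable1_diffP; have [] := dc.
have d45 : 0 < Num.min d4 d5 by rewrite lt_min d40.
have /cvgrPdist_lt /(_ _ d45) /nbhs_ballP[d6 /= d60 h6] := cc.
exists (Num.min (Num.min d1 d2) (Num.min d3 (Num.min (Num.min d4 d5) d6))).
  by rewrite !lt_min d10 d20 d30 d40 d50.
move=> h; rewrite !lt_min => /andP[/andP[hd1 hd2] /andP[hd3 /andP[/andP[hd4 hd5] hd6]]].
have eh : t + h - t = h by rewrite addrC addKr.
have cx : `|c (t + h) - x| < Num.min d4 d5.
  by rewrite distrC; apply: h6; rewrite /ball /= distrC eh.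
have lth : live Tstar (t + h).
  by have [] := h4 (t + h) x; rewrite ?eh// subrr normr0.
have [k k01 E] := mvt_plane x (c (t + h)) (fun z => theta_differentiable z lth).
set z := x + _ in E.
have zx : `|z - x| < Num.min d4 d5 by rewrite (le_lt_trans (mvt_dist _ _ k01)).
rewrite lt_min in zx; case/andP: zx => zx4 zx5.
have eh' d : `|h| < d -> `|t + h - t| < d by rewrite eh.
have [_ /ltW q1] := h4 _ _ (eh' _ hd4) zx4.
have [_ /ltW q2] := h5 _ _ (eh' _ hd5) zx5.
have r1 := h1 h hd1; have r2 := h2 h hd2; have r3 := h3 h hd3.
have m1 : `|(c (t + h) - x).1 * D1 (th (t + h)) z - h * v.1 * a1| <=
    eta * (`|h| * (`|a1| + eta) + `|h * v.1|).
  by apply: mul_diff_le (ltW eta0) q1 _.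
have m2 : `|(c (t + h) - x).2 * D2 (th (t + h)) z - h * v.2 * a2| <=
    eta * (`|h| * (`|a2| + eta) + `|h * v.2|).
  by apply: mul_diff_le (ltW eta0) q2 _.
have -> : th (t + h) (c (t + h)) - th t (c t) - h * dot (v - u t x) (grad (th t) x) =
  ((c (t + h) - x).1 * D1 (th (t + h)) z - h * v.1 * a1) +
  ((c (t + h) - x).2 * D2 (th (t + h)) z - h * v.2 * a2) +
  (th (t + h) x - th t x - h * (- dot (u t x) (grad (th t) x))).
  have -> : th (t + h) (c (t + h)) - th t (c t) =
    (th (t + h) (c (t + h)) - th (t + h) x) + (th (t + h) x - th t x).
    by rewrite addrA subrK.
  by rewrite E; exact: transport_split.
rewrite (le_trans (ler_normD _ _))//.
apply: (@le_trans _ _ (eta * (`|h| * (`|a1| + eta) + `|h * v.1|) +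
    eta * (`|h| * (`|a2| + eta) + `|h * v.2|) + eta * `|h|)).
  by rewrite lerD// (le_trans (ler_normD _ _))// lerD.
apply: (@le_trans _ _ (eta * C * `|h|)); last by rewrite ler_wpM2r.
rewrite !normrM error_identity.
by rewrite ler_wpM2r// ler_wpM2l ?(ltW eta0)// /C lerD2l.
Qed.

Variable X : R * R -> R -> R -> R * R.
Hypothesis traj : trajectories Tstar th X.

Lemma is_derive_traj a tau t : lifespan Tstar tau -> live Tstar t ->
  is_derive t 1 (X a tau) (u t (X a tau t)).
Proof.
move=> ltau lt; have [_ _ h] := traj a ltau.
by have [t0 _] := lt; apply: h => //; exact: live_lifespan.
Qed.

Lemma theta_conserved a tau t0 t1 : lifespan Tstar tau -> live Tstar t0 -> t0 <= t1 ->
  live Tstar t1 -> th t1 (X a tau t1) = th t0 (X a tau t0).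
Proof.
move=> ltau l0 t01 l1.
have D t : t0 <= t <= t1 -> is_derive t 1 (fun s => th s (X a tau s)) 0.
  move=> /andP[t0t tt1]; have lt : live Tstar t.
    by apply: live_le tt1 l1; apply: lt_le_trans t0t; case: l0.
  have h := transport_chain lt (is_derive_traj a ltau lt).
  by move: h; rewrite subrr /dot /= !mul0r addr0.
have [||c _] := @MVT_segment R (fun s => th s (X a tau s)) (fun=> 0) t0 t1 t01.
- move=> t; rewrite in_itv /= => /andP[h1 h2]; apply: D.
  by rewrite !ltW.
- apply: derivable_within_continuous => t; rewrite in_itv /= => tt.
  by have [] := D t tt.
by rewrite mul0r => /eqP; rewrite subr_eq0 => /eqP.
Qed.

End Dynamics.

Section FrozenGradient.
Context {R : realType}.
Variables (Tstar : \bar R) (th : R -> R * R -> R).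
Hypothesis sol : classical_solution Tstar th.
Notation u t := (velocity (th t)).
Notation W t := (gradperp (th t)).
Notation D1 f := ('D_(e1 R) f).
Notation D2 f := ('D_(e2 R) f).

Lemma C1_derive (f : R -> R * R -> R) i : C1_in_space Tstar f ->
  continuous_spacetime Tstar (fun t => 'D_(ei i) (f t)).
Proof. by case=> _ _ c1 c2; case: i; [exact: c2|exact: c1]. Qed.

Lemma spacetime_slice (V : topologicalType) (f : R -> R * R -> V) t x :
  continuous_spacetime Tstar f -> lifespan Tstar t -> {for x, continuous (f t)}.
Proof.
move=> /subspace_continuousP /(_ (t, x)) cf lt P hP.
have c : (fun y => (t, y)) y @[y --> x] --> (t, x).
  by apply: (@cvg_pair _ _ _ (nbhs x) (nbhs t) (nbhs x)); [exact: cvg_cst|exact: cvg_id].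
by apply: (@filterS _ (nbhs x) _ _ _ _ (c _ (cf lt P hP))) => y h; exact: (h lt).
Qed.

Lemma divergence_velocity t x : lifespan Tstar t -> divergence (u t) x = 0.
Proof.
move=> lt; have [dv _ c1 c2] := velocity_C1 sol.
apply: divergence_gradperp.
- by move=> z; exact: (@stream_differentiable _ _ _ sol t z lt).
- by move=> z; exact: dv.
- exact: (@spacetime_slice _ _ t x c1 lt).
- exact: (@spacetime_slice _ _ t x c2 lt).
Qed.

Lemma divergence_gradperp_theta t x : lifespan Tstar t -> divergence (W t) x = 0.
Proof.
move=> lt; have [dv _ c1 c2] := gradperp_theta_C1 sol.
have [d _ _ _] := theta_C1 sol.
apply: divergence_gradperp.
- by move=> z; exact: d.
- by move=> z; exact: dv.
- exact: (@spacetime_slice _ _ t x c1 lt).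
- exact: (@spacetime_slice _ _ t x c2 lt).
Qed.

Lemma mvt_direction (f : R * R -> R) (x e : R * R) (h : R) :
  (forall z, differentiable f z) -> 0 < h ->
  exists2 c, `|c| <= h & f (x + h *: e) - f x = h * 'D_e f (x + c *: e).
Proof.
move=> df h0; have dl (s : R) : is_derive s 1 (fun s => f (x + s *: e)) ('D_e f (x + s *: e)).
  by rewrite derive_gradE//; exact: (is_derive_chain (df _) (is_derive_line x e s)).
have [c ch E] := mvt_everywhere 0 h dl.
rewrite !subr0 (gtr0_norm h0) in ch; exists c => //.
by move: E; rewrite scale0r addr0 subr0 mulrC.
Qed.

Lemma norm_ei i : `|ei i| = 1 :> R.
Proof. by case: i; rewrite norm_pairE /= normr1 normr0; [rewrite max_r|rewrite max_l]. Qed.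

Variable X : R * R -> R -> R -> R * R.
Hypothesis traj : trajectories Tstar th X.

Lemma near_between (z t k : R) : t <= z <= t + k \/ t + k <= z <= t -> `|z - t| <= `|k|.
Proof.
have n1 := ler_norm k; have n2 := ler_norm (- k); rewrite normrN in n2.
by case=> /andP[h1 h2]; rewrite ler_norml; apply/andP; split; lra.
Qed.

Lemma frozen_bound (g1 g2 h1 h2 G1 G2 H1 H2 eta e h k q : R) :
  0 < eta -> eta + eta <= 2 -> eta * (`|G1| + `|G2| + `|H1| + `|H2| + 2) <= e -> 0 <= h ->
  `|g1 * h1 - G1 * H1| <= eta * (1 * (`|H1| + eta) + `|G1|) ->
  `|g2 * h2 - G2 * H2| <= eta * (1 * (`|H2| + eta) + `|G2|) ->
  q = (0 - h * g1) * h1 + (0 - h * g2) * h2 ->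
  `|q * k - h * (k * - (G1 * H1 + G2 * H2))| <= e * `|k| * h.
Proof.
move=> eta0 eta2 etaC h0 m1 m2 ->.
have -> : ((0 - h * g1) * h1 + (0 - h * g2) * h2) * k - h * (k * - (G1 * H1 + G2 * H2)) =
    - (k * h * ((g1 * h1 - G1 * H1) + (g2 * h2 - G2 * H2))) by ring.
rewrite normrN !normrM (ger0_norm h0) mulrC mulrA ler_wpM2r// ler_wpM2r//.
apply: le_trans etaC; rewrite (le_trans (ler_normD _ _))// (le_trans (lerD m1 m2))//.
by rewrite -mulrDr ler_wpM2l ?(ltW eta0)//; lra.
Qed.

(** The time derivative of the gradient is not given, but that of theta is. The difference of theta
    between a trajectory and its translate by [h *: ei i] is differentiated in time; the mean value
    theorem in time, then in space, leaves an error uniform in [h], so that [h] can be sent to 0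
    before the time increment. *)
Lemma gradient_evolution a tau t i : lifespan Tstar tau -> live Tstar t ->
  let x := X a tau t in
  is_derive t 1 (fun s => 'D_(ei i) (th s) (X a tau s))
    (- ('D_(ei i) (fun y => (u t y).1) x * D1 (th t) x +
        'D_(ei i) (fun y => (u t y).2) x * D2 (th t) x)).
Proof.
move=> ltau lt x; have [_ _ cH1 cH2] := theta_C1 sol.
have u1C := C1_fst (velocity_C1 sol); have u2C := C1_snd (velocity_C1 sol).
have cG1 := @C1_derive _ i u1C; have cG2 := @C1_derive _ i u2C.
set G1 := 'D_(ei i) (fun y => (u t y).1) x; set G2 := 'D_(ei i) (fun y => (u t y).2) x.
set H1 := D1 (th t) x; set H2 := D2 (th t) x.
apply/is_derive1_epsP => e e0.
pose C := `|G1| + `|G2| + `|H1| + `|H2| + 2.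
have C0 : 0 < C by rewrite /C ltr_wpDl// !addr_ge0.
have [eta [eta0 eta2 etaC]] : exists eta, [/\ 0 < eta, eta + eta <= 2 & eta * C <= e].
  exists (Num.min 1 (e / C)); split.
  - by rewrite lt_min ltr01 divr_gt0.
  - have : Num.min 1 (e / C) <= 1 by rewrite ge_min lexx.
    by move: (Num.min _ _) => m; lra.
  - by rewrite -ler_pdivlMr// ge_min lexx orbT.
have [d1 d10 b1] := spacetime_eps x cG1 lt eta0.
have [d2 d20 b2] := spacetime_eps x cG2 lt eta0.
have [d3 d30 b3] := spacetime_eps x cH1 lt eta0.
have [d4 d40 b4] := spacetime_eps x cH2 lt eta0.
have [d [d0 dd1 dd2 dd3 dd4]] : exists d, [/\ 0 < d, d <= d1, d <= d2, d <= d3 & d <= d4].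
  exists (Num.min (Num.min d1 d2) (Num.min d3 d4)).
  by rewrite !lt_min d10 d20 d30 d40 !ge_min !lexx !orbT.
have cX : {for t, continuous (X a tau)}.
  apply: differentiable_continuous; apply/derivable1_diffP.
  by have [] := is_derive_traj traj a ltau lt.
have d20' : 0 < d / 2 by rewrite divr_gt0.
have /cvgrPdist_lt /(_ _ d20') /nbhs_ballP[r /= r0 hr] := cX.
exists (Num.min d r); first by rewrite lt_min d0.
move=> k; rewrite lt_min => /andP[kd kr].
have near_t z : `|z - t| <= `|k| -> [/\ `|z - t| < d, `|X a tau z - x| < d / 2 & live Tstar z].
  move=> zk; have zd : `|z - t| < d by rewrite (le_lt_trans zk).
  split => //; first by rewrite distrC; apply: hr; rewrite /ball /= distrC (le_lt_trans zk).
  have [] // := b1 z x; first by rewrite (lt_le_trans zd).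
  by rewrite subrr normr0.
have nk : `|t + k - t| <= `|k| by rewrite addrC addKr.
have [_ _ ltk] := near_t _ nk.
apply: (derive_diff_le d20').
- by apply: diff_derivable; exact: (theta_differentiable sol).
- by apply: diff_derivable; exact: (theta_differentiable sol).
move=> h /andP[h0 hd].
pose q s := th s (X a tau s + h *: ei i) - th s (X a tau s).
(* The translated point moves with the velocity of the original one, not with the local velocity;
   the transport equation leaves exactly this discrepancy. *)
pose dq s := dot (u s (X a tau s) - u s (X a tau s + h *: ei i))
  (grad (th s) (X a tau s + h *: ei i)).
have Dq s : live Tstar s -> is_derive s 1 q (dq s).
  move=> ls; have dX := is_derive_traj traj a ltau ls.
  have dX' : is_derive s 1 (fun s => X a tau s + h *: ei i) (u s (X a tau s)).
    by apply: is_derive_eq; rewrite addr0.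
  have r1 := transport_chain sol ls dX'.
  have r2 := transport_chain sol ls dX.
  rewrite subrr in r2.
  have r2' : is_derive s 1 (fun s => th s (X a tau s)) 0.
    by move: r2; rewrite /dot /= !mul0r addr0.
  by rewrite /q; apply: is_derive_eq; rewrite subr0.
have mvt : exists2 z, `|z - t| <= `|k| & q (t + k) - q t = dq z * k.
  have lz z : `|z - t| <= `|k| -> live Tstar z by move=> /near_t[].
  have [k0|k0] := leP 0 k.
    have [|||z] := @MVT_segment R q dq t (t + k).
    - by rewrite lerDl.
    - move=> z; rewrite in_itv /= => /andP[z1 z2]; apply: Dq; apply: lz.
      by apply: near_between; left; rewrite !ltW.
    - apply: derivable_within_continuous => z; rewrite in_itv /= => z12.
      by have [] // := Dq z; apply: lz; apply: near_between; left.
    rewrite in_itv /= => z12 E; exists z; first by apply: near_between; left.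
    by rewrite E addrC addKr.
  have kt : t + k <= t by rewrite gerDl ltW.
  have [||z] := @MVT_segment R q dq (t + k) t kt.
  - move=> z; rewrite in_itv /= => /andP[z1 z2]; apply: Dq; apply: lz.
    by apply: near_between; right; rewrite !ltW.
  - apply: derivable_within_continuous => z; rewrite in_itv /= => z12.
    by have [] // := Dq z; apply: lz; apply: near_between; right.
  rewrite in_itv /= => z12 E; exists z; first by apply: near_between; right.
  by rewrite -[LHS]opprB E; ring.
have [z zk E] := mvt.
have -> : th (t + k) (X a tau (t + k) + h *: ei i) - th (t + k) (X a tau (t + k)) -
  (th t (X a tau t + h *: ei i) - th t (X a tau t)) = dq z * k by rewrite -E.
have [zd zX lz] := near_t _ zk.
have near_x p : `|p - X a tau z| <= h -> `|p - x| < d.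
  move=> ph; rewrite (le_lt_trans (ler_distD (X a tau z) _ _))// [ltRHS]splitr.
  by rewrite ler_ltD// (le_trans ph).
have near_line c : `|c| <= h -> `|X a tau z + c *: ei i - x| < d.
  move=> ch; apply: near_x; rewrite addrC addKr normrZ norm_ei mulr1//.
have du1 p : differentiable (fun y => (u z y).1) p.
  by have [D _ _ _] := u1C; apply: D; exact: live_lifespan.
have du2 p : differentiable (fun y => (u z y).2) p.
  by have [D _ _ _] := u2C; apply: D; exact: live_lifespan.
have [c1 c1h E1] := mvt_direction (X a tau z) (ei i) du1 h0.
have [c2 c2h E2] := mvt_direction (X a tau z) (ei i) du2 h0.
have hh : `|h| <= h by rewrite ger0_norm// ltW.
have [_ k1] := b1 z _ (lt_le_trans zd dd1) (lt_le_trans (near_line _ c1h) dd1).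
have [_ k2] := b2 z _ (lt_le_trans zd dd2) (lt_le_trans (near_line _ c2h) dd2).
have [_ k3] := b3 z _ (lt_le_trans zd dd3) (lt_le_trans (near_line _ hh) dd3).
have [_ k4] := b4 z _ (lt_le_trans zd dd4) (lt_le_trans (near_line _ hh) dd4).
pose g1 := 'D_(ei i) (fun y => (u z y).1) (X a tau z + c1 *: ei i).
pose g2 := 'D_(ei i) (fun y => (u z y).2) (X a tau z + c2 *: ei i).
pose h1 := D1 (th z) (X a tau z + h *: ei i); pose h2 := D2 (th z) (X a tau z + h *: ei i).
have k1' : `|g1 - G1| <= eta * 1 by rewrite mulr1; exact: ltW k1.
have k2' : `|g2 - G2| <= eta * 1 by rewrite mulr1; exact: ltW k2.
have m1 : `|g1 * h1 - G1 * H1| <= eta * (1 * (`|H1| + eta) + `|G1|).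
  exact: mul_diff_le (ltW eta0) (ltW k3) k1'.
have m2 : `|g2 * h2 - G2 * H2| <= eta * (1 * (`|H2| + eta) + `|G2|).
  exact: mul_diff_le (ltW eta0) (ltW k4) k2'.
have dqE : dq z = (0 - h * g1) * h1 + (0 - h * g2) * h2.
  rewrite -[h * g1]E1 -[h * g2]E2 !sub0r !opprB.
  by [].
exact: (frozen_bound k eta0 eta2 etaC (ltW h0) m1 m2 dqE).
Qed.

End FrozenGradient.

(** * Derivative of the flow along level curves *)

Section FlowDerivative.
Context {R : realType}.

(** Compactness of [[t0, t1]]: locally valid radii admit a common one, as [P] survives a decrease of
    the radius. *)
Lemma segment_uniform (P : R -> R -> Prop) (t0 t1 : R) :
  (forall d d' t, d' <= d -> P d t -> P d' t) ->
  (forall t, t0 <= t <= t1 -> exists r d, [/\ 0 < r, 0 < d & forall t', `|t' - t| < r -> P d t']) ->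
  exists2 d, 0 < d & forall t, t0 <= t <= t1 -> P d t.
Proof.
move=> mono loc.
have /compact_near_coveringP cov := @segment_compact R t0 t1.
have near_P : \forall d \near 0^'+, `[t0, t1]%classic `<=` P d.
  apply: cov => t; rewrite /= in_itv /= => tt.
  have [r [d [r0 d0 h]]] := loc t tt.
  exists ([set t' | `|t' - t| < r], [set d' | d' <= d]); last first.
    by move=> [t' d'] /= [h1 h2]; apply: mono h2 _; exact: h.
  split => /=; last exact: nbhs_right_le.
  by apply/nbhs_ballP; exists r => //= t'; rewrite /ball /= distrC.
have [d [d0 h]] : exists d, 0 < d /\ `[t0, t1]%classic `<=` P d.
  near (0 : R)^'+ => d; exists d; split; first by near: d; exact: nbhs_right_gt.
  by near: d.
by exists d => // t tt; apply: h; rewrite /= in_itv.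
Unshelve. all: by end_near. Qed.

Lemma sumsq_derive_le (r1 r2 d1 d2 K : R) : 0 <= K ->
  `|d1| <= K * (`|r1| + `|r2|) -> `|d2| <= K * (`|r1| + `|r2|) ->
  - (2 * r1 * d1 + 2 * r2 * d2) <= 4 * K * (r1 ^+ 2 + r2 ^+ 2) + 0.
Proof.
move=> K0 h1 h2; rewrite addr0 -!(mulrA 2) -mulrDr -(real_normK (num_real r1)) -(real_normK (num_real r2)).
have n1 : - (r1 * d1) <= `|r1| * (K * (`|r1| + `|r2|)).
  by rewrite (le_trans (ler_norm _))// normrN normrM ler_wpM2l.
have n2 : - (r2 * d2) <= `|r2| * (K * (`|r1| + `|r2|)).
  by rewrite (le_trans (ler_norm _))// normrN normrM ler_wpM2l.
have sq : 0 <= K * (`|r1| - `|r2|) ^+ 2 by rewrite mulr_ge0// sqr_ge0.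
by move: `|r1| `|r2| (r1 * d1) (r2 * d2) n1 n2 sq => x y p q; nra.
Qed.

(** The cross term [2 rho (|r1| + |r2|)] is at most [rho^2 + (|r1| + |r2|)^2]; the last square
    accounts for the extra 2 in the rate. *)
Lemma sumsq_derive_le_forced (r1 r2 d1 d2 K rho : R) : 0 <= K -> 0 <= rho ->
  `|d1| <= K * (`|r1| + `|r2|) + rho -> `|d2| <= K * (`|r1| + `|r2|) + rho ->
  - (2 * r1 * d1 + 2 * r2 * d2) <= (4 * K + 2) * (r1 ^+ 2 + r2 ^+ 2) + rho ^+ 2.
Proof.
move=> K0 rho0 h1 h2; rewrite -!(mulrA 2) -mulrDr -(real_normK (num_real r1)) -(real_normK (num_real r2)).
have n1 : - (r1 * d1) <= `|r1| * (K * (`|r1| + `|r2|) + rho).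
  by rewrite (le_trans (ler_norm _))// normrN normrM ler_wpM2l.
have n2 : - (r2 * d2) <= `|r2| * (K * (`|r1| + `|r2|) + rho).
  by rewrite (le_trans (ler_norm _))// normrN normrM ler_wpM2l.
have sq : 0 <= K * (`|r1| - `|r2|) ^+ 2 by rewrite mulr_ge0// sqr_ge0.
have sq1 : 0 <= (`|r1| - `|r2|) ^+ 2 by rewrite sqr_ge0.
have sq2 : 0 <= (`|r1| + `|r2| - rho) ^+ 2 by rewrite sqr_ge0.
by move: `|r1| `|r2| (r1 * d1) (r2 * d2) n1 n2 sq sq1 sq2 => x y p q; nra.
Qed.

Lemma is_derive_sumsq (r1 r2 : R -> R) (t d1 d2 : R) :
  is_derive t 1 r1 d1 -> is_derive t 1 r2 d2 ->
  is_derive t 1 (fun t => r1 t ^+ 2 + r2 t ^+ 2) (2 * r1 t * d1 + 2 * r2 t * d2).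
Proof.
move=> h1 h2; apply: is_derive_eq; rewrite /GRing.scale /=.
by ring.
Qed.

Definition pr (i : bool) (x : R * R) : R := if i then x.2 else x.1.

Lemma norm_le_sum (x : R * R) : `|x| <= `|x.1| + `|x.2|.
Proof. by rewrite norm_pair_le lerDl lerDr !normr_ge0. Qed.

Lemma norm_sqr_le (x : R * R) : `|x| ^+ 2 <= x.1 ^+ 2 + x.2 ^+ 2.
Proof.
rewrite norm_pairE -(real_normK (num_real x.1)) -(real_normK (num_real x.2)).
by rewrite /Num.max; case: ifP => _; rewrite ?lerDl ?lerDr sqr_ge0.
Qed.

Variables (Tstar : \bar R) (th : R -> R * R -> R).
Hypothesis sol : classical_solution Tstar th.
Variable X : R * R -> R -> R -> R * R.
Hypothesis traj : trajectories Tstar th X.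
Notation u t := (velocity (th t)).
Notation W t := (gradperp (th t)).

Definition dvel (i j : bool) (t : R) (x : R * R) : R :=
  'D_(ei j) (fun y => pr i (u t y)) x.

Lemma C1_pr (v : R -> R * R -> R * R) i :
  C1_in_space Tstar v -> C1_in_space Tstar (fun t x => pr i (v t x)).
Proof. by case: i; [exact: C1_snd|exact: C1_fst]. Qed.

Lemma continuous_dvel i j : continuous_spacetime Tstar (dvel i j).
Proof. by apply: C1_derive; apply: C1_pr; exact: velocity_C1 sol. Qed.

(** Along a trajectory [W] thus solves the linearized flow equation [w' = (w . grad) u]. The
    equation for the gradient has the transposed matrix, with a minus sign; rotation by a right
    angle together with [div u = 0] turns it into this one. *)
Lemma frozen_gradperp a tau t i : lifespan Tstar tau -> live Tstar t ->
  let x := X a tau t in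
  is_derive t 1 (fun s => pr i (W s (X a tau s)))
    ((W t x).1 * dvel i false t x + (W t x).2 * dvel i true t x).
Proof.
move=> ltau lt x; have ll := live_lifespan lt.
have dv : dvel false false t x + dvel true true t x = 0.
  exact: (divergence_velocity sol x ll).
have g1 := gradient_evolution sol traj a false ltau lt.
have g2 := gradient_evolution sol traj a true ltau lt.
have dv' : dvel true true t x = - dvel false false t x.
  by apply/eqP; rewrite -addr_eq0 addrC dv.
have alg (A B P Q C : R) : C = - A ->
    - (A * P + B * Q) = (- Q) * B + P * C /\ - - (B * P + C * Q) = (- Q) * A + P * B.
  by move=> ->; split; ring.
case: i => /=.
  by apply: is_derive_eq; exact: (alg _ _ _ _ _ dv').1.
have h : is_derive t 1 (fun s => - 'D_(ei true) (th s) (X a tau s))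
    (- - ('D_(ei true) (fun y => (u t y).1) x * 'D_(e1 R) (th t) x +
        'D_(ei true) (fun y => (u t y).2) x * 'D_(e2 R) (th t) x)).
  exact: (@is_deriveN _ _ _ (fun s => 'D_(ei true) (th s) (X a tau s))).
by apply: is_derive_eq; exact: (alg _ _ _ _ _ dv').2.
Qed.

End FlowDerivative.

Section Tube.
Context {R : realType}.
Variables (Tstar : \bar R).

Lemma tube (G : R -> R * R -> R) (a : R -> R * R) (t0 t1 eta : R) :
  continuous_spacetime Tstar G -> (forall t, t0 <= t <= t1 -> live Tstar t) ->
  (forall t, t0 <= t <= t1 -> {for t, continuous a}) -> 0 < eta ->
  exists2 d, 0 < d & forall t, t0 <= t <= t1 ->
    forall y, `|y - a t| <= d -> `|G t y - G t (a t)| <= eta.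
Proof.
move=> cG lt ca eta0.
apply: (@segment_uniform R (fun d t => forall y, `|y - a t| <= d -> `|G t y - G t (a t)| <= eta)).
  by move=> d d' t dd h y yd; apply: h; exact: le_trans dd.
move=> t tt; have e20 : 0 < eta / 2 by rewrite divr_gt0.
have [d d0 hd] := spacetime_eps (a t) cG (lt _ tt) e20.
have d20 : 0 < d / 2 by rewrite divr_gt0.
have /cvgrPdist_lt /(_ _ d20) /nbhs_ballP[r /= r0 hr] := ca _ tt.
exists (Num.min r d), (d / 2); split => //; first by rewrite lt_min r0.
move=> t'; rewrite lt_min => /andP[h1 h2] y yd.
have at' : `|a t' - a t| < d / 2 by rewrite distrC; apply: hr; rewrite /ball /= distrC.
have at2 : `|a t' - a t| < d by rewrite (lt_le_trans at')// ler_pdivrMr// ler_peMr ?ler1n// ltW.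
have [_ k1] := hd t' (a t') h2 at2.
have yt : `|y - a t| < d.
  rewrite (le_lt_trans (ler_distD (a t') _ _))// [ltRHS]splitr ler_ltD//.
have [_ k2] := hd t' y h2 yt.
rewrite (le_trans (ler_distD (G t (a t)) _ _))// [leRHS]splitr lerD ?(ltW k2)//.
by rewrite distrC ltW.
Qed.

Lemma tube_bounded (G : R -> R * R -> R) (a : R -> R * R) (t0 t1 : R) :
  continuous_spacetime Tstar G -> (forall t, t0 <= t <= t1 -> live Tstar t) ->
  (forall t, t0 <= t <= t1 -> {for t, continuous a}) ->
  exists2 K, 0 < K & forall t, t0 <= t <= t1 -> `|G t (a t)| <= K.
Proof.
move=> cG lt ca.
(* The upper bound is encoded as a small radius, [|G| <= 1 / d], to obtain it from the same
   compactness lemma. *)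
have [||d d0 hd] := @segment_uniform R (fun d t => 0 < d -> `|G t (a t)| * d <= 1) t0 t1.
- move=> d d' t dd h d0; apply: le_trans (h (lt_le_trans d0 dd)).
  by rewrite ler_wpM2l.
- move=> t tt; have [d d0 hd] := spacetime_eps (a t) cG (lt _ tt) (@ltr01 R).
  have /cvgrPdist_lt /(_ _ d0) /nbhs_ballP[r /= r0 hr] := ca _ tt.
  have p0 : 0 < `|G t (a t)| + 1 by rewrite ltr_wpDl.
  exists (Num.min r d), ((`|G t (a t)| + 1)^-1); split.
  + by rewrite lt_min r0.
  + by rewrite invr_gt0.
  move=> t'; rewrite lt_min => /andP[h1 h2] _.
  have at' : `|a t' - a t| < d by rewrite distrC; apply: hr; rewrite /ball /= distrC.
  have [_ k1] := hd t' (a t') h2 at'.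
  rewrite ler_pdivrMr// mul1r -[G t' _](subrK (G t (a t))) addrC.
  by rewrite (le_trans (ler_normD _ _))// lerD2l ltW.
exists d^-1; first by rewrite invr_gt0.
by move=> t tt; rewrite -[d^-1]mul1r ler_pdivlMr//; exact: hd.
Qed.

Lemma bool_uniform (P : bool -> R -> Prop) :
  (forall i d d', d' <= d -> P i d -> P i d') ->
  (forall i, exists2 d, 0 < d & P i d) -> exists2 d, 0 < d & forall i, P i d.
Proof.
move=> mono h; have [d1 d10 h1] := h true; have [d2 d20 h2] := h false.
exists (Num.min d1 d2); first by rewrite lt_min d10.
by case; [apply: mono h1|apply: mono h2]; rewrite ge_min lexx ?orbT.
Qed.

Lemma mvt_error (p q x y g1 g2 eta : R) : `|x - g1| <= eta -> `|y - g2| <= eta ->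
  `|p * x + q * y - (p * g1 + q * g2)| <= eta * (`|p| + `|q|).
Proof.
move=> h1 h2; have -> : p * x + q * y - (p * g1 + q * g2) = p * (x - g1) + q * (y - g2) by ring.
rewrite (le_trans (ler_normD _ _))// !normrM mulrDr.
by rewrite mulrC [X in _ + X]mulrC lerD// ler_wpM2r.
Qed.

Variable th : R -> R * R -> R.
Hypothesis sol : classical_solution Tstar th.
Variable X : R * R -> R -> R -> R * R.
Hypothesis traj : trajectories Tstar th X.
Notation u t := (velocity (th t)).
Notation W t := (gradperp (th t)).

Lemma velocity_taylor (a : R -> R * R) (t0 t1 eta : R) :
  (forall t, t0 <= t <= t1 -> live Tstar t) ->
  (forall t, t0 <= t <= t1 -> {for t, continuous a}) -> 0 < eta ->
  exists2 d, 0 < d & forall t, t0 <= t <= t1 -> forall y i, `|y - a t| <= d ->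
    `|pr i (u t y) - pr i (u t (a t)) -
      ((y - a t).1 * dvel th i false t (a t) + (y - a t).2 * dvel th i true t (a t))| <=
    eta * (`|(y - a t).1| + `|(y - a t).2|).
Proof.
move=> lt ca eta0.
have [d d0 hd] : exists2 d, 0 < d & forall i j t, t0 <= t <= t1 ->
    forall y, `|y - a t| <= d -> `|dvel th i j t y - dvel th i j t (a t)| <= eta.
  apply: (bool_uniform (P := fun i d => forall j t, t0 <= t <= t1 ->
    forall y, `|y - a t| <= d -> `|dvel th i j t y - dvel th i j t (a t)| <= eta)).
    by move=> i d d' dd h j t tt y yd; apply: h => //; exact: le_trans dd.
  move=> i; apply: (bool_uniform (P := fun j d => forall t, t0 <= t <= t1 ->
    forall y, `|y - a t| <= d -> `|dvel th i j t y - dvel th i j t (a t)| <= eta)).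
    by move=> j d d' dd h t tt y yd; apply: h => //; exact: le_trans dd.
  by move=> j; apply: tube => //; exact: continuous_dvel.
exists d => // t tt y i yd.
have df z : differentiable (fun y => pr i (u t y)) z.
  have [D _ _ _] := C1_pr i (velocity_C1 sol).
  by apply: D; exact: live_lifespan (lt _ tt).
have [c c01 E] := mvt_plane (a t) y df.
set z := a t + _ in E.
have zd : `|z - a t| <= d by apply: le_trans yd; exact: mvt_dist.
have k1 := hd i false t tt z zd; have k2 := hd i true t tt z zd.
have -> : pr i (u t y) - pr i (u t (a t)) =
  (y - a t).1 * dvel th i false t z + (y - a t).2 * dvel th i true t z by exact: E.
by apply: mvt_error; [exact: k1|exact: k2].
Qed.

End Tube.

Section FlowLinearization.
Context {R : realType}.

Lemma taylor_le (D p q g1 g2 eta K : R) : `|D - (p * g1 + q * g2)| <= eta * (`|p| + `|q|) ->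
  `|g1| <= K -> `|g2| <= K -> `|D| <= (K + eta) * (`|p| + `|q|).
Proof.
move=> h k1 k2; rewrite -[D](subrK (p * g1 + q * g2)) (le_trans (ler_normD _ _))//.
rewrite mulrDl addrC lerD// (le_trans (ler_normD _ _))// !normrM mulrDr.
by rewrite mulrC [X in _ + X]mulrC lerD// ler_wpM2r.
Qed.

Lemma taylor_err (D p q g1 g2 w1 w2 h rho K : R) : `|D - (p * g1 + q * g2)| <= rho ->
  `|g1| <= K -> `|g2| <= K ->
  `|D - h * (w1 * g1 + w2 * g2)| <= K * (`|p - h * w1| + `|q - h * w2|) + rho.
Proof.
move=> H k1 k2.
have -> : D - h * (w1 * g1 + w2 * g2) =
  ((p - h * w1) * g1 + (q - h * w2) * g2) + (D - (p * g1 + q * g2)) by ring.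
rewrite (le_trans (ler_normD _ _))// lerD// (le_trans (ler_normD _ _))// !normrM mulrDr.
by rewrite mulrC [X in _ + X]mulrC lerD// ler_wpM2r.
Qed.

Lemma norm_lt_sumsq (x : R * R) (d : R) : 0 <= d -> x.1 ^+ 2 + x.2 ^+ 2 < d ^+ 2 -> `|x| < d.
Proof.
move=> d0 h; have := le_lt_trans (norm_sqr_le x) h.
by rewrite ltr_pXn2r// nnegrE.
Qed.

Lemma sqr_norm_le (x y : R) : `|x| <= y -> x ^+ 2 <= y ^+ 2.
Proof.
by move=> h; rewrite -(real_normK (num_real x)) lerXn2r// nnegrE// (le_trans _ h).
Qed.

Lemma sqr_sum_le (x y a : R) : x ^+ 2 + y ^+ 2 <= a -> (x + y) ^+ 2 <= 2 * a.
Proof. by move=> h; have := sqr_ge0 (x - y); nra. Qed.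

Lemma le_sqr_succ (q : R) : 0 <= q -> q <= (q + 1) ^+ 2.
Proof. by move=> q0; nra. Qed.

Lemma norm_le_sqr (x y : R) : 0 <= y -> x ^+ 2 <= y ^+ 2 -> `|x| <= y.
Proof.
by move=> y0; rewrite -(real_normK (num_real x)) ler_pXn2r// nnegrE.
Qed.

Variables (Tstar : \bar R) (th : R -> R * R -> R).
Hypothesis sol : classical_solution Tstar th.
Variable X : R * R -> R -> R -> R * R.
Hypothesis traj : trajectories Tstar th X.
Notation u t := (velocity (th t)).
Notation W t := (gradperp (th t)).

Variables (t0 t1 : R).
Hypothesis live0 : live Tstar t0.
Hypothesis live1 : live Tstar t1.
Hypothesis t01 : t0 <= t1.

Let live_seg t : t0 <= t <= t1 -> live Tstar t.
Proof. by move=> /andP[h1 h2]; apply: live_le h2 live1; apply: lt_le_trans h1; case: live0. Qed.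

Let ll1 : lifespan Tstar t1. Proof. exact: live_lifespan. Qed.

Let continuous_traj al t : t0 <= t <= t1 -> {for t, continuous (X al t1)}.
Proof.
move=> tt; apply: differentiable_continuous; apply/derivable1_diffP.
by have [] := is_derive_traj traj al ll1 (live_seg tt).
Qed.

Let traj_end al : X al t1 t1 = al. Proof. by have [] := traj al ll1. Qed.

Let is_derive_pr_traj i al t : t0 <= t <= t1 ->
  is_derive t 1 (fun t => pr i (X al t1 t)) (pr i (u t (X al t1 t))).
Proof.
move=> tt; have h := is_derive_traj traj al ll1 (live_seg tt).
by case: i; [exact: is_derive_snd|exact: is_derive_fst].
Qed.

Let dvel_bounded al : exists2 K, 0 < K & forall i j t, t0 <= t <= t1 ->
  `|dvel th i j t (X al t1 t)| <= K.
Proof.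
have H i j : exists2 K, 0 < K & forall t, t0 <= t <= t1 -> `|dvel th i j t (X al t1 t)| <= K.
  apply: (@tube_bounded _ Tstar (dvel th i j) (X al t1) t0 t1) => // [|t tt].
    exact: (continuous_dvel sol).
  exact: continuous_traj.
have [K1 p1 h1] := H true true; have [K2 p2 h2] := H true false.
have [K3 p3 h3] := H false true; have [K4 p4 h4] := H false false.
exists (K1 + K2 + K3 + K4); first by rewrite !addr_gt0.
case; case=> t tt.
- by rewrite (le_trans (h1 t tt))//; lra.
- by rewrite (le_trans (h2 t tt))//; lra.
- by rewrite (le_trans (h3 t tt))//; lra.
- by rewrite (le_trans (h4 t tt))//; lra.
Qed.

(** The expansion of the velocity is valid only within [d] of the reference trajectory. The initial
    distance is divided by [2 (E + 1)], [E] being the Gronwall factor, so that the neighbour is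
    trapped in that tube throughout [[t0, t1]]. *)
Lemma flow_lipschitz al : exists C d, [/\ 0 <= C, 0 < d & forall be,
  `|be - al| < d -> forall t, t0 <= t <= t1 ->
  (X be t1 t - X al t1 t).1 ^+ 2 + (X be t1 t - X al t1 t).2 ^+ 2 <=
  C * ((be - al).1 ^+ 2 + (be - al).2 ^+ 2)].
Proof.
have [d d0 hd] := velocity_taylor sol live_seg (@continuous_traj al) (@ltr01 R).
have [K K0 hK] := dvel_bounded al.
pose E := expR (4 * (K + 1) * (t1 - t0)).
have E0 : 0 < E by exact: expR_gt0.
exists E, (d / (2 * (E + 1))); split; first exact: ltW.
  by rewrite divr_gt0// mulr_gt0// addr_gt0.
move=> be bed.
pose r i t := pr i (X be t1 t) - pr i (X al t1 t).
pose dr i t := pr i (u t (X be t1 t)) - pr i (u t (X al t1 t)).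
have Dr i t : t0 <= t <= t1 -> is_derive t 1 (r i) (dr i t).
  move=> tt; have h1 := is_derive_pr_traj i al tt; have h2 := is_derive_pr_traj i be tt.
  by rewrite /r; apply: is_derive_eq.
pose phi t := r false t ^+ 2 + r true t ^+ 2.
have K10 : 0 <= K + 1 by rewrite addr_ge0// ltW.
have ineq t : t0 <= t <= t1 -> phi t < d ^+ 2 ->
    - (2 * r false t * dr false t + 2 * r true t * dr true t) <= 4 * (K + 1) * phi t + 0.
  move=> tt pd; have nd : `|X be t1 t - X al t1 t| <= d.
    by apply: ltW; apply: (norm_lt_sumsq (ltW d0)); exact: pd.
  apply: sumsq_derive_le => //.
    exact: (taylor_le (hd t tt _ false nd) (hK _ _ t tt) (hK _ _ t tt)).
  exact: (taylor_le (hd t tt _ true nd) (hK _ _ t tt) (hK _ _ t tt)).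
have phi1 : phi t1 = (be - al).1 ^+ 2 + (be - al).2 ^+ 2 by rewrite /phi /r !traj_end.
have phi_small : phi t1 * E < d ^+ 2.
  rewrite phi1; move: bed; rewrite norm_pair_lt => /andP[/ltW/sqr_norm_le b1 /ltW/sqr_norm_le b2].
  have E1 : 0 < E + 1 by rewrite addr_gt0.
  have dE : (d / (2 * (E + 1))) ^+ 2 * (2 * (2 * (E + 1) ^+ 2)) = d ^+ 2.
    by field; rewrite gt_eqF.
  move: ((d / _) ^+ 2) b1 b2 dE => q b1 b2 dE.
  apply: (@le_lt_trans _ _ (2 * q * E)); first by rewrite ler_wpM2r ?(ltW E0)//; lra.
  have q0 : 0 < q by move: dE; have := exprn_gt0 2 d0; have := exprn_gt0 2 E1; nra.
  by rewrite -dE; nra.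
have := @gronwall_trap R phi (fun t => 2 * r false t * dr false t + 2 * r true t * dr true t)
  t0 t1 (4 * (K + 1)) 0 (d ^+ 2) t01.
rewrite mul0r addr0 -/E => G t tt; rewrite mulrC -phi1; apply: G => //.
- by rewrite mulr_ge0.
- by move=> z zz; apply: is_derive_sumsq; exact: Dr.
- by rewrite addr_ge0 ?sqr_ge0.
Qed.

(* [X be t1 t - X al t1 t - h lam W t (X al t1 t)] solves the linearized equation
   up to a forcing o(h), because the vorticity-like field [W] is transported. *)
Lemma flow_derivative (g : R -> R * R) (s lam : R) :
  is_derive s 1 g (lam *: W t1 (g s)) ->
  forall i, is_derive s 1 (fun z => pr i (X (g z) t1 t0))
    (lam * pr i (W t0 (X (g s) t1 t0))).
Proof.
move=> dg; set al := g s.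
have [C [d1 [C0 d10 lip]]] := flow_lipschitz al.
have [K K0 hK] := dvel_bounded al.
have /is_derive1_epsP dg1 := is_derive_fst dg.
have /is_derive1_epsP dg2 := is_derive_snd dg.
set v := lam *: W t1 al in dg1 dg2.
pose T := t1 - t0; have T0 : 0 <= T by rewrite subr_ge0.
pose V := (`|v.1| + 1) ^+ 2 + (`|v.2| + 1) ^+ 2.
have V0 : 0 <= V by rewrite addr_ge0 ?sqr_ge0.
(* [sg * |h|] will bound the sum of the two coordinate separations at all times: [V h^2] bounds the
   squared displacement of [g], the flow multiplies it by at most [C], and the 2 comes from
   [(x + y)^2 <= 2 (x^2 + y^2)]. *)
have [sg [sg0 sgV]] : exists sg, 0 < sg /\ 2 * (C * V) <= sg ^+ 2.
  exists (2 * (C * V) + 1); have : 0 <= C * V by rewrite mulr_ge0.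
  by move: (C * V) => c c0; split; nra.
pose E := expR ((4 * K + 2) * T); have E0 : 0 < E by exact: expR_gt0.
(* The Gronwall bound for the squared error in units of [eta^2 h^2]: 2 from the final data, one per
   coordinate, and [sg^2 T] from the forcing accumulated over the interval. *)
pose Q := (2 + sg ^+ 2 * T) * E.
have Q0 : 0 <= Q by rewrite mulr_ge0 ?(ltW E0)// addr_ge0// mulr_ge0// sqr_ge0.
suff main e : 0 < e -> exists2 d, 0 < d & forall h, `|h| < d -> forall i,
    `|pr i (X (g (s + h)) t1 t0) - pr i (X al t1 t0) - h * (lam * pr i (W t0 (X al t1 t0)))|
    <= e * `|h|.
  move=> i; apply/is_derive1_epsP => e e0; have [d d0 hd] := main e e0.
  by exists d => // h hh; exact: hd.
move=> e0; have [eta [eta0 etaQ]] : exists eta, 0 < eta /\ eta ^+ 2 * Q <= e ^+ 2.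
  have Q1 : 0 < Q + 1 by rewrite ltr_wpDl.
  exists (e / (Q + 1)); split; first by rewrite divr_gt0.
  rewrite expr_div_n mulrAC ler_pdivrMr ?exprn_gt0// ler_wpM2l ?sqr_ge0//.
  exact: le_sqr_succ.
have [d2 d20 hd2] := velocity_taylor sol live_seg (@continuous_traj al) eta0.
have [d3 d30 g3] := dg1 1 ltr01; have [d4 d40 g4] := dg2 1 ltr01.
have [d5 d50 g5] := dg1 eta eta0; have [d6 d60 g6] := dg2 eta eta0.
have cg : {for s, continuous g}.
  by apply: differentiable_continuous; apply/derivable1_diffP; have [] := dg.
have /cvgrPdist_lt /(_ _ d10) /nbhs_ballP[d7 /= d70 g7] := cg.
exists (Num.min (Num.min (Num.min d3 d4) (Num.min d5 d6)) (Num.min d7 (d2 / sg))).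
  by rewrite !lt_min d30 d40 d50 d60 d70 divr_gt0.
move=> h; rewrite !lt_min => /andP[/andP[/andP[h3 h4] /andP[h5 h6]] /andP[h7 h2]].
set be := g (s + h).
have bed : `|be - al| < d1.
  by rewrite distrC; apply: g7; rewrite /ball /= opprD addNKr normrN.
have lips := lip be bed.
have beV : (be - al).1 ^+ 2 + (be - al).2 ^+ 2 <= V * h ^+ 2.
  have st (x y : R) : `|x - h * y| <= 1 * `|h| -> x ^+ 2 <= (`|y| + 1) ^+ 2 * h ^+ 2.
    move=> k; rewrite -exprMn -[h in leRHS]/(h) -[leRHS]real_normK ?num_real// normrM.
    apply: sqr_norm_le; rewrite [`|_ + _|]ger0_norm ?addr_ge0// mulrDl mul1r.
    rewrite -[x](subrK (h * y)) addrC (le_trans (ler_normD _ _))// normrM mulrC lerD2l.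
    by rewrite -[leRHS]mul1r.
  by rewrite mulrDl lerD//; apply: st; [exact: g3|exact: g4].
pose r i t := pr i (X be t1 t) - pr i (X al t1 t).
pose dr i t := pr i (u t (X be t1 t)) - pr i (u t (X al t1 t)).
have Dr i t : t0 <= t <= t1 -> is_derive t 1 (r i) (dr i t).
  move=> tt; have k1 := is_derive_pr_traj i al tt; have k2 := is_derive_pr_traj i be tt.
  by rewrite /r; apply: is_derive_eq.
have r_small t : t0 <= t <= t1 -> `|r false t| + `|r true t| <= sg * `|h|.
  move=> tt; rewrite -[leLHS]ger0_norm ?addr_ge0//; apply: norm_le_sqr.
    by rewrite mulr_ge0// ltW.
  have k : r false t ^+ 2 + r true t ^+ 2 <= C * (V * h ^+ 2).
    by apply: le_trans (lips t tt) _; rewrite ler_wpM2l.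
  rewrite exprMn real_normK ?num_real//.
  apply: le_trans (ler_wpM2r (sqr_ge0 h) sgV).
  have -> : 2 * (C * V) * h ^+ 2 = 2 * (C * (V * h ^+ 2)) by rewrite !mulrA.
  apply: sqr_sum_le; rewrite !real_normK ?num_real//.
have r_tube t : t0 <= t <= t1 -> `|X be t1 t - X al t1 t| <= d2.
  move=> tt; apply: (le_trans (norm_le_sum _)); apply: (le_trans (r_small t tt)).
  by move: (ltW h2); rewrite ler_pdivlMr// mulrC.
pose w i t := pr i (W t (X al t1 t)).
pose dw i t := w false t * dvel th i false t (X al t1 t) + w true t * dvel th i true t (X al t1 t).
have Dw i t : t0 <= t <= t1 -> is_derive t 1 (w i) (dw i t).
  by move=> tt; exact: (frozen_gradperp sol traj al i ll1 (live_seg tt)).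
pose er i t := r i t - h * lam * w i t.
pose der i t := dr i t - h * lam * dw i t.
have Der i t : t0 <= t <= t1 -> is_derive t 1 (er i) (der i t).
  move=> tt; have k1 := Dr i t tt; have k2 := Dw i t tt.
  by rewrite /er; apply: is_derive_eq; rewrite /der /GRing.scale /= ?mulr0 ?addr0.
pose rho := eta * (sg * `|h|).
have rho0 : 0 <= rho by rewrite !mulr_ge0// ltW.
have err i t : t0 <= t <= t1 -> `|der i t| <= K * (`|er false t| + `|er true t|) + rho.
  move=> tt; apply: taylor_err (hK _ _ t tt) (hK _ _ t tt).
  apply: (le_trans (hd2 t tt _ i (r_tube t tt))).
  by rewrite ler_wpM2l ?(ltW eta0)//; exact: r_small.
pose psi t := er false t ^+ 2 + er true t ^+ 2.
have psi0 : 0 <= psi t1 by rewrite addr_ge0 ?sqr_ge0.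
have psi1 : psi t1 <= eta ^+ 2 * h ^+ 2 * 2.
  have st x : `|x| <= eta * `|h| -> x ^+ 2 <= eta ^+ 2 * h ^+ 2.
    by move=> /sqr_norm_le; rewrite exprMn real_normK ?num_real.
  have k1 : er false t1 ^+ 2 <= eta ^+ 2 * h ^+ 2.
    by apply: st; rewrite /er /r /w !traj_end -mulrA; exact: g5.
  have k2 : er true t1 ^+ 2 <= eta ^+ 2 * h ^+ 2.
    by apply: st; rewrite /er /r /w !traj_end -mulrA; exact: g6.
  by rewrite mulr_natr mulr2n lerD.
have K4 : 0 <= 4 * K + 2 by rewrite addr_ge0// mulr_ge0// ltW.
(* Here the differential inequality holds whatever the size of [psi], so any [M] above the resulting
   bound serves, whence the [+ 1]. *)
have := @gronwall_trap R psi (fun t => 2 * er false t * der false t + 2 * er true t * der true t)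
  t0 t1 (4 * K + 2) (rho ^+ 2) ((psi t1 + rho ^+ 2 * T) * E + 1) t01 K4 (sqr_ge0 _).
rewrite -/T -/E => G.
have {}G : psi t0 <= (psi t1 + rho ^+ 2 * T) * E.
  apply: G => //.
  - by move=> t tt; apply: is_derive_sumsq; exact: Der.
  - by move=> t tt _; apply: sumsq_derive_le_forced (err false t tt) (err true t tt) => //; exact: ltW.
  - by rewrite ltrDl.
  - by rewrite lexx.
have psiE : psi t0 <= (e * `|h|) ^+ 2.
  apply: (le_trans G); apply: (@le_trans _ _ (eta ^+ 2 * Q * h ^+ 2)); last first.
    by rewrite exprMn real_normK ?num_real// ler_wpM2r ?sqr_ge0.
  have -> : eta ^+ 2 * Q * h ^+ 2 = (eta ^+ 2 * h ^+ 2 * 2 + rho ^+ 2 * T) * E.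
    rewrite /rho /Q !exprMn real_normK ?num_real//.
    by move: (E) (T) => E' T'; ring.
  by rewrite ler_wpM2r ?(ltW E0)// lerD2r.
have eh0 : 0 <= e * `|h| by rewrite mulr_ge0// ltW.
move=> i; rewrite mulrA; apply: (norm_le_sqr eh0); apply: le_trans psiE.
by rewrite /psi; case: i; rewrite ?lerDl ?lerDr sqr_ge0.
Qed.

End FlowLinearization.

(** * Pointwise bounds on theta and its gradient *)

Section Bounds.
Context {R : realType}.
Notation mu := (@lebesgue_measure R).
Notation m2 := (sprod mu mu).

Lemma mu2_rectangle (a b c d : R) : a <= b -> c <= d ->
  @mu2 R (`[a, b] `*` `[c, d])%classic = ((b - a) * (d - c))%:E.
Proof.
move=> ab cd; rewrite /mu2 product_measure1E; [|exact: measurable_itv|exact: measurable_itv].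
transitivity ((b - a)%:E * (d - c)%:E)%E; last by rewrite -EFinM.
have m1 (x y : R) : x <= y -> lebesgue_measure (`[x, y]%classic : set R) = (y - x)%:E.
  rewrite le_eqVlt => /orP[/eqP ->|xy].
    by rewrite set_itv1 lebesgue_measure_set1 subrr.
  by rewrite lebesgue_measure_itv /= lte_fin xy EFinB.
by congr (_ * _)%E; exact: m1.
Qed.

Variables (Tstar : \bar R) (th : R -> R * R -> R).
Hypothesis sol : classical_solution Tstar th.

Lemma continuous_theta t : lifespan Tstar t -> continuous (th t).
Proof.
move=> lt x; have [_ c _ _] := theta_C1 sol.
exact: (@spacetime_slice _ _ _ _ t x c lt).
Qed.

Lemma continuous_gradperp t : lifespan Tstar t -> continuous (gradperp (th t)).
Proof.
move=> lt x; have [_ c _ _] := gradperp_theta_C1 sol.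
exact: (@spacetime_slice _ _ _ _ t x c lt).
Qed.

Lemma continuous_enorm (x : R * R) : {for x, continuous (@enorm R)}.
Proof.
apply: (@continuous_comp _ _ _ (fun x : R * R => dot x x) (@Num.sqrt R)).
  by apply: cvgD; apply: cvgM; (exact: cvg_fst || exact: cvg_snd).
exact: sqrt_continuous.
Qed.

(** [Omega] is an essential supremum, and [fine] would send an infinite one to 0, which
    [expR 1 < Omega th t] excludes. By continuity a violation at [x] persists on a square of
    positive measure. *)
Lemma gradperp_le_Omega t x : lifespan Tstar t -> expR 1 < Omega th t ->
  enorm (gradperp (th t) x) <= Omega th t.
Proof.
move=> lt Oe; rewrite leNgt; apply/negP => Ox.
have Om0 : 0 < Omega th t by apply: lt_trans Oe; exact: expR_gt0.
have OE : sup_grad th t = (Omega th t)%:E.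
  by move: Om0; rewrite /Omega; case: (sup_grad th t) => [r| |] //=; rewrite ltxx.
(* The definition of the sup norm distinguishes whether the whole space has positive measure. *)
have muT : (0 < @mu2 R setT)%E.
  apply: (@lt_le_trans _ _ (@mu2 R (`[0%R, 1%R] `*` `[0%R, 1%R])%classic)).
    by rewrite mu2_rectangle ?ler01// subr0 mulr1 lte_fin ltr01.
  apply: le_measure => //; rewrite inE; last exact: measurableT.
  by apply: measurableX; exact: measurable_itv.
have : (sup_grad th t <= (Omega th t)%:E)%E by rewrite OE.
rewrite /sup_grad unlock muT => /ess_supP[N [mN N0 sub]].
have c : {for x, continuous (fun y => enorm (gradperp (th t) y))}.
  apply: (@continuous_comp _ _ _ (gradperp (th t)) (@enorm R)).
    exact: continuous_gradperp.
  exact: continuous_enorm.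
have : nbhs (enorm (gradperp (th t) x)) [set r | Omega th t < r] by exact: lt_nbhsr.
move=> /c /nbhs_ballP[d /= d0 hd].
pose S := (`[x.1 - d / 2, x.1 + d / 2] `*` `[x.2 - d / 2, x.2 + d / 2])%classic.
have SN : S `<=` N.
  move=> y [/= y1 y2]; apply: sub => /=.
  rewrite ger0_norm ?enorm_ge0// lee_fin => h.
  have : Omega th t < enorm (gradperp (th t) y).
    apply: hd; move: y1 y2; rewrite !in_itv /= => /andP[h1 h2] /andP[h3 h4].
    have dd : d / 2 < d by rewrite ltr_pdivrMr// ltr_pMr// ltr1n.
    by split; rewrite /ball /= (le_lt_trans _ dd)// ler_distlC ?h1 ?h3.
  by rewrite ltNge h.
have mS : measurable S by apply: measurableX; exact: measurable_itv.
have : (@mu2 R S <= @mu2 R N)%E by apply: le_measure => //; rewrite inE.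
have -> : @mu2 R N = 0%E by exact: N0.
rewrite /S mu2_rectangle; [|lra|lra].
rewrite lee_fin leNgt => /negP; apply.
by apply: mulr_gt0; lra.
Qed.

Lemma norm_derive_le (f : R * R -> R) x i : `|'D_(ei i) f x| <= enorm (gradperp f x).
Proof.
rewrite -[leLHS]sqrtr_sqr /enorm ler_sqrt ?dot_ge0// /dot /= -!expr2 sqrrN.
by case: i; rewrite /ei; move: ('D_(e1 R) f x) ('D_(e2 R) f x) => a b; rewrite ?lerDl ?lerDr sqr_ge0.
Qed.

Lemma theta_lipschitz t x h i : lifespan Tstar t -> expR 1 < Omega th t -> 0 <= h ->
  `|th t (x + h *: ei i) - th t x| <= Omega th t * h.
Proof.
move=> lt Oe; rewrite le_eqVlt => /orP[/eqP <-|h0].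
  by rewrite scale0r addr0 subrr normr0 mulr0.
have [dth _ _ _] := theta_C1 sol.
have [c _ ->] := mvt_direction x (ei i) (fun z => dth t z lt) h0.
rewrite normrM (gtr0_norm h0) mulrC ler_wpM2r ?(ltW h0)//.
exact: le_trans (norm_derive_le _ _ _) (gradperp_le_Omega _ lt Oe).
Qed.

(** An integrable Lipschitz function is bounded: on the unit square with corner [x], [|theta|] stays
    above [|theta x| - 2 Omega], the 2 counting one step along each axis, and the integral over that
    square is at most the L^1 norm. *)
Lemma theta_bounded t : lifespan Tstar t -> expR 1 < Omega th t ->
  exists B, forall x, `|th t x| <= B.
Proof.
move=> lt Oe; have ith := theta_integrable sol lt.
have Om0 : 0 < Omega th t by apply: lt_trans Oe; exact: expR_gt0.
pose I := \int[m2]_y `|th t y|.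
exists (2 * Omega th t + I) => x; rewrite -lerBlDl.
set c := _ - _.
have [c0|c0] := leP c 0; first by rewrite (le_trans c0)// Rintegral_ge0.
pose S := (`[x.1, x.1 + 1] `*` `[x.2, x.2 + 1])%classic.
have mS : measurable S by apply: measurableX; exact: measurable_itv.
have muS : m2 S = 1%:E.
  have l z : z <= z + 1 :> R by rewrite lerDl.
  rewrite -[LHS]/(@mu2 R S) /S (mu2_rectangle (l _) (l _)).
  by congr EFin; ring.
have intS : (\int[m2]_y (\1_S y)%:E = 1%:E)%E by rewrite integral_indic// setIT; exact: muS.
have iS : m2.-integrable setT (fun y => (\1_S y)%:E).
  apply/integrableP; split; first by apply/measurable_EFinP; exact: measurable_indic.
  under eq_integral do rewrite /= ger0_norm//.
  by rewrite intS ltry.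
have cE : c = \int[m2]_y (c * \1_S y).
  rewrite RintegralZl//.
  have -> : \int[m2]_y \1_S y = 1 by rewrite /Rintegral intS.
  by rewrite mulr1.
rewrite cE; apply: le_Rintegral => //.
- exact: (integrableZl measurableT c iS).
- exact: integrable_norm ith.
move=> y _; rewrite /indic; case: (boolP (y \in S)) => [|_]; last by rewrite mulr0.
rewrite inE => -[/= y1 y2]; rewrite mulr1 /c lerBlDl.
move: y1 y2; rewrite !in_itv /= => /andP[h1 h2] /andP[h3 h4].
pose y' := x + (y.1 - x.1) *: ei false.
have yE : y = y' + (y.2 - x.2) *: ei true.
  rewrite /y' !scale_ei [LHS]surjective_pairing [RHS]surjective_pairing /=.
  by congr (_, _); ring.
have l1 := @theta_lipschitz t x (y.1 - x.1) false lt Oe.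
have l2 := @theta_lipschitz t y' (y.2 - x.2) true lt Oe.
rewrite -yE -/y' !subr_ge0 in l1 l2.
have a1 := l1 h1; have a2 := l2 h3.
have b1 : Omega th t * (y.1 - x.1) <= Omega th t.
  by rewrite ler_piMr ?(ltW Om0)// lerBlDl.
have b2 : Omega th t * (y.2 - x.2) <= Omega th t.
  by rewrite ler_piMr ?(ltW Om0)// lerBlDl.
have -> : th t x = th t y - (th t y - th t y') - (th t y' - th t x) by ring.
rewrite (le_trans (ler_normB _ _))//.
rewrite (le_trans (lerD (ler_normB _ _) (le_trans a1 b1)))//.
by rewrite -addrA addrC lerD2r mulr_natl mulr2n lerD2r (le_trans a2).
Qed.

End Bounds.

(** * A discrete version of [y' <= C y] *)

Section DiscreteGrowth.
Context {R : realType}.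
Variables (P : R -> Prop) (T k c : R) (y : R -> R).
Hypothesis P_le : forall s t, T <= s -> s <= t -> P t -> P s.
Hypothesis k0 : 0 < k.
Hypothesis c0 : 0 < c.
Hypothesis y_ge1 : forall t, T <= t -> P t -> 1 <= y t.
Hypothesis y_incr : forall s t, T <= s -> s <= t -> P t -> y s <= y t.
Hypothesis y_step : forall s t, T <= s -> s < t -> P t -> (t - s) * y t <= c -> y t <= y s + k.

(** All backward steps have the length [c / y t] that is admissible at the final time; monotonicity
    of [y] makes it admissible earlier too. The maximum with [T] stops the walk at the initial
    time. *)
Lemma growth_steps t n : T <= t -> P t ->
  y t - n%:R * k <= y (Num.max T (t - n%:R * (c / y t))).
Proof.
move=> Tt Pt; have y0 : 0 < y t by apply: lt_le_trans (y_ge1 Tt Pt).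
elim: n => [|n IH]; first by rewrite !mul0r !subr0 max_r.
set d := c / y t in IH *; have d0 : 0 < d by rewrite divr_gt0.
set s := Num.max T (t - n%:R * d) in IH *.
set s' := Num.max T (t - n.+1%:R * d).
have Ts' : T <= s' by rewrite le_max lexx.
have Ts : T <= s by rewrite le_max lexx.
have st : s <= t by rewrite ge_max Tt gerBl mulr_ge0// ltW.
have Ps : P s by exact: P_le Pt.
have s's : s - d <= s' /\ s' <= s.
  rewrite /s /s' -natr1 mulrDl mul1r; move: (n%:R * d) => z; split.
    by rewrite lerBlDr ge_max -!lerBlDr !le_max lerBlDr lerDl (ltW d0) /= opprD addrA lexx orbT.
  by rewrite ge_max !le_max lexx /= lerD2l lerN2 lerDl (ltW d0) orbT.
case: s's => s's1 s's2; have ys : y s <= y s' + k.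
  move: s's2; rewrite le_eqVlt => /orP[/eqP ->|s's2].
    by rewrite lerDl ltW.
  apply: y_step => //; apply: (@le_trans _ _ (d * y t)).
    apply: ler_pM; first by rewrite subr_ge0 ltW.
    - by rewrite (le_trans ler01)// y_ge1.
    - by rewrite lerBlDr addrC -lerBlDr.
    - exact: y_incr.
  by rewrite /d divfK// gt_eqF.
by rewrite -natr1 mulrDl mul1r opprD addrA lerBlDr (le_trans IH).
Qed.

(** About [y t / (2 k)] steps back lose at most half of [y t], and together they last at least
    [c / (4 k)], a time independent of [y t]. The threshold [4 k] ensures that after rounding down
    at least [y t / (4 k)] steps remain. *)
Lemma growth_double t : T <= t -> P t ->
  y t <= Num.max (4 * k) (2 * y (Num.max T (t - c / (4 * k)))).
Proof.
move=> Tt Pt; have y0 : 0 < y t by apply: lt_le_trans (y_ge1 Tt Pt).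
rewrite le_max; have [//|ky] := leP (y t) (4 * k); apply/orP; right.
have q0 : 0 <= y t / (2 * k) by rewrite divr_ge0 ?(ltW y0)// mulr_ge0// ltW.
set n := Num.trunc (y t / (2 * k)).
have [n1 n2] : n%:R * k <= y t / 2 /\ y t / (4 * k) <= n%:R.
  have /andP[h1 h2] := Num.Theory.truncn_itv q0; split.
    move: h1; rewrite ler_pdivlMr ?mulr_gt0// -/n; move: (n%:R : R) (y t) => a b h1'.
    by rewrite ler_pdivlMr// -mulrA [k * 2]mulrC.
  move: h2; rewrite -/n -[n.+1%:R]natr1; have : 1 <= y t / (4 * k).
    by rewrite ler_pdivlMr ?mulr_gt0// mul1r ltW.
  have -> : y t / (2 * k) = 2 * (y t / (4 * k)) by field; rewrite gt_eqF.
  by move: (y t / _) (n%:R) => a b; lra.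
have G := growth_steps n Tt Pt.
have mono : y (Num.max T (t - n%:R * (c / y t))) <= y (Num.max T (t - c / (4 * k))).
  apply: y_incr; first by rewrite le_max lexx.
    have tau : c / (4 * k) <= n%:R * (c / y t).
      have -> : c / (4 * k) = y t / (4 * k) * (c / y t) by field; rewrite !gt_eqF.
      by rewrite ler_wpM2r// divr_ge0// ltW.
    by rewrite ge_max !le_max lexx /= lerD2l lerN2 tau orbT.
  apply: P_le Pt; first by rewrite le_max lexx.
  by rewrite ge_max Tt gerBl divr_ge0 ?(ltW c0)// mulr_ge0// ltW.
by move: (le_trans G mono) n1; move: (y (Num.max _ _)) (y t) (n%:R * k) => a b z; lra.
Qed.

Lemma growth_pow n t : T <= t -> P t -> t <= T + n%:R * (c / (4 * k)) ->
  y t <= 2 ^+ n * (4 * k + y T).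
Proof.
set tau := c / (4 * k).
have tau0 : 0 < tau by rewrite divr_gt0// mulr_gt0.
elim: n t => [|n IH] t Tt Pt tn.
  have -> : t = T by apply/eqP; rewrite eq_le Tt andbT; move: tn; rewrite mul0r addr0.
  by rewrite mul1r lerDr mulr_ge0// ltW.
have PT : P T by exact: P_le Pt.
have Z0 : 0 <= y T by rewrite (le_trans ler01)// y_ge1.
apply: (le_trans (growth_double Tt Pt)); rewrite ge_max; apply/andP; split.
  apply: (@le_trans _ _ (1 * (4 * k + y T))); first by rewrite mul1r lerDl.
  by rewrite ler_wpM2r ?exprn_ege1 ?ler1n// addr_ge0// mulr_ge0// ltW.
rewrite exprS -mulrA ler_pM2l//; apply: IH.
- by rewrite le_max lexx.
- by apply: P_le Pt; rewrite ?le_max ?lexx// ge_max Tt gerBl ltW.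
rewrite ge_max lerDl mulr_ge0 ?(ltW tau0)//= lerBlDr.
by apply: (le_trans tn); rewrite -natr1 mulrDl mul1r addrA.
Qed.

Lemma growth_log : P T -> exists A B : R, 0 <= A /\
  forall t, T <= t -> P t -> ln (y t) <= A * t + B.
Proof.
move=> PT; set tau := c / (4 * k); have tau0 : 0 < tau by rewrite divr_gt0// mulr_gt0.
have Z0 : 0 < 4 * k + y T by rewrite addr_gt0 ?mulr_gt0// (lt_le_trans ltr01)// y_ge1.
have l2 : 0 <= ln 2 :> R by rewrite ln_ge0// ler1n.
exists (ln 2 / tau), (ln 2 * (1 - T / tau) + ln (4 * k + y T)); split.
  by rewrite divr_ge0// ltW.
move=> t Tt Pt.
have q0 : 0 <= (t - T) / tau by rewrite divr_ge0 ?subr_ge0// ltW.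
(* One more than the truncation, so that [n] doubling periods starting from [T] reach [t]. *)
set n := (Num.trunc ((t - T) / tau)).+1.
have [n1 n2] : n%:R <= (t - T) / tau + 1 /\ t <= T + n%:R * tau.
  have /andP[h1 h2] := Num.Theory.truncn_itv q0; split.
    by rewrite /n -natr1 lerD2r.
  by rewrite -lerBlDl -ler_pdivrMr// ltW.
have y0 : 0 < y t by apply: lt_le_trans (y_ge1 Tt Pt).
have G := growth_pow Tt Pt n2.
apply: (@le_trans _ _ (ln (2 ^+ n * (4 * k + y T)))).
  by rewrite ler_ln ?posrE// mulr_gt0// exprn_gt0.
rewrite lnM ?posrE ?exprn_gt0// lnXn// -[ln 2 *+ n]mulr_natl.
have -> : ln 2 / tau * t + (ln 2 * (1 - T / tau) + ln (4 * k + y T)) =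
  ((t - T) / tau + 1) * ln 2 + ln (4 * k + y T) by field; rewrite gt_eqF.
by rewrite lerD2r ler_wpM2r.
Qed.

End DiscreteGrowth.

(** * Arcs of level curves *)

Section UnitTangent.
Context {R : realType}.
Notation D1 f := ('D_(e1 R) f).
Notation D2 f := ('D_(e2 R) f).

Lemma is_derive_cast (V : normedModType R) (g : V -> R) (x v : V) (d d' : R) :
  is_derive x v g d -> d = d' -> is_derive x v g d'.
Proof. by move=> h <-. Qed.

Lemma is_derive_outer (q : R * R -> R) (phi : R -> R) (x e : R * R) (dphi : R) :
  differentiable q x -> is_derive (q x) 1 phi dphi ->
  differentiable (phi \o q) x /\ is_derive x e (phi \o q) ('D_e q x * dphi).
Proof.
move=> dq [dp <-]; have dp' : differentiable phi (q x) by apply/derivable1_diffP.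
have dpq : differentiable (phi \o q) x by exact: differentiable_comp.
split; first exact: dpq.
split; first exact: diff_derivable.
rewrite (deriveE _ dpq) (deriveE _ dq) (deriveE _ dp') diff_comp//=.
by rewrite -[X in 'd phi _ X]mulr1 -[_ * 1]/('d q x e *: (1 : R)) linearZ.
Qed.

Lemma is_derive_pair (f1 f2 : R * R -> R) (x e : R * R) (d1 d2 : R) :
  is_derive x e f1 d1 -> is_derive x e f2 d2 ->
  is_derive x e (fun y => (f1 y, f2 y)) (d1, d2).
Proof.
move=> [a1 <-] [a2 <-].
have cv : h^-1 *: ((f1 (h *: e + x), f2 (h *: e + x)) - (f1 x, f2 x)) @[h --> 0^'] -->
    ('D_e f1 x, 'D_e f2 x).
  exact: (@cvg_pair _ _ _ _ _ _ _ _ _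
    (fun h : R => h^-1 *: (f1 (h *: e + x) - f1 x)) _ a1 a2).
by split; [apply/cvg_ex; eexists; exact: cv|exact: cvg_lim].
Qed.

Lemma is_derive_rsqrt (r : R) : 0 < r ->
  is_derive r 1 (fun r => (Num.sqrt r)^-1) (- (2 * r)^-1 * (Num.sqrt r)^-1).
Proof.
move=> r0; have s0 : 0 < Num.sqrt r by rewrite sqrtr_gt0.
have h := is_derive1_sqrt r0.
have h' := is_deriveV (lt0r_neq0 s0) h.
apply: is_derive_eq; rewrite /GRing.scale /=.
rewrite -[X in _ = - (2 * X)^-1 * _](sqr_sqrtr (ltW r0)).
by move: (Num.sqrt r) s0 => z z0; field; rewrite gt_eqF.
Qed.

Variable f : R * R -> R.
Notation w := (gradperp f).
Hypothesis df : forall x, differentiable f x.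
Hypothesis dw : forall x, differentiable w x.
Hypothesis cw1 : forall x, {for x, continuous (D1 w)}.
Hypothesis cw2 : forall x, {for x, continuous (D2 w)}.
Hypothesis div0 : forall x, divergence w x = 0.

Definition sqw (x : R * R) : R := dot (w x) (w x).
Definition rho (x : R * R) : R := (Num.sqrt (sqw x))^-1.
(** The derivative of [ln |w|] in the direction [e]. *)
Definition kap (e x : R * R) : R := dot (w x) ('D_e w x) / sqw x.
Definition dxi (i : bool) (e x : R * R) : R :=
  rho x * (pr i ('D_e w x) - pr i (w x) * kap e x).

Lemma sqw_gt0 x : w x != 0 -> 0 < sqw x.
Proof. by move=> w0; rewrite lt_def dot_ge0 dot_eq0 w0. Qed.

Lemma is_derive_w i (x e : R * R) :
  differentiable (fun y => pr i (w y)) x /\ is_derive x e (fun y => pr i (w y)) (pr i ('D_e w x)).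
Proof.
have h : is_derive x e w ('D_e w x) by apply: derivableP; exact: diff_derivable.
case: i; split; rewrite /pr.
- exact: (@differentiable_comp _ _ _ _ w snd _ (dw x) (differentiable_snd _)).
- exact: is_derive_snd.
- exact: (@differentiable_comp _ _ _ _ w fst _ (dw x) (differentiable_fst _)).
- exact: is_derive_fst.
Qed.

Lemma is_derive_sqw (x e : R * R) :
  differentiable sqw x /\ is_derive x e sqw (2 * dot (w x) ('D_e w x)).
Proof.
have [d1 h1] := is_derive_w false x e; have [d2 h2] := is_derive_w true x e.
have E : sqw = (fun y => pr false (w y)) * (fun y => pr false (w y)) +
    (fun y => pr true (w y)) * (fun y => pr true (w y)) by [].
split; first by rewrite E; apply: differentiableD; apply: differentiableM.
rewrite E; apply: is_derive_cast (is_deriveD (is_deriveM h1 h1) (is_deriveM h2 h2)) _.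
rewrite /dot -[pr false (w x)]/((w x).1) -[pr true (w x)]/((w x).2).
rewrite -[pr false ('D_e w x)]/(('D_e w x).1) -[pr true ('D_e w x)]/(('D_e w x).2).
move: (w x).1 (w x).2 ('D_e w x).1 ('D_e w x).2 => a b c d.
by rewrite /GRing.scale /=; ring.
Qed.

Lemma is_derive_xi i (x e : R * R) : w x != 0 ->
  differentiable (fun y => pr i (unit_tangent f y)) x /\
  is_derive x e (fun y => pr i (unit_tangent f y)) (dxi i e x).
Proof.
move=> w0; have q0 := sqw_gt0 w0.
have [dq hq] := is_derive_sqw x e; have [di hi] := is_derive_w i x e.
have [dr hr] := is_derive_outer e dq (is_derive_rsqrt q0).
have E : (fun y => pr i (unit_tangent f y)) =
    ((fun r => (Num.sqrt r)^-1) \o sqw) * (fun y => pr i (w y)).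
  by apply/funext => y; case: i {di hi}.
split; first by rewrite E; apply: differentiableM.
rewrite E; apply: is_derive_cast (is_deriveM hr hi) _.
rewrite (@derive_val _ _ _ _ _ _ _ hq) /dxi /kap -[(_ \o sqw) x]/(rho x) -/(rho x).
move: (rho x) (dot _ _) (pr i _) (pr i _) (sqw x) q0 => r p a b q q0.
by rewrite /GRing.scale /=; field; rewrite gt_eqF.
Qed.

Lemma derive_xi (x e : R * R) : w x != 0 ->
  'D_e (unit_tangent f) x = (dxi false e x, dxi true e x).
Proof.
move=> w0; have [_ h1] := is_derive_xi false e w0; have [_ h2] := is_derive_xi true e w0.
have h := is_derive_pair h1 h2.
have E : unit_tangent f = fun y => (pr false (unit_tangent f y), pr true (unit_tangent f y)).
  by apply/funext => y; rewrite [LHS]surjective_pairing.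
by rewrite {1}E derive_val.
Qed.

(** Since [w] is divergence free, only the derivative of [1 / |w|] contributes to the divergence of
    [w / |w|], which is therefore minus the derivative of [ln |w|] along xi. *)
Lemma divergence_xi x : w x != 0 ->
  divergence (unit_tangent f) x = - rho x * ((w x).1 * kap (e1 R) x + (w x).2 * kap (e2 R) x).
Proof.
move=> w0; rewrite /divergence.
have [_ h1] := is_derive_xi false (e1 R) w0; have [_ h2] := is_derive_xi true (e2 R) w0.
have -> : 'D_(e1 R) (fun y => (unit_tangent f y).1) x = dxi false (e1 R) x.
  exact: (@derive_val _ _ _ _ _ _ _ h1).
have -> : 'D_(e2 R) (fun y => (unit_tangent f y).2) x = dxi true (e2 R) x.
  exact: (@derive_val _ _ _ _ _ _ _ h2).
have [_ k1] := is_derive_w false x (e1 R); have [_ k2] := is_derive_w true x (e2 R).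
have : pr false ('D_(e1 R) w x) + pr true ('D_(e2 R) w x) = 0.
  rewrite -(@derive_val _ _ _ _ _ _ _ k1) -(@derive_val _ _ _ _ _ _ _ k2); exact: div0.
rewrite /dxi; move: (pr false ('D__ _ _)) (pr true ('D__ _ _)) => a b ab.
have -> : a = - b by apply/eqP; rewrite -addr_eq0 ab.
rewrite -[pr false (w x)]/((w x).1) -[pr true (w x)]/((w x).2).
by move: (rho x) (w x).1 (w x).2 (kap _ _) (kap _ _) => r p q k l; ring.
Qed.

Lemma advect_xi x : w x != 0 ->
  advect (unit_tangent f) (unit_tangent f) x =
  (rho x * ((w x).1 * dxi false (e1 R) x + (w x).2 * dxi false (e2 R) x),
   rho x * ((w x).1 * dxi true (e1 R) x + (w x).2 * dxi true (e2 R) x)).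
Proof.
move=> w0; rewrite /advect !derive_xi// [LHS]surjective_pairing.
have E1 : (unit_tangent f x).1 = rho x * (w x).1 by [].
have E2 : (unit_tangent f x).2 = rho x * (w x).2 by [].
have alg (r p q a b : R) : r * p * a + r * q * b = r * (p * a + q * b) by ring.
by rewrite E1 E2; congr (_, _); exact: alg.
Qed.

Let cw x : {for x, continuous w}. Proof. exact: differentiable_continuous. Qed.

Let cDw e x : e = e1 R \/ e = e2 R -> {for x, continuous ('D_e w)}.
Proof. by case=> ->; [exact: cw1|exact: cw2]. Qed.

Lemma continuous_pr i (h : R * R -> R * R) x : {for x, continuous h} ->
  {for x, continuous (fun y => pr i (h y))}.
Proof.
move=> ch; case: i.
  exact: (@cvg_comp _ _ _ h snd _ _ _ ch (@cvg_snd _ _ _ _ _)).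
exact: (@cvg_comp _ _ _ h fst _ _ _ ch (@cvg_fst _ _ _ _ _)).
Qed.

Lemma continuous_sqw x : {for x, continuous sqw}.
Proof. by apply: differentiable_continuous; have [] := is_derive_sqw x (e1 R). Qed.

Lemma continuous_rho x : w x != 0 -> {for x, continuous rho}.
Proof.
move=> w0; have q0 := sqw_gt0 w0.
have [d _] := is_derive_outer (e1 R) (is_derive_sqw x (e1 R)).1 (is_derive_rsqrt q0).
exact: differentiable_continuous d.
Qed.

Lemma continuous_kap e x : e = e1 R \/ e = e2 R -> w x != 0 -> {for x, continuous (kap e)}.
Proof.
move=> he w0; have q0 := sqw_gt0 w0.
apply: cvgM; last by apply: cvgV; [rewrite gt_eqF|exact: continuous_sqw].
by apply: cvgD; apply: cvgM; [exact: (@continuous_pr false _ _ (@cw x))|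
  exact: (@continuous_pr false _ _ (cDw he))|exact: (@continuous_pr true _ _ (@cw x))|
  exact: (@continuous_pr true _ _ (cDw he))].
Qed.

Lemma continuous_dxi i e x : e = e1 R \/ e = e2 R -> w x != 0 -> {for x, continuous (dxi i e)}.
Proof.
move=> he w0; apply: cvgM; first exact: continuous_rho.
apply: cvgB; first exact: (@continuous_pr i _ _ (cDw he)).
by apply: cvgM; [exact: (@continuous_pr i _ _ (@cw x))|exact: continuous_kap].
Qed.

(** To bound values on the arc by the supremum there, the divergence of xi must be seen to be
    bounded on the arc. This expression, and [adv_formula] for the curvature vector, are visibly
    continuous wherever [w] does not vanish. *)
Definition div_formula (x : R * R) : R :=
  - rho x * ((w x).1 * kap (e1 R) x + (w x).2 * kap (e2 R) x).

Lemma continuous_div_formula x : w x != 0 -> {for x, continuous div_formula}.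
Proof.
move=> w0; apply: cvgM; first by apply: cvgN; exact: continuous_rho.
apply: cvgD; apply: cvgM.
- exact: (@continuous_pr false _ _ (@cw x)).
- by apply: continuous_kap => //; left.
- exact: (@continuous_pr true _ _ (@cw x)).
- by apply: continuous_kap => //; right.
Qed.

Definition adv_formula (i : bool) (x : R * R) : R :=
  rho x * ((w x).1 * dxi i (e1 R) x + (w x).2 * dxi i (e2 R) x).

Lemma continuous_adv_formula i x : w x != 0 -> {for x, continuous (adv_formula i)}.
Proof.
move=> w0; apply: cvgM; first exact: continuous_rho.
apply: cvgD; apply: cvgM.
- exact: (@continuous_pr false _ _ (@cw x)).
- by apply: continuous_dxi => //; left.
- exact: (@continuous_pr true _ _ (@cw x)).
- by apply: continuous_dxi => //; right.
Qed.

End UnitTangent.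

Section ArcLength.
Context {R : realType}.
Notation mu := (@lebesgue_measure R).

Lemma within_interior (V : topologicalType) (F : R -> V) (a b s : R) :
  {within `[a, b], continuous F} -> a < s < b -> {for s, continuous F}.
Proof.
move=> /subspace_continuousP cF /andP[sa sb].
have h : s \in `[a, b] by rewrite in_itv /= !ltW.
move=> A FA; have := cF s h A FA; rewrite /within /=.
by apply: filterS3 (lt_nbhsl sb) (lt_nbhsr sa) => x xb ax; apply; rewrite /= in_itv /= !ltW.
Qed.

Lemma within_of_for (V : topologicalType) (F : R -> V) (a b : R) :
  (forall s, a <= s <= b -> {for s, continuous F}) -> {within `[a, b], continuous F}.
Proof.
by move=> cF; apply: continuous_in_subspaceT => s; rewrite inE /= in_itv; exact: cF.
Qed.

(** Derivatives are asked for inside the interval only: beyond its end points a parametrization need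
    not follow the level curve, and the tangency relation [arc_tangent] is established on the open
    interval. *)
Lemma increment_le (phi psi dphi dpsi : R -> R) (a b x y : R) :
  {within `[a, b], continuous phi} -> {within `[a, b], continuous psi} ->
  (forall s : R, a < s < b -> is_derive s 1 phi (dphi s)) ->
  (forall s : R, a < s < b -> is_derive s 1 psi (dpsi s)) ->
  (forall s, a < s < b -> dphi s <= dpsi s) ->
  a <= x -> x <= y -> y <= b -> phi y - phi x <= psi y - psi x.
Proof.
move=> cp cq dp dq le ax; rewrite le_eqVlt => /predU1P[-> _|xy yb]; first by rewrite !subrr.
have sub : `[x, y] `<=` `[a, b].
  by apply: subset_itv; rewrite !bnd_simp.
have c : {within `[x, y], continuous (psi - phi)}.
  apply: continuous_subspaceW sub _ => s; apply: cvgB; [exact: cq|exact: cp].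
have itv s : s \in `]x, y[ -> a < s < b.
  by rewrite in_itv /= => /andP[xs sy]; rewrite (le_lt_trans ax xs) (lt_le_trans sy yb).
have d s : s \in `]x, y[ -> is_derive s 1 (psi - phi) (dpsi s - dphi s).
  by move=> /itv h; exact: is_deriveB (dq s h) (dp s h).
have [s /itv h] := MVT xy d c.
have : 0 <= (dpsi s - dphi s) * (y - x).
  by apply: mulr_ge0; rewrite subr_ge0; [exact: le|exact: ltW].
move=> h0 E; move: h0; rewrite -E /= -subr_ge0.
by rewrite -[(psi - phi) y]/(psi y - phi y) -[(psi - phi) x]/(psi x - phi x) => h0; lra.
Qed.

Lemma abs_increment_le (phi psi dphi dpsi : R -> R) (a b x y : R) :
  {within `[a, b], continuous phi} -> {within `[a, b], continuous psi} ->
  (forall s : R, a < s < b -> is_derive s 1 phi (dphi s)) ->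
  (forall s : R, a < s < b -> is_derive s 1 psi (dpsi s)) ->
  (forall s, a < s < b -> `|dphi s| <= dpsi s) ->
  a <= x -> x <= y -> y <= b -> `|phi y - phi x| <= psi y - psi x.
Proof.
move=> cp cq dp dq le ax xy yb; rewrite ler_norml; apply/andP; split; last first.
  apply: (increment_le cp cq dp dq) => // s /le; exact: le_trans (ler_norm _).
have cp' : {within `[a, b], continuous (- phi)} by move=> s; apply: cvgN; exact: cp.
have dp' s : a < s < b -> is_derive s 1 (- phi) (- dphi s).
  by move=> h; exact: is_deriveN (dp s h).
rewrite lerNl; have := increment_le cp' cq dp' dq.
move=> /(_ x y _ ax xy yb); rewrite opprB.
rewrite -[(- phi) y]/(- phi y) -[(- phi) x]/(- phi x) opprK addrC; apply=> s /le.
by rewrite -normrN; exact: le_trans (ler_norm _).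
Qed.

Lemma arc_length_primitive (g : R -> R * R) :
  {within `[0, 1], continuous (derive1 g)} ->
  exists S : R -> R, [/\ S 0 = 0, S 1 = arc_length g, {within `[0, 1], continuous S},
    forall s : R, 0 < s < 1 -> is_derive s 1 S (enorm (derive1 g s)) &
    forall x y, 0 <= x -> x <= y -> y <= 1 -> S x <= S y].
Proof.
move=> cg; pose spd s := enorm (derive1 g s).
have cs : {within `[0, 1], continuous spd}.
  move=> s; apply: (@continuous_comp _ _ _ _ (@enorm R)); [exact: cg|exact: continuous_enorm].
have si : mu.-integrable `[0, 1] (EFin \o spd).
  exact: (continuous_compact_integrable (@segment_compact _ 0 1) cs).
pose S x := parameterized_integral mu 0 x spd.
have cS : {within `[0, 1], continuous S}.
  exact: (@parameterized_integral_continuous _ 0 1 spd ler01 si).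
have dS (s : R) : 0 < s < 1 -> is_derive s 1 S (spd s); last first.
  exists S; split => //; first by rewrite /S /parameterized_integral set_itv1 Rintegral_set1.
  have c0 : {within `[0, 1], continuous (cst (0 : R) : R -> R)}.
    by apply: continuous_subspaceT => s; exact: cvg_cst.
  have d0 (s : R) : 0 < s < 1 -> is_derive s 1 (cst (0 : R) : R -> R) 0.
    by move=> _; exact: is_derive_cst.
  move=> x y x0 xy y1; have := increment_le c0 cS d0 dS (fun s _ => enorm_ge0 _) x0 xy y1.
  by rewrite /= subrr subr_ge0.
move=> s01; have [d e] := continuous_FTC1_closed (andP s01).2 si (andP s01).1 (within_interior cs s01).
by split; [exact: d|rewrite -derive1E; exact: e].
Qed.

Lemma le_max_on (F : R * R -> R) (g : R -> R * R) (s : R) :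
  {within `[0, 1], continuous (F \o g)} -> 0 <= s <= 1 ->
  F (g s) <= max_on (curve_image g) F.
Proof.
move=> cF s01; have [c c01 hc] := EVT_max ler01 cF.
apply: sup_upper_bound; last by exists (g s) => //; exists s.
split; first by exists (F (g s)), (g s) => //; exists s.
by exists (F (g c)) => _ [_ [t t01 <-] <-]; exact: hc.
Qed.

Lemma max_on_le (F : R * R -> R) (g : R -> R * R) (b : R) :
  (forall s, 0 <= s <= 1 -> F (g s) <= b) -> max_on (curve_image g) F <= b.
Proof.
move=> h; apply: sup_le_ub.
  by exists (F (g 0)), (g 0) => //; exists 0 => //; rewrite /= in_itv /= lexx ler01.
by move=> _ [_ [t t01 <-] <-]; apply: h; move: t01; rewrite /= in_itv.
Qed.

Lemma positive_of_neq0 (q : R -> R) (a b : R) : {within `[a, b], continuous q} ->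
  (forall s, a <= s <= b -> q s != 0) -> 0 < q a -> forall s, a <= s <= b -> 0 < q s.
Proof.
move=> cq q0 qa s /andP[sa sb]; rewrite ltNge; apply/negP => qs.
have c : {within `[a, s], continuous q}.
  by apply: continuous_subspaceW cq; apply: subset_itvl; rewrite bnd_simp.
have [|z] := IVT sa c (v := 0); first by rewrite ge_min qs orbT le_max ltW.
rewrite in_itv /= => /andP[az zs] z0.
by have := q0 z; rewrite az (le_trans zs sb) z0 eqxx => /(_ isT).
Qed.

(** A continuous derivative without zeros keeps its sign, so the increment suffers no
    cancellation. *)
Lemma abs_increment_ge (phi psi dphi dpsi : R -> R) (a b : R) : a <= b ->
  {within `[a, b], continuous dphi} ->
  (forall s : R, a <= s <= b -> is_derive s 1 phi (dphi s)) ->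
  (forall s : R, a <= s <= b -> is_derive s 1 psi (dpsi s)) ->
  (forall s, a <= s <= b -> 0 < dpsi s /\ dpsi s <= `|dphi s|) ->
  psi b - psi a <= `|phi b - phi a|.
Proof.
move=> ab; have aab : a <= a <= b by rewrite lexx.
wlog pa : phi dphi / 0 < dphi a.
  move=> H cd dp dq le; have [d0 dle] := le a aab.
  have [pa|pa] := ltP 0 (dphi a); first exact: (H phi dphi).
  have pa' : dphi a < 0.
    by rewrite lt_neqAle pa andbT -normr_gt0; exact: lt_le_trans dle.
  have -> : `|phi b - phi a| = `|(- phi) b - (- phi) a|.
    by rewrite -[(- phi) b]/(- phi b) -[(- phi) a]/(- phi a) -opprD normrN.
  apply: (H (- phi) (- dphi) _ _ _ dq).
  - by rewrite -[(- dphi) a]/(- dphi a) oppr_gt0.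
  - by move=> s; apply: cvgN; exact: cd.
  - by move=> s h; exact: is_deriveN (dp s h).
  - by move=> s /le; rewrite -[(- dphi) s]/(- dphi s) normrN.
move=> cd dp dq le.
have pos := positive_of_neq0 cd _ pa.
have cont (F dF : R -> R) : (forall s : R, a <= s <= b -> is_derive s 1 F (dF s)) ->
    {within `[a, b], continuous F}.
  by move=> h; apply: within_of_for => s /h; exact: is_derive1_continuous.
have in_oo (s : R) : a < s < b -> a <= s <= b by move=> /andP[h1 h2]; rewrite !ltW.
apply: le_trans (ler_norm _).
apply: (increment_le (cont _ _ dq) (cont _ _ dp) (fun s h => dq s (in_oo s h))
  (fun s h => dp s (in_oo s h)) _ (lexx a) ab (lexx b)) => s /in_oo h.
have [_ h2] := le s h; apply: le_trans h2 _; rewrite ger0_norm// ltW// pos// => z hz.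
by rewrite -normr_gt0; have [] := le z hz; exact: lt_le_trans.
Qed.

End ArcLength.

Section ArcChord.
Context {R : realType}.

Lemma enormZ (a : R) (v : R * R) : enorm (a *: v) = `|a| * enorm v.
Proof.
rewrite /enorm -sqrtr_sqr -sqrtrM ?sqr_ge0//; congr (Num.sqrt _).
by rewrite /dot -[(a *: v).1]/(a * v.1) -[(a *: v).2]/(a * v.2); ring.
Qed.

Lemma dot_le_enorm (v z : R * R) : `|dot v z| <= enorm v * enorm z.
Proof.
rewrite /enorm -sqrtrM ?dot_ge0// -sqrtr_sqr ler_sqrt; last by rewrite mulr_ge0// dot_ge0.
by rewrite /dot; have := sqr_ge0 (v.1 * z.2 - v.2 * z.1); nra.
Qed.

Lemma continuous_dotl (nu v : R * R) : {for v, continuous (fun v => dot v nu)}.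
Proof.
apply: cvgD; (apply: cvgM; last exact: cvg_cst).
  exact: (@cvg_fst _ _ _ _ _).
exact: (@cvg_snd _ _ _ _ _).
Qed.

Lemma abs_pr_le_enorm i (v : R * R) : `|pr i v| <= enorm v.
Proof.
rewrite /enorm -sqrtr_sqr ler_sqrt ?dot_ge0// /dot /pr.
by have := sqr_ge0 v.1; have := sqr_ge0 v.2; case: i; nra.
Qed.

Lemma parallel_of_orthogonal (p w : R * R) : dot w w != 0 ->
  p.1 * w.2 - p.2 * w.1 = 0 -> p = (dot p w / dot w w) *: w.
Proof.
case: p => p q; case: w => a b; rewrite /dot /= => w0 h.
have alg (x c n d : R) : d != 0 -> x * d = n * c -> x = n / d * c.
  by move=> d0 e; apply: (mulIf d0); rewrite e; field.
congr (_, _); apply: alg w0 _; apply/eqP; rewrite -subr_eq0 /=.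
  have -> : p * (a * a + b * b) - (p * a + q * b) * a = b * (p * b - q * a) by ring.
  by rewrite h mulr0.
have -> : q * (a * a + b * b) - (p * a + q * b) * b = - a * (p * b - q * a) by ring.
by rewrite h mulr0.
Qed.

(** The projection is at most [|v.1| + |v.2|], so one coordinate carries half of it. Coordinates are
    preferred to the direction [nu] because the flow estimates are stated coordinatewise. *)
Lemma norm_half_projection (v nu : R * R) (c : R) : `|nu.1| <= 1 -> `|nu.2| <= 1 ->
  2 * c <= `|dot v nu| -> exists i, c <= `|pr i v|.
Proof.
move=> n1 n2 h; have [h1|h1] := leP c `|v.1|; first by exists false.
have [h2|h2] := leP c `|v.2|; first by exists true.
have : `|dot v nu| <= `|v.1| + `|v.2|.
  rewrite (le_trans (ler_normD _ _))// !normrM.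
  by apply: lerD; rewrite ler_piMr.
by move=> h3; exfalso; lra.
Qed.

Let arc_ln_identity (l n q a b p r : R) : n != 0 ->
  l * (p * (2 * a * q^-1) + r * (2 * b * q^-1)) =
  - 2 * (l * n * (- n^-1 * (p * (a / q) + r * (b / q)))).
Proof.
move=> n0; transitivity (2 * l * (n * n^-1) * (p * (a / q) + r * (b / q))).
  by rewrite mulfV//; ring.
by ring.
Qed.

Let arc_projection_identity (l n a b p q : R) : 0 < n ->
  l * a * p + l * b * q = l * n * (n^-1 * a * p + n^-1 * b * q).
Proof.
move=> n0; transitivity (l * (n * n^-1) * (a * p + b * q)); last by ring.
by rewrite mulfV ?gt_eqF//; ring.
Qed.

Variable f : R * R -> R.
Notation w := (gradperp f).
Notation D1 f := ('D_(e1 R) f).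
Notation D2 f := ('D_(e2 R) f).
Hypothesis df : forall x, differentiable f x.
Hypothesis dw : forall x, differentiable w x.
Hypothesis cw1 : forall x, {for x, continuous (D1 w)}.
Hypothesis cw2 : forall x, {for x, continuous (D2 w)}.
Hypothesis div0 : forall x, divergence w x = 0.
Variable g : R -> R * R.
Hypothesis seg : level_segment f g.
Notation g' := (derive1 g).

(** The factor [lam] for which [g' = lam w], obtained by projecting [g'] on [w]. *)
Definition speed_ratio (s : R) : R := dot (g' s) (w (g s)) / sqw f (g s).
Notation lam := speed_ratio.

Lemma arc_gradperp_neq0 s : 0 <= s <= 1 -> w (g s) != 0.
Proof. by move=> s01; case: seg => _ _ _ _; apply; exists s. Qed.

Lemma is_derive_arc (s : R) : 0 <= s <= 1 -> is_derive s 1 g (g' s).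
Proof.
move=> s01; case: seg => _ /(_ s) h _ _ _; have [d _] := h s01.
by rewrite derive1E; exact: derivableP.
Qed.

Lemma continuous_arc s : 0 <= s <= 1 -> {for s, continuous g}.
Proof.
move=> s01; apply: differentiable_continuous; apply/derivable1_diffP.
by have [] := is_derive_arc s01.
Qed.

Lemma arc_tangent s : 0 < s < 1 -> g' s = lam s *: w (g s).
Proof.
move=> /andP[s0 s1]; have s01 : 0 <= s <= 1 by rewrite !ltW.
apply: parallel_of_orthogonal; first by rewrite dot_eq0 arc_gradperp_neq0.
have [_ _ _ [c hc] _] := seg.
have h := is_derive_chain (df (g s)) (is_derive_arc s01).
have n : \forall z \near s, (f \o g) z = cst c z.
  apply: filterS2 (lt_nbhsl s1) (lt_nbhsr s0) => z z1 z0.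
  by apply: hc; exists z => //=; rewrite in_itv /= !ltW.
have := @derive_val _ _ _ _ _ _ _ h; rewrite (near_eq_derive _ n) derive_cst => {}h.
rewrite -[(w (g s)).1]/(- 'D_(e2 R) f (g s)) -[(w (g s)).2]/('D_(e1 R) f (g s)).
by rewrite h; ring.
Qed.

Lemma arc_speed s : 0 < s < 1 -> enorm (g' s) = `|lam s| * enorm (w (g s)).
Proof. by move=> /arc_tangent ->; rewrite enormZ. Qed.

Lemma is_derive_along (q : R * R -> R) (s d1 d2 : R) : 0 < s < 1 -> differentiable q (g s) ->
  is_derive (g s) (e1 R) q d1 -> is_derive (g s) (e2 R) q d2 ->
  is_derive s 1 (q \o g) (lam s * ((w (g s)).1 * d1 + (w (g s)).2 * d2)).
Proof.
move=> s01 dq h1 h2; have /andP[s0 s1] := s01.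
have s01' : 0 <= s <= 1 by rewrite !ltW.
apply: is_derive_cast (is_derive_chain dq (is_derive_arc s01')) _.
rewrite (@derive_val _ _ _ _ _ _ _ h1) (@derive_val _ _ _ _ _ _ _ h2) arc_tangent//.
rewrite -[(lam s *: _).1]/(lam s * (w (g s)).1) -[(lam s *: _).2]/(lam s * (w (g s)).2).
by ring.
Qed.

Lemma is_derive_arc_xi i (s : R) : 0 < s < 1 ->
  is_derive s 1 (fun s => pr i (unit_tangent f (g s)))
    (lam s * enorm (w (g s)) * adv_formula f i (g s)).
Proof.
move=> s01; have /andP[s0 s1] := s01.
have w0 : w (g s) != 0 by apply: arc_gradperp_neq0; rewrite !ltW.
have [d h1] := is_derive_xi dw i (e1 R) w0; have [_ h2] := is_derive_xi dw i (e2 R) w0.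
apply: is_derive_cast (is_derive_along s01 d h1 h2) _.
rewrite /adv_formula mulrA -[lam s * _ * _ in RHS]mulrA /rho -/(enorm _) mulfV ?mulr1//.
by rewrite sqrtr_eq0 -ltNge sqw_gt0.
Qed.

Lemma is_derive_arc_ln (s : R) : 0 < s < 1 ->
  is_derive s 1 (fun s => ln (sqw f (g s)))
    (- 2 * (lam s * enorm (w (g s)) * div_formula f (g s))).
Proof.
move=> s01; have /andP[s0 s1] := s01.
have w0 : w (g s) != 0 by apply: arc_gradperp_neq0; rewrite !ltW.
have q0 := sqw_gt0 w0.
have [dq h1] := is_derive_sqw dw (g s) (e1 R); have [_ h2] := is_derive_sqw dw (g s) (e2 R).
have [d k1] := is_derive_outer (e1 R) dq (is_derive1_ln q0).
have [_ k2] := is_derive_outer (e2 R) dq (is_derive1_ln q0).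
apply: is_derive_cast (is_derive_along s01 d k1 k2) _.
rewrite (@derive_val _ _ _ _ _ _ _ h1) (@derive_val _ _ _ _ _ _ _ h2).
have n0 : enorm (w (g s)) != 0 by rewrite sqrtr_eq0 -ltNge sqw_gt0.
rewrite /div_formula /rho -/(enorm _) /kap.
exact: arc_ln_identity.
Qed.

Notation L := (arc_length g).
Notation M := (max_on (curve_image g) (fun x => `|divergence (unit_tangent f) x|)).
Notation K := (max_on (curve_image g)
  (fun x => enorm (advect (unit_tangent f) (unit_tangent f) x))).

Let arc_comp (F : R * R -> R) (G : R * R -> R) :
  (forall x, w x != 0 -> F x = G x) -> (forall x, w x != 0 -> {for x, continuous G}) ->
  {within `[0, 1], continuous (F \o g)}.
Proof.
move=> FG cG; apply: (@subspace_eq_continuous _ _ _ (G \o g)).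
  by move=> s; rewrite inE /= => s01; rewrite -FG//; exact: arc_gradperp_neq0.
apply: within_of_for => s s01.
by apply: continuous_comp; [exact: continuous_arc|exact/cG/arc_gradperp_neq0].
Qed.

Lemma div_formula_le s : 0 <= s <= 1 -> `|div_formula f (g s)| <= M.
Proof.
move=> s01; rewrite -[div_formula _ _]divergence_xi//; last exact: arc_gradperp_neq0.
apply: (@le_max_on _ (fun x => `|divergence (unit_tangent f) x|)) => //.
apply: (arc_comp (G := fun x => `|div_formula f x|)) => x x0.
  by rewrite divergence_xi.
by apply: cvg_norm; exact: continuous_div_formula.
Qed.

Lemma adv_formula_le s : 0 <= s <= 1 ->
  enorm (adv_formula f false (g s), adv_formula f true (g s)) <= K.
Proof.
move=> s01; rewrite -[(_, _)]advect_xi//; last exact: arc_gradperp_neq0.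
apply: (@le_max_on _ (fun x => enorm (advect (unit_tangent f) (unit_tangent f) x))) => //.
apply: (arc_comp (G := fun x => enorm (adv_formula f false x, adv_formula f true x))) => x x0.
  by rewrite advect_xi.
apply: (@continuous_comp _ _ _ (fun x => (adv_formula f false x, adv_formula f true x)) (@enorm R));
  last exact: continuous_enorm.
exact: (@cvg_pair _ _ _ _ _ _ _ _ _ (adv_formula f false) _
  (@continuous_adv_formula _ _ dw cw1 cw2 false _ x0)
  (@continuous_adv_formula _ _ dw cw1 cw2 true _ x0)).
Qed.

(** Along the arc [ln |w|^2] changes at rate at most [2 M |g'|], hence by at most [2 M L <= 2 C0] in
    total; the square root removes the 2. *)
Lemma arc_gradperp_comparable C0 s : M * L <= C0 -> 0 <= s <= 1 ->
  max_on (curve_image g) (fun x => enorm (w x)) <= expR C0 * enorm (w (g s)).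
Proof.
move=> MLC s01; have [_ _ cg' _ _] := seg.
have [S [S0 S1 cS dS mS]] := arc_length_primitive cg'.
have M0 : 0 <= M by apply: le_trans (div_formula_le s01); exact: normr_ge0.
pose phi z := ln (sqw f (g z)).
have cphi : {within `[0, 1], continuous phi}.
  apply: within_of_for => z z01; have q0 := sqw_gt0 (arc_gradperp_neq0 z01).
  have cq : {for z, continuous (sqw f \o g)}.
    by apply: continuous_comp; [exact: continuous_arc|exact: continuous_sqw].
  exact: (@continuous_comp _ _ _ (sqw f \o g) (@ln R) z cq (continuous_ln q0)).
have cpsi : {within `[0, 1], continuous (2 * M *: S)}.
  by move=> z; apply: cvgZl_tmp; exact: cS.
have dpsi (z : R) : 0 < z < 1 -> is_derive z 1 (2 * M *: S) (2 * M * enorm (g' z)).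
  by move=> z01; have h := dS z z01; exact: is_deriveZ.
have le z : 0 < z < 1 ->
    `|- 2 * (lam z * enorm (w (g z)) * div_formula f (g z))| <= 2 * M * enorm (g' z).
  move=> z01; rewrite arc_speed//; have z01' : 0 <= z <= 1 by case/andP: z01 => ? ?; rewrite !ltW.
  move: (div_formula_le z01') (enorm_ge0 (w (g z))) M0.
  move: (div_formula f (g z)) (enorm (w (g z))) (lam z) M => d n l m dm n0 m0.
  rewrite !normrM normrN (ger0_norm n0) (ger0_norm (ler0n _ 2)) -[2 * m * _]mulrA ler_pM2l//.
  by rewrite mulrC ler_wpM2r// mulr_ge0.
have incr x y : 0 <= x -> x <= y -> y <= 1 -> `|phi y - phi x| <= 2 * C0.
  move=> x0 xy y1; apply: le_trans (abs_increment_le cphi cpsi is_derive_arc_ln dpsi le x0 xy y1) _.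
  rewrite -[(_ *: S) y]/(2 * M * S y) -[(_ *: S) x]/(2 * M * S x) -mulrBr -mulrA ler_pM2l//.
  apply: le_trans MLC; rewrite ler_wpM2l// -S1 -[S 1]subr0 -S0.
  by apply: lerB; apply: mS => //; exact: le_trans xy y1 || exact: le_trans x0 xy.
apply: max_on_le => z z01; have q0 := sqw_gt0 (arc_gradperp_neq0 z01).
have r0 := sqw_gt0 (arc_gradperp_neq0 s01).
have h : phi z <= phi s + 2 * C0.
  have /andP[z0 z1] := z01; have /andP[s0 s1] := s01.
  have [zs|/ltW sz] := leP z s; [have := incr z s z0 zs s1|have := incr s z s0 sz z1];
    by rewrite ler_norml => /andP[a b]; move: (phi z) (phi s) a b => a b; lra.
have h2 : sqw f (g z) <= expR C0 ^+ 2 * sqw f (g s).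
  move: h; rewrite /phi -ler_expR expRD !lnK// ?posrE// mulrC => h.
  apply: le_trans h _; suff -> : expR (2 * C0) = expR C0 ^+ 2 by [].
  by rewrite -expRM_natl.
rewrite /enorm -(ger0_norm (ltW (expR_gt0 C0))) -sqrtr_sqr -sqrtrM ?sqr_ge0// ler_sqrt//.
by rewrite mulr_ge0// ?sqr_ge0// ltW.
Qed.

Lemma enorm_unit_tangent x : w x != 0 -> dot (unit_tangent f x) (unit_tangent f x) = 1.
Proof.
move=> x0; have := enormZ (enorm (w x))^-1 (w x); rewrite -/(unit_tangent f x) => h.
have n0 : 0 < enorm (w x) by rewrite sqrtr_gt0 sqw_gt0.
by rewrite -enorm_sqr h ger0_norm ?invr_ge0 ?ltW// mulVf ?expr1n// gt_eqF.
Qed.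

Lemma is_derive_dot (h : R -> R * R) (nu dh : R * R) (s : R) :
  (forall i, is_derive s 1 (fun z => pr i (h z)) (pr i dh)) ->
  is_derive s 1 (fun z => dot (h z) nu) (dot dh nu).
Proof.
move=> H; have h1 := H false; have h2 := H true.
have E : (fun z => dot (h z) nu) =
    nu.1 *: (fun z => pr false (h z)) + nu.2 *: (fun z => pr true (h z)).
  by apply/funext => z; rewrite /dot (mulrC (h z).1) (mulrC (h z).2).
rewrite E; apply: is_derive_cast (is_deriveD (is_deriveZ _ h1) (is_deriveZ _ h2)) _.
by rewrite /dot (mulrC dh.1) (mulrC dh.2).
Qed.

(** From [2 C0 l <= L] and [K L <= C0] follows [K l <= 1/2]: over an arc of length [l] the unit
    tangent keeps a component at least [1/2] along its initial value [nu]. The chord then projects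
    on [nu] with length at least [l / 2], and one of its coordinates is at least [l / 4]. *)
Lemma arc_chord C0 l : M * L <= C0 -> K * L <= C0 -> 0 < C0 -> 0 < l -> 2 * l < L ->
  2 * C0 * l <= L ->
  exists s0 s1 (S : R -> R), [/\ 0 < s0, s0 < s1, s1 < 1,
    forall s : R, 0 < s < 1 -> is_derive s 1 S (enorm (g' s)) & S s1 - S s0 = l] /\
    (forall i, `|pr i (g s1 - g s0)| <= l) /\ exists i, l / 4 <= `|pr i (g s1 - g s0)|.
Proof.
move=> MLC KLC C00 l0 lL ClL; have [_ hg cg' _ _] := seg.
have [S [S0 S1 cS dS mS]] := arc_length_primitive cg'.
have ivt v : 0 < v -> v < L -> exists2 s, 0 < s < 1 & S s = v.
  move=> v0 vL; have [|s] := IVT ler01 cS (v := v).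
    by rewrite S0 S1 ge_min le_max (ltW v0) (ltW vL) orbT.
  rewrite in_itv /= => /andP[s0 s1] sv; exists s => //; rewrite !lt_neqAle s0 s1 !andbT.
  apply/andP; split; apply/eqP => e.
    by move: v0; rewrite -sv -e S0 ltxx.
  by move: vL; rewrite -sv e S1 ltxx.
have lL' : l < L by lra.
(* The sub-arc runs between arc lengths [l] and [2 l], so that both its ends are interior
   parameters. *)
have [s0 s001 Ss0] := ivt l l0 lL'; have [s1 s101 Ss1] := ivt (2 * l) (mulr_gt0 (ltr0n _ 2) l0) lL.
have /andP[s00 s01] := s001; have /andP[s10 s11] := s101.
have s0s1 : s0 < s1.
  rewrite ltNge; apply/negP => s1s0; have := mS s1 s0 (ltW s10) s1s0 (ltW s01).
  by rewrite Ss0 Ss1 => h; lra.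
have SS : S s1 - S s0 = l by rewrite Ss0 Ss1; ring.
have in01 s : s0 <= s <= s1 -> 0 < s < 1.
  by move=> /andP[a b]; rewrite (lt_le_trans s00 a) (le_lt_trans b s11).
have w01 (s : R) : 0 < s < 1 -> 0 <= s <= 1 by move=> /andP[a b]; rewrite !ltW.
have dg i (s : R) : 0 < s < 1 -> is_derive s 1 (fun z => pr i (g z)) (pr i (g' s)).
  move=> /w01 /is_derive_arc h; case: i; [exact: is_derive_snd|exact: is_derive_fst].
have cpr (i : bool) : {within `[0, 1], continuous (fun z => pr i (g z))}.
  apply: within_of_for => s /continuous_arc h.
  case: i; [exact: (@cvg_comp _ _ _ g snd _ _ _ h (@cvg_snd _ _ _ _ _))|
    exact: (@cvg_comp _ _ _ g fst _ _ _ h (@cvg_fst _ _ _ _ _))].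
have chord_le i : `|pr i (g s1 - g s0)| <= l.
  have -> : pr i (g s1 - g s0) = pr i (g s1) - pr i (g s0) by case: i.
  rewrite -SS; apply: (abs_increment_le (cpr i) cS (dg i) dS) (ltW s00) (ltW s0s1) (ltW s11).
  by move=> s _; exact: abs_pr_le_enorm.
exists s0, s1, S; split; first by split.
split; first exact: chord_le.
have w0 : w (g s0) != 0 by exact/arc_gradperp_neq0/w01.
pose nu := unit_tangent f (g s0).
have nu1 : dot nu nu = 1 by exact: enorm_unit_tangent.
have nu1' : enorm nu = 1 by rewrite /enorm nu1 sqrtr1.
pose P s := dot (unit_tangent f (g s)) nu.
pose adv s := (adv_formula f false (g s), adv_formula f true (g s)).
have dP (s : R) : s0 <= s <= s1 ->
    is_derive s 1 P (dot (lam s * enorm (w (g s)) *: adv s) nu).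
  move=> /in01 s01'; apply: is_derive_dot => i; have := is_derive_arc_xi i s01'.
  by case: i.
have K0 : 0 <= K.
  have h := adv_formula_le (w01 s0 s001); exact: le_trans (enorm_ge0 _) h.
have Kl : K * l <= 1 / 2.
  rewrite -(ler_pM2l C00); have : K * (2 * C0 * l) <= C0.
    by apply: le_trans KLC; rewrite ler_wpM2l.
  by move: (K) => k h; lra.
have Phalf s : s0 <= s <= s1 -> 1 / 2 <= P s.
  move=> /andP[s0s ss1].
  have lim z : s0 <= z <= s1 -> `|dot (lam z * enorm (w (g z)) *: adv z) nu| <= K * enorm (g' z).
    move=> /in01 z01; apply: le_trans (dot_le_enorm _ _) _.
    rewrite nu1' mulr1 enormZ normrM (ger0_norm (enorm_ge0 _)) -arc_speed// mulrC.
    by rewrite ler_wpM2r ?enorm_ge0//; exact/adv_formula_le/w01.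
  have oo (z : R) : s0 < z < s1 -> s0 <= z <= s1 by move=> /andP[a b]; rewrite !ltW.
  have cP : {within `[s0, s1], continuous P}.
    by apply: within_of_for => z /dP; exact: is_derive1_continuous.
  have dKS (z : R) : s0 < z < s1 -> is_derive z 1 (K *: S) (K * enorm (g' z)).
    by move=> /oo /in01 /dS h; exact: is_deriveZ.
  have cKS : {within `[s0, s1], continuous (K *: S)}.
    apply: within_of_for => z /in01 /dS /is_derive1_continuous h.
    exact: (cvgZl_tmp (k := K) h).
  have := abs_increment_le cP cKS (fun z h => dP z (oo z h)) dKS
    (fun z h => lim z (oo z h)) (lexx s0) s0s ss1.
  rewrite -[(_ *: S) s]/(K * S s) -[(_ *: S) s0]/(K * S s0) -mulrBr -[P s0]/(dot nu nu) nu1.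
  have : K * (S s - S s0) <= K * l.
    rewrite ler_wpM2l// -SS lerB// mS//; last exact: ltW.
    exact: le_trans (ltW s00) s0s.
  rewrite ler_distlC; move: (K * l) Kl (K * _) (P s) => a h1 b p h2 /andP[h3 h4]; lra.
have cq : {within `[s0, s1], continuous (fun s => dot (g' s) nu)}.
  apply: within_of_for => s /in01 s01'; have c := within_interior cg' s01'.
  exact: (@continuous_comp _ _ _ g' (fun v => dot v nu) s c (@continuous_dotl _ _)).
have dQ (s : R) : s0 <= s <= s1 -> is_derive s 1 (fun z => dot (g z) nu) (dot (g' s) nu).
  by move=> /in01 s01'; apply: is_derive_dot => i; exact: dg.
have dS2 (s : R) : s0 <= s <= s1 -> is_derive s 1 (2^-1 *: S) (2^-1 * enorm (g' s)).
  by move=> /in01 /dS h; exact: is_deriveZ.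
have key : l / 2 <= `|dot (g s1) nu - dot (g s0) nu|.
  have := abs_increment_ge (ltW s0s1) cq dQ dS2.
  rewrite -[(_ *: S) s1]/(2^-1 * S s1) -[(_ *: S) s0]/(2^-1 * S s0) -mulrBr SS mulrC; apply.
  move=> s ss; have s01' := in01 s ss; split.
    rewrite mulr_gt0 ?invr_gt0// sqrtr_gt0 lt_neqAle dot_ge0 eq_sym dot_eq0 andbT.
    by have [] := hg s; first by rewrite in_itv /= w01.
  have n0 : 0 < enorm (w (g s)) by rewrite sqrtr_gt0; exact/sqw_gt0/arc_gradperp_neq0/w01.
  have -> : dot (g' s) nu = lam s * enorm (w (g s)) * P s.
    have x1 : (unit_tangent f (g s)).1 = (enorm (w (g s)))^-1 * (w (g s)).1 by [].
    have x2 : (unit_tangent f (g s)).2 = (enorm (w (g s)))^-1 * (w (g s)).2 by [].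
    rewrite arc_tangent// /P /dot x1 x2.
    rewrite -[(lam s *: _).1]/(lam s * (w (g s)).1) -[(lam s *: _).2]/(lam s * (w (g s)).2).
    exact: arc_projection_identity.
  rewrite 2!normrM (ger0_norm (enorm_ge0 _)) -arc_speed// mulrC ler_wpM2l ?enorm_ge0//.
  by rewrite -div1r; apply: le_trans (Phalf s ss) (ler_norm _).
apply: (norm_half_projection (nu := nu)).
- by have := abs_pr_le_enorm false nu; rewrite nu1'.
- by have := abs_pr_le_enorm true nu; rewrite nu1'.
have -> : 2 * (l / 4) = l / 2 by field.
suff -> : dot (g s1 - g s0) nu = dot (g s1) nu - dot (g s0) nu by [].
rewrite /dot -[(g s1 - g s0).1]/((g s1).1 - (g s0).1) -[(g s1 - g s0).2]/((g s1).2 - (g s0).2).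
by ring.
Qed.

End ArcChord.

(** * Growth of Omega *)

Section Drift.
Context {R : realType}.
Variables (Tstar : \bar R) (th : R -> R * R -> R) (X : R * R -> R -> R -> R * R).
Hypothesis sol : classical_solution Tstar th.
Hypothesis traj : trajectories Tstar th X.
Notation Om t := (Omega th t).

Let trap_identity (l V y1 y2 v1 v2 : R) : 0 <= l -> `|y1| <= l / 8 -> `|y2| <= l / 8 ->
  `|v1| <= V -> `|v2| <= V ->
  - (2 * y1 * v1 + 2 * y2 * v2) <= 0 * (y1 ^+ 2 + y2 ^+ 2) + l * V / 2.
Proof.
move=> l0 h1 h2 k1 k2.
have b (y v : R) : `|y| <= l / 8 -> `|v| <= V -> - (y * v) <= l / 8 * V.
  move=> hy hv; apply: le_trans (ler_norm _) _; rewrite normrN normrM.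
  exact: ler_pM.
by have := b _ _ h1 k1; have := b _ _ h2 k2; lra.
Qed.

Let abs_sum_le (d r l : R) : `|d| <= l -> `|r| <= l / 8 -> l <= 1 / 2 -> `|d + r| <= 1.
Proof. by move=> h1 h2 h3; have := ler_normD d r; lra. Qed.

(** The velocity modulus applies only while the two points differ by at most 1 in each coordinate.
    This is bootstrapped: with drift at most [l / 8] and [l <= 1/2] it holds, and then with
    [V = Kvel B * y] the squared drift grows at rate at most [l V / 2]. As [(t1 - t0) V <= l / 64],
    it reaches at most [l^2 / 128], below the trap value [(l / 8)^2]. *)
Lemma trajectory_drift (B y l t0 t1 : R) (a b : R * R) :
  live Tstar t0 -> live Tstar t1 -> t0 <= t1 ->
  (forall t x, t0 <= t <= t1 -> `|th t x| <= B) ->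
  (forall t, t0 <= t <= t1 -> expR 1 < Om t /\ ln (Om t) <= y) ->
  0 < l -> l <= 1 / 2 -> 0 < Kvel B -> (t1 - t0) * (Kvel B * y) <= l / 64 ->
  (forall i, `|pr i (a - b)| <= l) ->
  forall i, `|pr i (X a t1 t0 - X b t1 t0) - pr i (a - b)| <= l / 8.
Proof.
move=> live0 live1 t01 thB Omy l0 l1 K0 small ab.
have lf1 := live_lifespan live1.
have live_seg t : t0 <= t <= t1 -> live Tstar t.
  by move=> /andP[h1 h2]; apply: live_le h2 live1; apply: lt_le_trans h1; case: live0.
pose r i t := pr i (X a t1 t) - pr i (X b t1 t) - pr i (a - b).
pose v i t := pr i (velocity (th t) (X a t1 t)) - pr i (velocity (th t) (X b t1 t)).
have dpr i al (t : R) : t0 <= t <= t1 ->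
    is_derive t 1 (fun t => pr i (X al t1 t)) (pr i (velocity (th t) (X al t1 t))).
  move=> /live_seg lt; have h := is_derive_traj traj al lf1 lt.
  by case: i; [exact: is_derive_snd|exact: is_derive_fst].
have dr i (t : R) : t0 <= t <= t1 -> is_derive t 1 (r i) (v i t).
  move=> ht; have h1 := dpr i a t ht; have h2 := dpr i b t ht.
  have h3 : is_derive t 1 (cst (pr i (a - b)) : R -> R) 0 by exact: is_derive_cst.
  by apply: is_derive_cast (is_deriveB (is_deriveB h1 h2) h3) _; rewrite subr0.
have vle i t : t0 <= t <= t1 -> `|r false t| <= l / 8 -> `|r true t| <= l / 8 ->
    `|v i t| <= Kvel B * y.
  move=> ht h1 h2; have lf := live_lifespan (live_seg t ht); have [Oe Ole] := Omy t ht.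
  have E1 : X a t1 t = X b t1 t + (X a t1 t - X b t1 t) by rewrite addrC subrK.
  have s1 : `|(X a t1 t - X b t1 t).1| <= 1.
    by have := abs_sum_le (ab false) h1 l1; rewrite /r addrC subrK.
  have s2 : `|(X a t1 t - X b t1 t).2| <= 1.
    by have := abs_sum_le (ab true) h2 l1; rewrite /r addrC subrK.
  have [k1 k2] := velocity_diff (X b t1 t) (continuous_theta sol lf) (theta_integrable sol lf)
    (fun x => thB t x ht) (fun x h i h0 => theta_lipschitz sol x i lf Oe h0)
    (symbol_integrable sol lf) (fun x => stream_differentiable sol x lf) Oe s1 s2.
  have le : Kvel B * ln (Om t) <= Kvel B * y by rewrite ler_wpM2l// ltW.
  by rewrite /v E1; case: i; [exact: le_trans k2 le|exact: le_trans k1 le].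
have r1 i : r i t1 = 0.
  rewrite /r; have [-> _ _] := traj a lf1; have [-> _ _] := traj b lf1.
  by case: i; exact: subrr.
clearbody v.
have rle (p q : R) : p ^+ 2 + q ^+ 2 < (l / 8) ^+ 2 -> `|p| <= l / 8 /\ `|q| <= l / 8.
  have l8 : 0 <= l / 8 by rewrite divr_ge0// ltW.
  move=> h; have := sqr_ge0 p; have := sqr_ge0 q => q0 p0.
  by split; apply: norm_le_sqr => //; apply: le_trans (ltW h); rewrite ?lerDl ?lerDr.
pose e := l * (Kvel B * y) / 2.
have y0 : 0 <= y.
  have [Oe] := Omy t1 (introT andP (conj t01 (lexx _))); apply: le_trans.
  by apply: ln_ge0; apply: le_trans (ltW Oe); rewrite -expR0 ler_expR.
have e0 : 0 <= e by exact: divr_ge0 (mulr_ge0 (ltW l0) (mulr_ge0 (ltW K0) y0)) (ler0n _ 2).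
have dphi (t : R) : t0 <= t <= t1 ->
    is_derive t 1 (fun t => r false t ^+ 2 + r true t ^+ 2)
      (2 * r false t * v false t + 2 * r true t * v true t).
  by move=> ht; exact: is_derive_sumsq (dr _ _ ht) (dr _ _ ht).
have phi1 : r false t1 ^+ 2 + r true t1 ^+ 2 = 0 by rewrite !r1 expr0n /= addr0.
have fin : e * (t1 - t0) < (l / 8) ^+ 2.
  have : l * ((t1 - t0) * (Kvel B * y)) <= l * (l / 64) by rewrite ler_wpM2l// ltW.
  have : 0 < l ^+ 2 by rewrite exprn_gt0.
  by rewrite /e; move: (Kvel B * y) (t1 - t0) => V d h1 h2; nra.
have fin' : (r false t1 ^+ 2 + r true t1 ^+ 2 + e * (t1 - t0)) * expR (0 * (t1 - t0)) <
    (l / 8) ^+ 2.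
  by rewrite phi1 add0r mul0r expR0 mulr1.
have trap t : t0 <= t <= t1 -> r false t ^+ 2 + r true t ^+ 2 < (l / 8) ^+ 2 ->
    - (2 * r false t * v false t + 2 * r true t * v true t) <=
    0 * (r false t ^+ 2 + r true t ^+ 2) + e.
  move=> ht /rle[h1 h2]; apply: trap_identity => //; [exact: ltW|exact: vle|exact: vle].
have ph0 : 0 <= r false t1 ^+ 2 + r true t1 ^+ 2 by rewrite phi1.
have := gronwall_trap t01 (lexx 0) e0 dphi trap ph0 fin'.
move=> /(_ t0 (introT andP (conj (lexx _) t01))) h.
have [h1 h2] := rle _ _ (le_lt_trans h fin').
case; first exact: h2.
exact: h1.
Qed.

End Drift.

Section Growth.
Context {R : realType}.
Variables (Tstar : \bar R) (th : R -> R * R -> R) (X : R * R -> R -> R -> R * R).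
Hypothesis sol : classical_solution Tstar th.
Hypothesis traj : trajectories Tstar th X.
Notation Om t := (Omega th t).
Notation W t := (gradperp (th t)).

Let ratio_le (a m n E p q : R) : 0 < m -> 0 <= n -> m <= E * n -> `|p| <= q ->
  `|a * p| <= E * q / m * (`|a| * n).
Proof.
move=> m0 n0 h hp; have -> : E * q / m * (`|a| * n) = `|a| * q * (E * n) / m by ring.
rewrite ler_pdivlMr// normrM; apply: (ler_pM _ (ltW m0) _ h).
  exact: mulr_ge0.
exact: ler_wpM2l.
Qed.

Let Omega_le_of_increments (d D l E O0 O1 c0 : R) : 0 < l -> 0 < c0 -> 0 < O1 -> l / 4 <= `|d| ->
  `|D - d| <= l / 8 -> `|D| <= E * O0 / (c0 * O1) * l -> O1 <= 8 * E / c0 * O0.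
Proof.
move=> l0 c00 O10 h1 h2 h3.
have : l / 8 <= E * O0 / (c0 * O1) * l.
  by apply: le_trans h3; have := ler_normB D (D - d); rewrite opprB addrC subrK => h; lra.
rewrite mulrC ler_pM2r// ler_pdivlMr ?mulr_gt0// => h.
have -> : 8 * E / c0 * O0 = 8 * (E * O0) / c0 by ring.
by rewrite ler_pdivlMr//; lra.
Qed.

(** Some coordinate of the chord is at least [l / 4] at [t1]; the drift costs [l / 8], so at least
    [l / 8] is left at [t0], which gives the factor 8. The factor [expR C0 / c0] compares the
    modulus of the gradient at a point of the arc with its maximum there, then with [Omega t1]. *)
Lemma Omega_step (g : R -> R * R) (B y l c0 C0 t0 t1 : R) :
  live Tstar t0 -> live Tstar t1 -> t0 <= t1 ->
  (forall t x, t0 <= t <= t1 -> `|th t x| <= B) ->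
  (forall t, t0 <= t <= t1 -> expR 1 < Om t /\ ln (Om t) <= y) ->
  level_segment (th t1) g -> 0 < c0 -> 0 < C0 ->
  c0 * Om t1 <= max_on (curve_image g) (fun x => enorm (W t1 x)) ->
  max_on (curve_image g) (fun x => `|divergence (unit_tangent (th t1)) x|) *
    arc_length g <= C0 ->
  max_on (curve_image g)
    (fun x => enorm (advect (unit_tangent (th t1)) (unit_tangent (th t1)) x)) *
    arc_length g <= C0 ->
  0 < l -> l <= 1 / 2 -> 2 * l < arc_length g -> 2 * C0 * l <= arc_length g ->
  0 < Kvel B -> (t1 - t0) * (Kvel B * y) <= l / 64 ->
  Om t1 <= 8 * expR C0 / c0 * Om t0.
Proof.
move=> live0 live1 t01 thB Omy seg c00 C00 OmL MLC KLC l0 l1 lL ClL K0 small.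
have lf1 := live_lifespan live1; have lf0 := live_lifespan live0.
have [Oe1 _] := Omy t1 (introT andP (conj t01 (lexx _))).
have [Oe0 _] := Omy t0 (introT andP (conj (lexx _) t01)).
have O1 : 0 < Om t1 by apply: le_lt_trans Oe1; exact: expR_ge0.
have [_ _ cw1 cw2] := gradperp_theta_C1 sol.
have df x := theta_differentiable sol x live1.
have dw x : differentiable (W t1) x by have [h _ _ _] := gradperp_theta_C1 sol; exact: h.
have cw1' x : {for x, continuous ('D_(e1 R) (W t1))} := spacetime_slice cw1 lf1.
have cw2' x : {for x, continuous ('D_(e2 R) (W t1))} := spacetime_slice cw2 lf1.
have div0 x := divergence_gradperp_theta sol x lf1.
have [s0 [s1 [S [[s00 s01 s11 dS SS] [chord [i ichord]]]]]] :=
  arc_chord df dw cw1' cw2' seg MLC KLC C00 l0 lL ClL.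
have in01 s : s0 <= s <= s1 -> 0 < s < 1.
  by move=> /andP[a b]; rewrite (lt_le_trans s00 a) (le_lt_trans b s11).
have w01 (s : R) : 0 < s < 1 -> 0 <= s <= 1 by move=> /andP[a b]; rewrite !ltW.
pose lam s := speed_ratio (th t1) g s.
pose Y s := pr i (X (g s) t1 t0).
pose dY s := lam s * pr i (W t0 (X (g s) t1 t0)).
have dYE (s : R) : s0 <= s <= s1 -> is_derive s 1 Y (dY s).
  move=> ss; apply: (flow_derivative sol traj live0 live1 t01).
  rewrite -[_ *: _](arc_tangent df seg (in01 s ss)).
  exact: is_derive_arc seg _ (w01 s (in01 s ss)).
(* An upper bound for the speed of the backward image relative to that of the arc: [Omega t0] over
   the smallest gradient allowed on the arc at [t1]. *)
pose k := expR C0 * Om t0 / (c0 * Om t1).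
have dYle s : s0 <= s <= s1 -> `|dY s| <= k * enorm (derive1 g s).
  move=> ss; rewrite (arc_speed df seg (in01 s ss)) /dY -/(lam s).
  apply: ratio_le; [by rewrite mulr_gt0|exact: enorm_ge0| |].
    by apply: le_trans OmL _; exact: (arc_gradperp_comparable df dw cw1' cw2' div0 seg MLC (w01 s (in01 s ss))).
  exact: le_trans (abs_pr_le_enorm i (W t0 (X (g s) t1 t0)))
    (gradperp_le_Omega sol (X (g s) t1 t0) lf0 Oe0).
have oo (s : R) : s0 < s < s1 -> s0 <= s <= s1 by move=> /andP[a b]; rewrite !ltW.
have cY : {within `[s0, s1], continuous Y}.
  by apply: within_of_for => s /dYE; exact: is_derive1_continuous.
have dkS (s : R) : s0 <= s <= s1 -> is_derive s 1 (k *: S) (k * enorm (derive1 g s)).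
  by move=> /in01 /dS h; exact: is_deriveZ.
have ckS : {within `[s0, s1], continuous (k *: S)}.
  by apply: within_of_for => s /dkS; exact: is_derive1_continuous.
have := abs_increment_le cY ckS (fun s h => dYE s (oo s h)) (fun s h => dkS s (oo s h))
  (fun s h => dYle s (oo s h)) (lexx s0) (ltW s01) (lexx s1).
rewrite -[(_ *: S) s1]/(k * S s1) -[(_ *: S) s0]/(k * S s0) -mulrBr SS.
have drift := trajectory_drift sol traj live0 live1 t01 thB Omy l0 l1 K0 small chord i.
rewrite /k; apply: (@Omega_le_of_increments (pr i (g s1 - g s0))) => //.
suff -> : Y s1 - Y s0 = pr i (X (g s1) t1 t0 - X (g s0) t1 t0) by [].
by rewrite /Y; case: (i).
Qed.

Lemma ln_le_shift (a x z : R) : 0 < a -> 0 < x -> 0 < z -> x <= a * z -> ln x <= ln z + ln a.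
Proof.
by move=> a0 x0 z0 h; rewrite addrC -lnM ?posrE// ler_ln ?posrE// mulr_gt0.
Qed.

End Growth.

Theorem theorem2 (R : realType) (Tstar : \bar R) (theta : R -> R * R -> R)
  (X : R * R -> R -> R -> R * R)
  (gamma : R -> R -> R * R) (T0 c0 cL C0 : R)
  (theta_sol : classical_solution Tstar theta)
  (X_traj : trajectories Tstar theta X)
  (T0_life : lifespan Tstar T0)
  (gamma_seg : forall t, T0 <= t -> (t%:E < Tstar)%E ->
     level_segment (theta t) (gamma t))
  (carried : forall t0 t, T0 <= t0 -> t0 < t -> (t%:E < Tstar)%E ->
     curve_image (gamma t) `<=` (fun a => X a t0 t) @` curve_image (gamma t0))
  (Omega_gt_e : forall t, lifespan Tstar t -> expR 1 < Omega theta t)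
  (Omega_incr : forall s t, T0 <= s -> s <= t -> (t%:E < Tstar)%E ->
     Omega theta s <= Omega theta t)
  (c0_range : 0 < c0 <= 1)
  (OmegaL_ge : forall t, T0 <= t -> (t%:E < Tstar)%E ->
     c0 * Omega theta t <= max_gradperp theta gamma t)
  (cL_gt0 : 0 < cL) (C0_gt0 : 0 < C0)
  (H1' : forall t, T0 <= t -> (t%:E < Tstar)%E -> cL <= arc_length (gamma t))
  (H2 : forall t, T0 <= t -> (t%:E < Tstar)%E ->
     max_div_tangent theta gamma t * arc_length (gamma t) <= C0 /\
     max_curvature theta gamma t * arc_length (gamma t) <= C0) :
  exists C1 C2 : R, forall t, lifespan Tstar t ->
    ln (ln (Omega theta t)) <= C1 * t + C2.
Proof.
have OmE t : lifespan Tstar t -> sup_grad theta t = (Omega theta t)%:E.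
  move=> lt; have := Omega_gt_e t lt; rewrite /Omega; case: (sup_grad theta t) => [r //| |] /=.
    by rewrite ltNge expR_ge0.
  by rewrite ltNge expR_ge0.
(* [T0] may be 0, where trajectories are only continuous; the growth argument therefore starts at a
   later positive time [T1]. *)
have [T1 T01 live1] := lifespan_gt T0_life.
have lf1 := live_lifespan live1; have T1pos : 0 < T1 by case: live1.
have liveP t : T1 <= t -> (t%:E < Tstar)%E -> live Tstar t.
  by move=> Tt tT; split => //; exact: lt_le_trans Tt.
have [B thB1] := theta_bounded theta_sol lf1 (Omega_gt_e T1 lf1).
(* The trajectory through [x] at time [t] is followed back to [T1], so a bound at this single time,
   obtained from the L^1 norm and the gradient, serves for all later ones. *)
have thB t x : T1 <= t -> (t%:E < Tstar)%E -> `|theta t x| <= B.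
  move=> Tt tT; have lt := liveP t Tt tT; have lf := live_lifespan lt.
  have [Xt _ _] := X_traj x t lf.
  by rewrite -{1}Xt (theta_conserved theta_sol X_traj x lf live1 Tt lt).
have K0 : 0 < Kvel B.
  have B0 : 0 <= B := le_trans (normr_ge0 _) (thB1 0).
  have kd : 0 < @Kdiff R := lt_le_trans ltr01 Kdiff_ge1.
  have B1 : 0 < 1 + B by apply: ltr_wpDr.
  exact: mulr_gt0 (mulr_gt0 (ltr0n _ 64) (exprn_gt0 2 kd)) B1.
(* In the denominator below, [2 * cL] gives [l <= 1/2], the 4 gives [2 * l < cL], and [2 * C0] gives
   the condition on the curvature. *)
have [l [l0 l1 l2 l3]] : exists l, [/\ 0 < l, l <= 1 / 2, 2 * l < cL & 2 * C0 * l <= cL].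
  have D0 : 0 < 2 * C0 + 2 * cL + 4 by lra.
  exists (cL / (2 * C0 + 2 * cL + 4)); split.
  - exact: divr_gt0.
  - by rewrite ler_pdivrMr//; lra.
  - by rewrite mulrA ltr_pdivrMr//; nra.
  - by rewrite mulrA ler_pdivrMr//; nra.
have /andP[c00 c01] := c0_range.
pose A := 8 * expR C0 / c0.
have A1 : 1 < A.
  rewrite ltr_pdivlMr// mul1r; apply: le_lt_trans c01 _.
  by have : 1 < expR C0 by [rewrite expR_gt1]; lra.
have y_ge1 t : T1 <= t -> (t%:E < Tstar)%E -> 1 <= ln (Omega theta t).
  move=> Tt tT; have := Omega_gt_e t (live_lifespan (liveP t Tt tT)) => h.
  rewrite -[leLHS](expRK (1 : R)) ler_ln ?posrE ?expR_gt0 ?ltW//.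
  exact: lt_trans (expR_gt0 _) h.
have incr s t : T1 <= s -> s <= t -> (t%:E < Tstar)%E -> Omega theta s <= Omega theta t.
  by move=> Ts; apply: Omega_incr; exact: le_trans (ltW T01) Ts.
have P_le s t : T1 <= s -> s <= t -> (t%:E < Tstar)%E -> (s%:E < Tstar)%E.
  by move=> _ st; apply: le_lt_trans; rewrite lee_fin.
have pos t : T1 <= t -> (t%:E < Tstar)%E -> 0 < Omega theta t.
  move=> Tt tT; apply: lt_trans (expR_gt0 1) _.
  exact: Omega_gt_e (live_lifespan (liveP t Tt tT)).
have y_incr s t : T1 <= s -> s <= t -> (t%:E < Tstar)%E ->
    ln (Omega theta s) <= ln (Omega theta t).
  move=> Ts st tT; rewrite ler_ln ?posrE; [exact: incr|exact: pos (P_le s t Ts st tT)|].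
  by apply: pos tT; exact: le_trans st.
have y_step s t : T1 <= s -> s < t -> (t%:E < Tstar)%E ->
    (t - s) * ln (Omega theta t) <= l / 64 / Kvel B ->
    ln (Omega theta t) <= ln (Omega theta s) + ln A.
  move=> Ts st tT h; have Tt := le_trans Ts (ltW st); have sT := P_le s t Ts (ltW st) tT.
  have T0t : T0 <= t := le_trans (ltW T01) Tt.
  have cLt := H1' t T0t tT; have [h1 h2] := H2 t T0t tT.
  have step : Omega theta t <= A * Omega theta s.
    apply: (@Omega_step _ Tstar theta X theta_sol X_traj (gamma t) B (ln (Omega theta t)) l).
    - exact: liveP.
    - exact: liveP.
    - exact: ltW.
    - move=> z x /andP[sz zt]; apply: thB; first exact: le_trans sz.
      exact: P_le (le_trans Ts sz) zt tT.
    - move=> z /andP[sz zt]; have Tz := le_trans Ts sz; have zT := P_le z t Tz zt tT.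
      by split; [exact: Omega_gt_e (live_lifespan (liveP z Tz zT))|exact: y_incr].
    - exact: gamma_seg.
    - exact: c00.
    - exact: C0_gt0.
    - exact: OmegaL_ge.
    - exact: h1.
    - exact: h2.
    - exact: l0.
    - exact: l1.
    - exact: lt_le_trans cLt.
    - exact: le_trans cLt.
    - exact: K0.
    - by rewrite (mulrC (Kvel B)) mulrA -(ler_pdivlMr _ _ K0).
  have os := pos s Ts sT; have ot := pos t Tt tT; have A0 := lt_trans ltr01 A1.
  exact: ln_le_shift.
have lnA : 0 < ln A by exact: ln_gt0.
have c1 : 0 < l / 64 / Kvel B by rewrite !divr_gt0.
have [a [b [a0 hab]]] := growth_log P_le lnA c1 y_ge1 y_incr y_step (proj2 live1).
have [D hD] := local_bounds theta_sol lf1.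
(* On [[0, T1]] the local bound [D] on the gradient replaces the growth estimate; absolute values
   and [0 <= a] let the same two constants serve before and after [T1]. *)
exists a, (`|b| + `|ln (ln D)|) => t lt; have [t0 tT] := lt.
have [Tt|/ltW tT1] := leP T1 t.
  apply: le_trans (hab t Tt tT) _; rewrite lerD2l.
  by apply: le_trans (ler_norm b) _; rewrite lerDl.
have eO := Omega_gt_e t lt.
have OD : Omega theta t <= D.
  by have [|_] := hD t; [rewrite t0 tT1|rewrite OmE// lee_fin].
have O0 : 0 < Omega theta t := lt_trans (expR_gt0 1) eO.
have le1 : ln (Omega theta t) <= ln D by rewrite ler_ln// posrE (lt_le_trans O0 OD).
have ln0 : 0 < ln (Omega theta t).
  by apply: ln_gt0; apply: lt_trans eO; rewrite expR_gt1.
have : ln (ln (Omega theta t)) <= ln (ln D).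
  by rewrite ler_ln// posrE (lt_le_trans ln0 le1).
move=> h; apply: le_trans h _; apply: le_trans (ler_norm _) _.
by rewrite addrA lerDr addr_ge0// mulr_ge0.
Qed.
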